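(* Let $W_q$ be a random variable taking values in $\{0,1,2,\dots\}$ such that, for all $x>0$, \[ P\Big(\tfrac{W_q}{2}\ge x,\ W_q\text{ even}\Big)=h_1(\lceil x\rceil)e^{-\nu\lceil x\rceil},\qquad P\Big(\tfrac{W_q-1}{2}\ge x,\ W_q\text{ odd}\Big)=h_2(\lceil x\rceil)e^{-\nu\lceil x\rceil}, \] where $\nu>0$ and $h_1,h_2$ are positive functions on $(0,\infty)$ such that $h_2(x)/h_1(x)\to c_1$ as $x\to\infty$ for some fixed $c_1\ge 0$, and $h_1(ax)/h_1(x)\to 1$ as $x\to\infty$, $a\to 1$. Let \[ X=L(e^{W_q})\,e^{\beta W_q}(-1)^{W_q}, \] where $\beta>0$ and $L$ is a slowly varying function at $\infty$ such that $n\mapsto L(e^n)$ is ultimately monotonically increasing, and suppose $\alpha:=\nu/(2\beta)<2$. Let $X_1,X_2,\dots$ be i.i.d. copies of $X$, let $F$ be the distribution function of $X$, $Q(s)=\inf\{y: F(y)\ge s\}$ for $0\le s\le 1$, and set \[ k_n=\Big\lceil \frac{e^{(n-1)\nu}}{h_1(n-1)}\Big\rceil,\qquad A_{k_n}=L(e^{2n-2})e^{2\beta(n-1)},\qquad B_{k_n}=k_n\int_{1/k_n}^{1-1/k_n}Q(s)\,ds . \] Then, as $n\to\infty$, \[ \frac{1}{A_{k_n}}\Big\{\sum_{j=1}^{k_n}X_j-B_{k_n}\Big\} \] converges in distribution to a non-Gaussian semi-stable law, namely the semi-stable law characterized (in the sense described in the context) by the index $\alpha=\nu/(2\beta)$ and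 the functions \[ M_L(-x)=c_1\exp\Big(-\nu\Big(\Big[\tfrac12+\tfrac{1}{2\beta}\log x\Big]-\tfrac{1}{2\beta}\log x\Big)\Big),\qquad M_R(x)=\exp\Big(-\nu\Big(\Big\lceil \tfrac{1}{2\beta}\log x\Big\rceil_{+}-\tfrac{1}{2\beta}\log x\Big)\Big),\qquad x>0, \] with location parameter $\eta=\Theta(\psi_1)-\Theta(\psi_2)$.
   Context: Notation: $\lceil x\rceil$ is the smallest integer $\ge x$; $\lceil x\rceil_{+}$ is the smallest integer strictly larger than $x$ (so $\lceil x\rceil_+=[x]+1$); $[x]$ is the integer part (largest integer $\le x$). Semi-stable law characterized by $\alpha\in(0,2)$ and functions $M_L$ on $(-\infty,0)$, $M_R$ on $(0,\infty)$: put $\Lambda_L(x)=M_L(x)/|x|^{\alpha}$ for $x<0$ and $\Lambda_R(x)=-M_R(x)/x^{\alpha}$ for $x>0$. It is the infinitely divisible distribution without Gaussian part whose characteristic function $\hat\mu$ satisfies \[ \log\hat\mu(t)=i\eta t+\int_{-\infty}^0\Big(e^{itx}-1-\frac{itx}{1+x^2}\Big)d\Lambda_L(x)+\int_0^{\infty}\Big(e^{itx}-1-\frac{itx}{1+x^2}\Big)d\Lambda_R(x), \] where the location is $\eta=\Theta(\psi_1)-\Theta(\psi_2)$ with $\Theta(\psi_i)=\int_0^1\frac{\psi_i(s)}{1+\psi_i^2(s)}ds-\int_1^\infty\frac{\psi_i^3(s)}{1+\psi_i^2(s)}ds$, $\psi_1(s)=\inf_{x<0}\{\Lambda_L(x)>s\}$,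 $\psi_2(s)=\inf_{x<0}\{-\Lambda_R(-x)>s\}$. *)

(* Defs.v *)
From HB Require Import structures.
From mathcomp Require Import all_boot all_order all_algebra.
From mathcomp Require Import all_classical all_reals all_analysis.
Set Implicit Arguments. Unset Strict Implicit. Unset Printing Implicit Defensive.
Import Order.TTheory GRing.Theory Num.Theory.
Import numFieldNormedType.Exports.
Local Open Scope classical_set_scope.
Local Open Scope ring_scope.

Definition mutually_independent d (Omega : measurableType d) (R : realType)
  (P : probability Omega R) (Xs : nat -> {RV P >-> R}) : Prop :=
  forall (s : seq nat) (B : nat -> set R), uniq s ->
    (forall i, measurable (B i)) ->
    fine (P (\bigcap_(i in [set` s]) (Xs i @^-1` B i))) =
    \prod_(i <- s) fine (P (Xs i @^-1` B i)).

Definition same_law d (Omega : measurableType d) (R : realType)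
  (P : probability Omega R) (Y X : Omega -> R) : Prop :=
  forall B : set R, measurable B -> P (Y @^-1` B) = P (X @^-1` B).

Definition cdf (R : realType) (mu : probability R R) (y : R) : R :=
  fine (mu [set` `]-oo, y]]).

Definition cvg_in_distribution d (Omega : measurableType d) (R : realType)
  (P : probability Omega R) (Y : nat -> Omega -> R) (mu : probability R R) : Prop :=
  forall y : R, {for y, continuous (cdf mu)} ->
    (fun n => fine (P [set w | Y n w <= y])) @ \oo --> cdf mu y.

Definition slowly_varying (R : realType) (L : R -> R) : Prop :=
  (\forall x \near +oo, 0 < L x) /\
  forall lam : R, 0 < lam -> (fun x => L (lam * x) / L x) @ +oo --> (1 : R).

Section SemiStable.
Variables (R : realType) (alpha : R) (ML MR : R -> R).

Definition LambdaL (x : R) : R := ML x / powR `|x| alpha.   (* x < 0 *)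
Definition LambdaR (x : R) : R := - (MR x / powR x alpha).  (* x > 0 *)

(* inf of the empty set is 0 in MathComp-Analysis *)
Definition psi1 (s : R) : R := inf [set x | x < 0 /\ s < LambdaL x].
Definition psi2 (s : R) : R := inf [set x | x < 0 /\ s < - LambdaR (- x)].

Definition Theta (psi : R -> R) : R :=
  Rintegral lebesgue_measure `[0, 1] (fun s => psi s / (1 + psi s ^+ 2)) -
  Rintegral lebesgue_measure `[1, +oo[ (fun s => psi s ^+ 3 / (1 + psi s ^+ 2)).

Definition eta_loc : R := Theta psi1 - Theta psi2.

(* nu is the Levy measure on R \ {0} given by the Stieltjes measures
   dLambdaL on (-oo,0) and dLambdaR on (0,+oo) *)
Definition levy_measure_of (nu : {measure set R -> \bar R}) : Prop :=
  nu [set 0] = 0%E /\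
  (forall y : R, y < 0 -> nu [set` `]-oo, y[] = (LambdaL y)%:E) /\
  (forall x : R, 0 < x -> nu [set` `]x, +oo[] = (- LambdaR x)%:E).

(* mu is the infinitely divisible law without Gaussian part with
   log mu^(t) = i eta t + int (e^{itx} - 1 - itx/(1+x^2)) dLambda(x),
   written through real and imaginary parts:
   mu^(t) = exp(Re) (cos(Im) + i sin(Im)). *)
Definition semistable_law (mu : probability R R) : Prop :=
  exists nu : {measure set R -> \bar R}, levy_measure_of nu /\
  forall t : R,
    let D := `]-oo, 0[ `|` `]0, +oo[ in
    let re := Rintegral nu D (fun x => cos (t * x) - 1) in
    let im := eta_loc * t +
              Rintegral nu D (fun x => sin (t * x) - t * x / (1 + x ^+ 2)) in
    Rintegral mu setT (fun x => cos (t * x)) = expR re * cos im /\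
    Rintegral mu setT (fun x => sin (t * x)) = expR re * sin im.
End SemiStable.

(* Main.v *)
Require Import Defs.
From HB Require Import structures.
From mathcomp Require Import all_boot all_order all_algebra.
From mathcomp Require Import all_classical all_reals all_analysis.
From mathcomp Require Import measurable_realfun ring lra.
From mathcomp Require Import complex.
Import Order.TTheory GRing.Theory Num.Theory.
Import numFieldNormedType.Exports.
Local Open Scope classical_set_scope.
Local Open Scope ring_scope.

(** Write [m] for the law of [X], [Q] for its quantile function, [k] and [A] for
    [k_n] and [A_{k_n}], and [b = B / (k A)].  The substitutions [u = k s] and
    [u = k (1 - s)] turn [k E g(X/A)] into the integral over [u > 0] of [g] along
    the two rescaled quantiles [Q(u/k)/A] and [Q(1 - u/k)/A], and turn [k b] into
    the integral over [u >= 1] of the positive part of the second minus the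
    negative part of the first.  Along [k_n] the tails
    [k P(X > x A)] and [k P(X <= - x A)] converge, off a discrete set of [x], to
    geometric step functions; hence the rescaled quantiles converge for almost
    every [u], to [psi_1] and [- psi_2].  A bound [k P(|X| > x A) <= C x^-a] with
    [a < 2] dominates them by [K u^(-1/a)], whose square is integrable at
    infinity, so that dominated convergence yields the limits of
    [k (E exp(it(X/A - b)) - 1)].  The characteristic function of the normalized
    sum is the [k]-th power of [E exp(it(X/A - b))] and Levy's continuity theorem
    concludes. *)

Set Implicit Arguments.
Unset Strict Implicit.
Unset Printing Implicit Defensive.

(** The atoms of [X] are spaced geometrically, so its tails oscillate on the logarithmic scale;
    [k_n] is essentially the reciprocal of a tail of [W] over even values, which makes [k] times
    either parity tail at index [N + j] converge for each fixed integer [j]. Two obstacles shape the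
    proof. The slowly varying factors may spoil a bound with exponent [nu / (2 * beta)] itself, so
    [a] is taken halfway between it and 2. The sequence [k b] may diverge, so the centering cannot
    pass to the limit alone. However, with [trunc1 y = y / (1 + y ^ 2)], the difference
    [k E trunc1(X/A) - k b] is eventually equal to [Theta] of the upper array minus [Theta] of the
    lower one, and [Theta] is continuous under the domination; moreover [k b ^ 2] tends to 0, which
    makes the other effects of the shift by [b] negligible. The Levy measure is defined as the image
    of Lebesgue measure under the two limiting quantiles. The limits found by dominated convergence
    are then integrals against it by change of variables, without a separate study of its
    singularity at 0. *)

Local Notation cdf := Defs.cdf.

(** * Integration *)

Section integration.
Context d (T : measurableType d) (R : realType).

Lemma Rintegral_dct (mu : {measure set T -> \bar R}) (D : set T)
    (f_ : nat -> T -> R) (f g : T -> R) : measurable D ->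
  (forall n, measurable_fun D (f_ n)) -> measurable_fun D f ->
  {ae mu, forall x, D x -> f_ ^~ x @ \oo --> f x} ->
  mu.-integrable D (EFin \o g) ->
  (\forall n \near \oo, forall x, D x -> `|f_ n x| <= g x) ->
  (fun n => \int[mu]_(x in D) f_ n x) @ \oo --> \int[mu]_(x in D) f x.
Proof.
move=> mD mf_ mf ff ig [N _ dom].
(* Domination is only assumed from [N] on, hence the shift of the sequence. *)
rewrite -(cvg_shiftn N); apply: fine_cvg.
have [|||||If _ cvgf] := @dominated_convergence _ _ _ mu D mD
  (fun n x => (f_ (n + N)%N x)%:E) (EFin \o f) (EFin \o g).
- by move=> n; apply/measurable_EFinP.
- exact/measurable_EFinP.
- apply: filterS ff => x fx Dx /=; apply: cvg_EFin; first exact: nearW.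
  by rewrite (cvg_shiftn N (f_ ^~ x)); exact: fx.
- exact: ig.
- by apply: aeW => x n Dx /=; rewrite lee_fin; apply: dom => //=; rewrite leq_addl.
rewrite fineK; first exact: cvgf.
exact: integrable_fin_num.
Qed.

Lemma integrable_bounded (mu : {measure set T -> \bar R}) (D : set T)
    (f g : T -> R) : measurable D -> measurable_fun D f ->
  mu.-integrable D (EFin \o g) -> (forall x, D x -> `|f x| <= g x) ->
  mu.-integrable D (EFin \o f).
Proof.
move=> mD mf ig fg; apply: le_integrable ig => //; first exact/measurable_EFinP.
by move=> x Dx /=; rewrite lee_fin (le_trans (fg _ Dx))// ler_norm.
Qed.

Lemma ge0_integral_mrestr (mu : {measure set T -> \bar R}) (D : set T)
    (mD : measurable D) (f : T -> \bar R) : measurable_fun setT f ->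
  (forall x, 0 <= f x)%E ->
  (\int[mrestr mu mD]_x f x = \int[mu]_(x in D) f x)%E.
Proof.
move=> mf f0; transitivity (\int[mrestr mu mD]_(x in D) f x)%E; last first.
  apply: eq_measure_integral => A mA AD.
  by rewrite /= /mrestr setIidl.
rewrite (@ge0_negligible_integral _ _ _ _ setT (~` D))//.
- by rewrite setTD setCK.
- exact: measurableC.
- by rewrite /= /mrestr setICl measure0.
Qed.

(** [m] has to be the image of [mu] on subsets of [E] only. This covers the Levy measure, an image
    of Lebesgue measure under a different map on each half-line. The formula is proved for
    non-negative functions, then applied to positive and negative parts. *)
Lemma integral_image_measure d' (T' : measurableType d')
    (mu : {measure set T -> \bar R}) (D : set T) (q : T -> T')
    (m : {measure set T' -> \bar R}) (E : set T') (f : T' -> \bar R) :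
  measurable D -> measurable_fun D q ->
  (forall B, measurable B -> B `<=` E -> m B = mu (D `&` q @^-1` B)) ->
  measurable E -> measurable_fun E f ->
  (\int[m]_(y in E) f y = \int[mu]_(x in D `&` q @^-1` E) f (q x))%E.
Proof.
move=> mD mq mE' mE.
have mDq : measurable (D `&` q @^-1` E) by exact: mq.
have ge0 (g : T' -> \bar R) : measurable_fun E g -> (forall y, 0 <= g y)%E ->
    (\int[m]_(y in E) g y = \int[mu]_(x in D `&` q @^-1` E) g (q x))%E.
  move=> mg g0.
  (* Extending [q] by zero gives a total map, for which the pushforward is defined; restricting [mu]
     to [D] discards the artificial values. *)
  have mq' : measurable_fun setT (q \_ D) by apply/(measurable_restrictT _ _).1.
  have mgE : measurable_fun setT (g \_ E) by apply/(measurable_restrictT _ _).1.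
  have gE0 y : (0 <= (g \_ E) y)%E by rewrite patchE; case: ifP.
  transitivity (\int[pushforward (mrestr mu mD) (q \_ D)]_(y in E) (g \_ E) y)%E.
    rewrite (eq_measure_integral (pushforward (mrestr mu mD) (q \_ D))).
      by apply: eq_integral => y yE; rewrite patchE yE.
    move=> A mA AE; rewrite mE'//= /pushforward /mrestr; congr (mu _).
    apply/seteqP; split=> x /=; first by move=> [Dx Aq]; rewrite patchE mem_set.
    by rewrite patchE => -[+ Dx]; rewrite mem_set.
  rewrite ge0_integral_pushforward//; last exact: measurable_funS mgE.
  have mE'' : measurable ((q \_ D) @^-1` E).
    by rewrite -[X in measurable X]setTI; exact: mq'.
  rewrite integral_mkcond ge0_integral_mrestr//; last 2 first.
    apply/(measurable_restrictT _ _).1 => //.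
    by apply: measurableT_comp => //; exact: measurable_funTS.
    by move=> x; rewrite patchE; case: ifP => // _; exact: gE0.
  rewrite integral_mkcond [RHS]integral_mkcond; apply: eq_integral => x _.
  rewrite !patchE in_setI; case: (boolP (x \in D)) => //= xD.
  have -> : (x \in (q \_ D) @^-1` E) = (x \in q @^-1` E).
    by apply/idP/idP => /set_mem xE; apply/mem_set;
       move: xE; rewrite /= patchE xD.
  by case: ifP => // /set_mem/= qE; rewrite !patchE xD mem_set.
move=> mf; rewrite [LHS]integralE [RHS]integralE; congr (_ - _)%E.
  rewrite ge0//; first by apply: eq_integral => x _; rewrite !funeposE.
  exact: measurable_funepos.
rewrite ge0//; first by apply: eq_integral => x _; rewrite !funenegE.
exact: measurable_funeneg.
Qed.

Lemma integrable_image_measure d' (T' : measurableType d')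
    (mu : {measure set T -> \bar R}) (D : set T) (q : T -> T')
    (m : {measure set T' -> \bar R}) (E : set T') (f : T' -> \bar R) :
  measurable D -> measurable_fun D q ->
  (forall B, measurable B -> B `<=` E -> m B = mu (D `&` q @^-1` B)) ->
  measurable E -> measurable_fun E f ->
  mu.-integrable (D `&` q @^-1` E) (f \o q) -> m.-integrable E f.
Proof.
move=> mD mq mE' mE mf /integrableP[_ fi]; apply/integrableP; split=> //.
rewrite (integral_image_measure mD mq mE')//; exact: measurableT_comp.
Qed.

End integration.

Lemma measure_itvNy_unique (R : realType) (m1 m2 : {measure set R -> \bar R}) :
  (m1 setT < +oo)%E ->
  (forall y, m1 `]-oo, y]%classic = m2 `]-oo, y]%classic) ->
  forall A, measurable A -> m1 A = m2 A.
Proof.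
move=> m1oo m12.
pose G : set (set R) := [set A | exists y : R, A = `]-oo, y]%classic].
pose g (n : nat) : set R := `]-oo, n%:R]%classic.
apply: (@measure_unique _ _ _ G g).
- have mG : @measurable _ R = <<s @RGenOInfty.G R>>.
    exact: RGenOInfty.measurableE.
  apply/seteqP; split.
  + rewrite mG; apply: smallest_sub.
      exact: smallest_sigma_algebra.
    move=> _ [x ->]; rewrite -setCitvl; apply: sigma_algebraC.
    by apply: sub_sigma_algebra; exists x.
  + apply: smallest_sub; first exact: sigma_algebra_measurable.
    by move=> _ [y ->]; exact: measurable_itv.
- move=> _ _ [x ->] [y ->]; exists (Order.min x y).
  apply/seteqP; split=> z /=; rewrite !in_itv/= le_min.
    by move=> [-> ->].
  by move=> /andP[-> ->].
- by move=> n; exists n%:R.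
- apply/seteqP; split=> // x _; exists (Num.truncn `|x|).+1 => //; rewrite /g/=.
  by rewrite in_itv/= (le_trans (ler_norm _))// ltW// truncnS_gt.
- by move=> _ [y ->].
- move=> n; apply: le_lt_trans m1oo; apply: le_measure; rewrite ?inE//.
  exact: measurable_itv.
Qed.

Lemma integrable_bounded_itv (R : realType) (a b M : R) (E : set R) (f : R -> R) :
  measurable E -> E `<=` `[a, b] -> measurable_fun E f ->
  (forall x, E x -> `|f x| <= M) -> lebesgue_measure.-integrable E (EFin \o f).
Proof.
move=> mE Eab mf fM; apply: measurable_bounded_integrable => //.
  apply: (@le_lt_trans _ _ (lebesgue_measure `[a, b]%classic)).
    by apply: le_measure; rewrite ?inE//; exact: measurable_itv.
  by rewrite /= lebesgue_measure_itv/=; case: ifP; rewrite ?ltry.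
exists M; split; first exact: num_real.
by move=> N MN x Ex; apply: le_trans (fM x Ex) (ltW MN).
Qed.

Lemma Rintegral_image d (T : measurableType d) (R : realType)
    (mu : {measure set T -> \bar R}) (D : set T) (X : T -> R)
    (m : {measure set R -> \bar R}) (f : R -> R) :
  measurable D -> measurable_fun D X ->
  (forall B, measurable B -> m B = mu (D `&` X @^-1` B)) ->
  measurable_fun setT f -> \int[m]_x f x = \int[mu]_(w in D) f (X w).
Proof.
move=> mD mX mE mf; rewrite /Rintegral; congr fine.
rewrite (@integral_image_measure _ T R _ _ mu D X m setT (EFin \o f))//.
- by rewrite preimage_setT setIT.
- by move=> B mB _; exact: mE.
- exact/measurable_EFinP.
Qed.

Lemma Rintegral_law d (T : measurableType d) (R : realType) (P : {measure set T -> \bar R})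
    (X : T -> R) (m : {measure set R -> \bar R}) (f : R -> R) :
  measurable_fun setT X -> (forall B, measurable B -> m B = P (X @^-1` B)) ->
  measurable_fun setT f -> \int[m]_x f x = \int[P]_w f (X w).
Proof. by move=> mX mE; apply: Rintegral_image => // B mB; rewrite setTI; exact: mE. Qed.

(** * Quantile functions *)

Section quantile.
Context (R : realType).

Let idR : R -> R := idfun.

(** On the probability space [R] with law [m], the identity is a random variable with distribution
    function [cdf m]; general facts on distribution functions thus transfer to [cdf m]. *)
#[local] HB.instance Definition _ :=
  @isMeasurableFun.Build _ _ _ _ idR (@measurable_id _ _ setT).

Implicit Types (F : R -> R) (m : probability R R).

Definition quantile F (s : R) : R := inf [set y | s <= F y].

Lemma cdfE m y : m `]-oo, y]%classic = (cdf m y)%:E.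
Proof. by rewrite fineK// fin_num_measure//; exact: measurable_itv. Qed.

Lemma cdf_ge0 m y : 0 <= cdf m y.
Proof. by rewrite fine_ge0. Qed.

Lemma cdf_le1 m y : cdf m y <= 1.
Proof. by rewrite -lee_fin -cdfE probability_le1//; exact: measurable_itv. Qed.

Lemma le_cdf m : {homo cdf m : x y / x <= y}.
Proof.
move=> x y xy; rewrite -lee_fin -!cdfE.
apply: le_measure; rewrite ?inE; [exact: measurable_itv..|].
exact: subset_itvl.
Qed.

Lemma EFin_cdf m y : random_variable.cdf (idR : {RV m >-> R}) y = (cdf m y)%:E.
Proof. by rewrite -cdfE. Qed.

Lemma cvg_cdfy m : cdf m @ +oo --> (1 : R).
Proof.
apply: fine_cvg; have := @cvg_cdfy1 _ _ _ m (idR : {RV m >-> R}).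
by under eq_cvg do rewrite EFin_cdf -cdfE.
Qed.

Lemma cvg_cdfNy m : cdf m @ -oo --> (0 : R).
Proof.
apply: fine_cvg; have := @cvg_cdfNy0 _ _ _ m (idR : {RV m >-> R}).
by under eq_cvg do rewrite EFin_cdf -cdfE.
Qed.

Lemma cdf_proper m (s : R) : 0 < s -> s < 1 ->
  (exists y, s <= cdf m y) /\ (exists b, forall y, s <= cdf m y -> b <= y).
Proof.
move=> s0 s1; split.
  have : \forall y \near +oo, s < cdf m y.
    by apply: (cvgr_gt (1 : R)) => //; exact: cvg_cdfy.
  by move=> [y [_ /(_ (y + 1))]]; rewrite ltrDl ltr01 => /(_ isT)/ltW; exists (y + 1).
have : \forall y \near -oo, cdf m y < s.
  by apply: (cvgr_lt (0 : R)) => //; exact: cvg_cdfNy.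
move=> [b [_ bP]]; exists b => y sy; rewrite leNgt; apply/negP => /bP/=.
by rewrite ltNge sy.
Qed.

Lemma cdf_right_cvg m (y e : R) : 0 < e ->
  exists2 z, y < z & cdf m z < cdf m y + e.
Proof.
move=> e0.
have cF : cdf m z @[z --> y^'+] --> cdf m y.
  apply: fine_cvg; have := @cdf_right_continuous _ _ _ m (idR : {RV m >-> R}) y.
  by rewrite EFin_cdf; under eq_cvg do rewrite EFin_cdf -cdfE.
have : \forall z \near y^'+, cdf m z < cdf m y + e.
  by apply: (cvgr_lt (cdf m y)) => //; rewrite ltrDl.
move=> H; have [z [yz Fz]] : exists z, y < z /\ cdf m z < cdf m y + e.
  by apply: (@filter_ex _ (y^'+)); near=> z; split; near: z;
    [exact: nbhs_right_gt|exact: H].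
by exists z.
Unshelve. all: by end_near. Qed.

(** Galois connection: by right continuity the infimum is attained. Later comparisons of quantiles
    with thresholds reduce to it. *)
Lemma quantile_le m (s y : R) : 0 < s -> s < 1 ->
  (quantile (cdf m) s <= y) = (s <= cdf m y).
Proof.
move=> s0 s1; have [[y0 sy0] [b bP]] := cdf_proper m s0 s1.
have hi : has_inf [set y | s <= cdf m y] by split; [exists y0 | exists b].
apply/idP/idP => [qy|sy]; last by apply: ge_inf => //; case: hi.
rewrite leNgt; apply/negP => Fs.
(* If [cdf m y < s], some [z > y] still has [cdf m z < s], whereas the infimum forces the level [s]
   to be reached before [z]. *)
have [z yz Fz] := @cdf_right_cvg m y (s - cdf m y) ltac:(by rewrite subr_gt0).
have e0 : 0 < z - quantile (cdf m) s by rewrite subr_gt0 (le_lt_trans qy).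
have [x /= sx] := inf_adherent e0 hi.
rewrite -/(quantile _ _) addrC subrK => xz.
by have := le_lt_trans (le_trans sx (le_cdf m (ltW xz))) Fz; rewrite addrC subrK ltxx.
Qed.

Lemma quantile_mono m (s t : R) : 0 < s -> s <= t -> t < 1 ->
  quantile (cdf m) s <= quantile (cdf m) t.
Proof.
move=> s0 st t1; rewrite quantile_le//; last exact: le_lt_trans t1.
by apply: (le_trans st); rewrite -quantile_le//; exact: lt_le_trans st.
Qed.

Lemma measurable_fun_itvNy (D : set R) (q : R -> R) : measurable D ->
  (forall y, measurable (D `&` q @^-1` `]-oo, y]%classic)) ->
  measurable_fun D q.
Proof.
move=> mD mq; apply: (measurability (@RGenOInfty.G R)) => [|/= _ [_ [y ->] <-]].
  exact: RGenOInfty.measurableE.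
rewrite (_ : _ `&` _ = D `\` (D `&` q @^-1` `]-oo, y]%classic)).
  exact: measurableD.
apply/seteqP; split=> x /=; rewrite !in_itv/= ?andbT.
  by move=> [Dx yq]; split=> // -[_]; rewrite leNgt yq.
by move=> [Dx H]; split=> //; rewrite ltNge; apply/negP => H'; exact: H.
Qed.

Variables (m : probability R R) (k : R).
Hypothesis k0 : 0 < k.
Let F := cdf m.
Let ql u := quantile F (u / k).
Let qr u := quantile F (1 - u / k).

Let div_itv u : `]0, k[%classic u -> (0 < u / k) /\ (u / k < 1).
Proof.
by rewrite /= in_itv/= => /andP[u0 uk]; rewrite divr_gt0// ltr_pdivrMr// mul1r.
Qed.

Lemma quantilel_preimage y :
  `]0, k[ `&` ql @^-1` `]-oo, y] = `]0, k[ `&` `]-oo, k * F y].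
Proof.
apply/seteqP; split=> u [uk /=]; rewrite !in_itv/= => H; split=> //.
  have [u0 u1] := div_itv uk; move: H.
  by rewrite /ql quantile_le// ler_pdivrMr// mulrC.
have [u0 u1] := div_itv uk; rewrite /ql quantile_le// ler_pdivrMr//.
by rewrite mulrC.
Qed.

Lemma quantiler_preimage y :
  `]0, k[ `&` qr @^-1` `]-oo, y] = `]0, k[ `&` `[k * (1 - F y), +oo[.
Proof.
have E u : (1 - u / k <= F y) = (k * (1 - F y) <= u).
  by rewrite lerBlDr -lerBlDl ler_pdivlMr// mulrC.
apply/seteqP; split=> u [uk /=]; rewrite !in_itv/= ?andbT => H; split=> //.
  have [u0 u1] := div_itv uk; move: H.
  by rewrite /qr quantile_le ?E// ?subr_gt0// gtrBl.
have [u0 u1] := div_itv uk.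
by rewrite /qr quantile_le ?E// ?subr_gt0// gtrBl.
Qed.

Lemma measurable_quantilel : measurable_fun `]0, k[ ql.
Proof.
apply: measurable_fun_itvNy => // y; rewrite quantilel_preimage.
exact: measurableI.
Qed.

Lemma measurable_quantiler : measurable_fun `]0, k[ qr.
Proof.
apply: measurable_fun_itvNy => // y; rewrite quantiler_preimage.
exact: measurableI.
Qed.

Lemma quantilel_measure y :
  lebesgue_measure (`]0, k[ `&` ql @^-1` `]-oo, y]) = (k * F y)%:E.
Proof.
rewrite quantilel_preimage; have [F1|F1] := ltP (F y) 1.
  rewrite (_ : _ `&` _ = `]0, k * F y]%classic).
    rewrite lebesgue_measure_itv/= lte_fin; case: ifPn => [_|].
      by rewrite sube0.
    rewrite -leNgt => H; congr EFin; apply/eqP.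
    by rewrite eq_le H mulr_ge0 ?cdf_ge0// ltW.
  apply/seteqP; split=> u /=; rewrite !in_itv/=.
    by move=> [/andP[-> _] ->].
  move=> /andP[u0 uF]; rewrite u0 uF; split=> //=.
  by rewrite (le_lt_trans uF)// gtr_pMr.
have -> : F y = 1 by apply/eqP; rewrite eq_le cdf_le1.
rewrite mulr1 (_ : _ `&` _ = `]0, k[%classic).
  by rewrite lebesgue_measure_itv/= lte_fin k0 sube0.
apply/seteqP; split=> u /=; rewrite !in_itv/= ?andbT; first by case.
by move=> /andP[u0 uk]; rewrite u0 uk ltW.
Qed.

Lemma quantiler_measure y :
  lebesgue_measure (`]0, k[ `&` qr @^-1` `]-oo, y]) = (k * F y)%:E.
Proof.
rewrite quantiler_preimage; have [F1|F1] := ltP (F y) 1.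
  rewrite (_ : _ `&` _ = `[k * (1 - F y), k[%classic).
    rewrite lebesgue_measure_itv/= lte_fin; case: ifPn => [_|].
      by rewrite -EFinB; congr EFin; ring.
    rewrite gtr_pMr// -leNgt => H; have -> : F y = 0.
      by apply/eqP; rewrite eq_le cdf_ge0 andbT; lra.
    by rewrite mulr0.
  apply/seteqP; split=> u /=; rewrite !in_itv/= ?andbT.
    by move=> [/andP[_ ->] ->].
  move=> /andP[uF uk]; rewrite uk uF; split=> //; rewrite andbT.
  by apply: lt_le_trans uF; rewrite mulr_gt0// subr_gt0.
have -> : F y = 1 by apply/eqP; rewrite eq_le cdf_le1.
rewrite mulr1 subrr mulr0 (_ : _ `&` _ = `]0, k[%classic).
  by rewrite lebesgue_measure_itv/= lte_fin k0 sube0.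
apply/seteqP; split=> u /=; rewrite !in_itv/= ?andbT; first by case.
by move=> /andP[u0 uk]; rewrite u0 uk ltW.
Qed.

(** Finite measures that agree on all half-lines are equal. The map [q] is abstract because the
    quantiles read from the bottom ([ql]) and from the top ([qr]) both have image [k * m]. *)
Lemma quantile_image (q : R -> R) : measurable_fun `]0, k[ q ->
  (forall y, lebesgue_measure (`]0, k[ `&` q @^-1` `]-oo, y]) = (k * F y)%:E) ->
  forall B : set R, measurable B ->
    (k%:E * m B = lebesgue_measure (`]0%R, k[ `&` q @^-1` B))%E.
Proof.
move=> mq qE B mB; have k0' := ltW k0.
have mq' : measurable_fun setT (q \_ `]0, k[%classic).
  by apply/(measurable_restrictT _ _).1.
pose m2 := pushforward (mrestr lebesgue_measure
  (measurable_itv (Interval (BRight 0) (BLeft k)))) (q \_ `]0, k[%classic).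
have m2E A : m2 A = lebesgue_measure (`]0, k[ `&` q @^-1` A).
  rewrite /m2 /pushforward /mrestr; congr (lebesgue_measure _).
  apply/seteqP; split=> x /=; rewrite ?in_itv/= patchE.
    by move=> [+ xk]; rewrite mem_set//= in_itv.
  by move=> [xk ?]; rewrite mem_set//= in_itv.
rewrite -m2E; transitivity (mscale (NngNum k0') m B); first by [].
apply: measure_itvNy_unique => //.
  by rewrite /= /mscale/= probability_setT mule1 ltry.
by move=> y; rewrite /= /mscale/= cdfE -EFinM -qE -m2E.
Qed.

Lemma integral_quantile (q : R -> R) (f : R -> \bar R) :
  measurable_fun `]0, k[ q ->
  (forall y, lebesgue_measure (`]0, k[ `&` q @^-1` `]-oo, y]) = (k * F y)%:E) ->
  measurable_fun setT f -> (forall y, 0 <= f y)%E ->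
  (k%:E * \int[m]_y f y = \int[lebesgue_measure]_(u in `]0%R, k[) f (q u))%E.
Proof.
move=> mq qE mf f0; have k0' := ltW k0.
rewrite -(@ge0_integral_mscale _ _ R m setT measurableT (NngNum k0') f)//.
rewrite (@integral_image_measure _ (measurableTypeR R) R _ R lebesgue_measure `]0, k[%classic q)//.
  by rewrite preimage_setT setIT.
by move=> B mB _; exact: (quantile_image mq qE mB).
Qed.

End quantile.

(** * Independence *)

Section bounded_measurable.
Context d (T : measurableType d) (R : realType).
Implicit Types f g : T -> R.

Definition bmeas f := measurable_fun setT f /\ exists M, forall x, `|f x| <= M.

Lemma bmeas_cst (c : R) : bmeas (fun=> c).
Proof. by split; [exact: measurable_cst | exists `|c|]. Qed.

Lemma bmeasD f g : bmeas f -> bmeas g -> bmeas (fun x => f x + g x).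
Proof.
move=> [mf [M fM]] [mg [N gN]]; split; first exact: measurable_funD.
by exists (M + N) => x; rewrite (le_trans (ler_normD _ _))// lerD.
Qed.

Lemma bmeasM f g : bmeas f -> bmeas g -> bmeas (fun x => f x * g x).
Proof.
move=> [mf [M fM]] [mg [N gN]]; split; first exact: measurable_funM.
by exists (M * N) => x; rewrite normrM ler_pM.
Qed.

Lemma bmeasZ (c : R) f : bmeas f -> bmeas (fun x => c * f x).
Proof. by move=> bf; apply: bmeasM => //; exact: bmeas_cst. Qed.

Lemma bmeasN f : bmeas f -> bmeas (fun x => - f x).
Proof.
by move=> bf; under eq_fun do rewrite -mulN1r; exact: bmeasZ.
Qed.

Lemma bmeasB f g : bmeas f -> bmeas g -> bmeas (fun x => f x - g x).
Proof. by move=> bf bg; apply: bmeasD => //; exact: bmeasN. Qed.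

Lemma bmeas_prod I (s : seq I) (f : I -> T -> R) : (forall i, bmeas (f i)) ->
  bmeas (fun x => \prod_(i <- s) f i x).
Proof.
move=> bf; elim: s => [|i s IH].
  by under eq_fun do rewrite big_nil; exact: bmeas_cst.
by under eq_fun do rewrite big_cons; exact: bmeasM.
Qed.

Lemma bmeas_indic (A : set T) : measurable A -> bmeas (\1_A : T -> R).
Proof.
move=> mA; split; first exact: measurable_indic.
by exists 1 => x; rewrite indicE; case: (_ \in _); rewrite ?normr1 ?normr0.
Qed.

Lemma bmeas_cos f : measurable_fun setT f -> bmeas (fun x => cos (f x)).
Proof.
move=> mf; split; last first.
  by exists 1 => x; rewrite ler_norml cos_geN1 cos_le1.
apply: (measurableT_comp (f := @cos R)) => //.
by apply: continuous_measurable_fun; exact: continuous_cos.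
Qed.

Lemma bmeas_sin f : measurable_fun setT f -> bmeas (fun x => sin (f x)).
Proof.
move=> mf; split; last first.
  by exists 1 => x; rewrite ler_norml sin_geN1 sin_le1.
apply: (measurableT_comp (f := @sin R)) => //.
by apply: continuous_measurable_fun; exact: continuous_sin.
Qed.

Variable P : probability T R.

Lemma bmeas_integrable f : bmeas f -> P.-integrable setT (EFin \o f).
Proof.
move=> [mf [M fM]]; apply: (@integrable_bounded _ _ _ _ _ _ (cst M)) => //.
exact: finite_measure_integrable_cst.
Qed.

Lemma expD f g : bmeas f -> bmeas g ->
  \int[P]_x (f x + g x) = \int[P]_x f x + \int[P]_x g x.
Proof. by move=> bf bg; apply: RintegralD => //; exact: bmeas_integrable. Qed.

Lemma expB f g : bmeas f -> bmeas g ->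
  \int[P]_x (f x - g x) = \int[P]_x f x - \int[P]_x g x.
Proof. by move=> bf bg; apply: RintegralB => //; exact: bmeas_integrable. Qed.

Lemma expZ (c : R) f : bmeas f -> \int[P]_x (c * f x) = c * \int[P]_x f x.
Proof. by move=> bf; apply: RintegralZl => //; exact: bmeas_integrable. Qed.

Lemma exp_cst (c : R) : \int[P]_x c = c.
Proof. by rewrite Rintegral_cst//= probability_setT mulr1. Qed.

Lemma exp_indic (A : set T) : measurable A -> \int[P]_x (\1_A x : R) = fine (P A).
Proof. by move=> mA; rewrite /Rintegral integral_indic// setIT. Qed.

Lemma le_exp f g : bmeas f -> bmeas g -> (forall x, f x <= g x) ->
  \int[P]_x f x <= \int[P]_x g x.
Proof. by move=> bf bg fg; apply: le_Rintegral => //; exact: bmeas_integrable. Qed.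

Lemma norm_exp_le f (M : R) : bmeas f -> (forall x, `|f x| <= M) ->
  `|\int[P]_x f x| <= M.
Proof.
move=> bf fM; rewrite ler_norml; apply/andP; split.
  rewrite -[leLHS]exp_cst; apply: le_exp => //; first exact: bmeas_cst.
  by move=> x; move: (fM x); rewrite ler_norml => /andP[].
rewrite -[leRHS]exp_cst; apply: le_exp => //; first exact: bmeas_cst.
by move=> x; move: (fM x); rewrite ler_norml => /andP[].
Qed.

End bounded_measurable.

Lemma bmeas_comp d d' (T : measurableType d) (T' : measurableType d')
    (R : realType) (f : T' -> R) (X : T -> T') :
  bmeas f -> measurable_fun setT X -> bmeas (fun x => f (X x)).
Proof.
move=> [mf [M fM]] mX; split; last by exists M => x.
exact: measurableT_comp.
Qed.

Section product_rule.
Import HBNNSimple.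
Context d (T : measurableType d) (R : realType) (P : probability T R).

(** Monotone class argument: the identity is linear in [f] and passes to bounded pointwise limits,
    so that indicators suffice. It is applied with [h] a product over the other indices. *)
Lemma exp_mul_comp (h X : T -> R) (c : R) :
  bmeas h -> measurable_fun setT X ->
  (forall C : set R, measurable C ->
    \int[P]_x (h x * \1_C (X x)) = c * \int[P]_x \1_C (X x)) ->
  forall f : R -> R, bmeas f ->
    \int[P]_x (h x * f (X x)) = c * \int[P]_x f (X x).
Proof.
move=> bh mX hC.
pose K (g : R -> R) := bmeas g /\
  \int[P]_x (h x * g (X x)) = c * \int[P]_x g (X x).
have KD g1 g2 : K g1 -> K g2 -> K (fun x => g1 x + g2 x).
  move=> [b1 e1] [b2 e2]; split; first exact: bmeasD.
  under eq_Rintegral do rewrite mulrDr.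
  by rewrite !expD ?e1 ?e2 ?mulrDr//; try apply: bmeasM => //; exact: bmeas_comp.
have KZ a g : K g -> K (fun x => a * g x).
  move=> [b1 e1]; split; first exact: bmeasZ.
  under eq_Rintegral do rewrite mulrCA.
  have bg : bmeas (fun x => g (X x)) by exact: bmeas_comp.
  rewrite (@expZ _ _ _ P a (fun x => h x * g (X x))); last exact: bmeasM.
  by rewrite e1 mulrCA (@expZ _ _ _ P a (fun x => g (X x))).
have K1 (C : set R) : measurable C -> K \1_C.
  by move=> mC; split; [exact: bmeas_indic|exact: hC].
have Ksum (s : seq R) (a : R -> R) (C : R -> set R) : (forall r, measurable (C r)) ->
    K (fun x => \sum_(r <- s) a r * \1_(C r) x).
  move=> mC; elim: s => [|r s IH].
    rewrite (_ : (fun _ => _) = (fun x => 0 * \1_setT x)); last first.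
      by apply/funext => x; rewrite big_nil mul0r.
    by apply: KZ; apply: K1; exact: measurableT.
  under eq_fun do rewrite big_cons.
  by apply: KD => //; apply: KZ; exact: K1.
have Kpos (g : R -> R) : bmeas g -> (forall x, 0 <= g x) -> K g.
  move=> bg g0; split => //.
  have [mg [M gM]] := bg.
  have mEg : measurable_fun setT (EFin \o g) by exact/measurable_EFinP.
  pose g_ := nnsfun_approx measurableT mEg.
  have Kg n : K (g_ n).
    rewrite (_ : (g_ n : R -> R) =
      (fun x => \sum_(r <- finmap.enum_fset (fset_set (range (g_ n)))) r * \1_(g_ n @^-1` [set r]) x)).
      by apply: Ksum => r; exact: measurable_sfunP.
    apply/funext => x; rewrite fimfunE fsbig_finite//.
  have gcvg x : g_ ^~ x @ \oo --> g x.
    exact: fine_cvg (@cvg_nnsfun_approx _ _ _ _ _ _ mEg (fun x _ => g0 x) x Logic.I).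
  have gle n x : `|g_ n x| <= M.
    rewrite ger0_norm//; apply: le_trans (le_trans (ler_norm _) (gM x)).
    rewrite -(cvg_lim _ (gcvg x))//.
    apply: (@nondecreasing_cvgn_le _ (g_ ^~ x)).
      by move=> i j ij /=; exact/lefP/nd_nnsfun_approx.
    by apply/cvg_ex; eexists; exact: gcvg.
  have [mh [N hN]] := bh.
  have c1 : (fun n => \int[P]_x (h x * g_ n (X x))) @ \oo -->
      \int[P]_x (h x * g (X x)).
    apply: (@Rintegral_dct _ _ _ _ _ _ _ (cst (N * M))) => //.
    - by move=> n; apply: measurable_funM => //; exact: measurableT_comp.
    - by apply: measurable_funM => //; exact: measurableT_comp.
    - by apply: aeW => x _; apply: cvgMr; exact: gcvg.
    - exact: finite_measure_integrable_cst.
    - by apply: nearW => n x _; rewrite normrM ler_pM.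
  have c2 : (fun n => c * \int[P]_x (g_ n (X x))) @ \oo -->
      c * \int[P]_x (g (X x)).
    apply: cvgMr; apply: (@Rintegral_dct _ _ _ _ _ _ _ (cst M)) => //.
    - by move=> n; exact: measurableT_comp.
    - exact: measurableT_comp.
    - by apply: aeW => x _; exact: gcvg.
    - exact: finite_measure_integrable_cst.
    - by apply: nearW => n x _.
  have E : (fun n => \int[P]_x (h x * g_ n (X x))) =
           (fun n => c * \int[P]_x (g_ n (X x))).
    by apply/funext => n; exact: (Kg n).2.
  by rewrite -(cvg_lim _ c1)// E (cvg_lim _ c2).
move=> f bf; have [mf [M fM]] := bf.
suff [] : K f by [].
(* Adding the bound [M] reduces to non-negative functions. *)
have -> : f = (fun x => (f x + M) + (- M) * \1_setT x).
  by apply/funext => x; rewrite indicT mulr1 addrK.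
apply: KD; last by apply: KZ; exact: K1.
apply: Kpos; first by apply: bmeasD => //; exact: bmeas_cst.
by move=> x; rewrite -lerBlDr sub0r; move: (fM x); rewrite ler_norml => /andP[].
Qed.

Variable Xs : nat -> {RV P >-> R}.
Hypothesis indep : mutually_independent Xs.

(** Independence speaks of events, so [s2] carries the factors that are still indicators. In the
    induction step the index [j] enters [s2] with an arbitrary set [C], and [exp_mul_comp] then
    replaces the indicator of [C] by [f j]. *)
Lemma exp_prod_indep (s1 s2 : seq nat) (f : nat -> R -> R) (B : nat -> set R) :
  uniq (s1 ++ s2) -> (forall i, bmeas (f i)) -> (forall i, measurable (B i)) ->
  \int[P]_w (\prod_(i <- s1) f i (Xs i w) * \prod_(i <- s2) \1_(B i) (Xs i w)) =
  \prod_(i <- s1) (\int[P]_w f i (Xs i w)) *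
  \prod_(i <- s2) (\int[P]_w \1_(B i) (Xs i w)).
Proof.
elim: s1 s2 B => [|j s1 IH] s2 B us bf mB.
  rewrite big_nil mul1r; under eq_Rintegral do rewrite big_nil mul1r.
  have mX i : measurable (Xs i @^-1` B i).
    by rewrite -[X in measurable X]setTI; exact: measurable_funP.
  have -> : \int[P]_w (\prod_(i <- s2) \1_(B i) (Xs i w)) =
      fine (P (\bigcap_(i in [set` s2]) (Xs i @^-1` B i))).
    rewrite -exp_indic; last by apply: fin_bigcap_measurable => //; exact: finite_seq.
    apply: eq_Rintegral => w _; rewrite indicE.
    elim: {us} s2 => [|i s2 IHs]; rewrite ?big_nil ?big_cons.
      by rewrite mem_set.
    rewrite {}IHs indicE.
    have -> : (w \in \bigcap_(k in [set` i :: s2]) Xs k @^-1` B k) =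
        (Xs i w \in B i) && (w \in \bigcap_(k in [set` s2]) Xs k @^-1` B k).
      apply/idP/idP => [/set_mem H|/andP[/set_mem H1 /set_mem H2]].
        apply/andP; split; apply/mem_set; first by apply: H; rewrite /= mem_head.
        by move=> k ks; apply: H; rewrite /= inE ks orbT.
      apply/mem_set => k /=; rewrite inE => /orP[/eqP -> //|ks]; exact: H2.
    by case: (_ \in B i) => /=; rewrite ?mul1r ?mul0r.
  rewrite indep//; apply: eq_bigr => i _.
  transitivity (\int[P]_w (\1_(Xs i @^-1` B i) w : R)); first by rewrite exp_indic.
  apply: eq_Rintegral => w _; rewrite !indicE.
  have -> // : (w \in Xs i @^-1` B i) = (Xs i w \in B i).
  by apply/idP/idP => /set_mem H; exact/mem_set.
rewrite big_cons; under eq_Rintegral do rewrite big_cons -mulrA mulrC.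
move: us => /= /andP[js us].
pose h w := \prod_(i <- s1) f i (Xs i w) * \prod_(i <- s2) \1_(B i) (Xs i w).
pose c := \prod_(i <- s1) (\int[P]_w f i (Xs i w)) *
  \prod_(i <- s2) (\int[P]_w \1_(B i) (Xs i w)).
rewrite (@exp_mul_comp h (Xs j) c _ _ _ (f j))//; first by rewrite /c; ring.
- apply: bmeasM; apply: bmeas_prod => i; apply: bmeas_comp => //.
  exact: bmeas_indic.
- move=> C mC.
  pose B' i := if i == j then C else B i.
  have mB' i : measurable (B' i) by rewrite /B'; case: ifP.
  have us' : uniq (s1 ++ j :: s2).
    by rewrite -cat1s uniq_catCA /= js.
  have BB' F : \prod_(i <- s2) F i (B i) = \prod_(i <- s2) F i (B' i) :> R.
    rewrite [LHS]big_seq [RHS]big_seq; apply: eq_bigr => i is2; rewrite /B'; case: eqP => // ij.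
    by move: js; rewrite mem_cat -ij is2 orbT.
  have := IH (j :: s2) B' us' bf mB'.
  rewrite big_cons {2}/B' eqxx /c (BB' (fun i b => \int[P]_w \1_b (Xs i w))) => IHj.
  rewrite -mulrA [X in _ * X]mulrC -IHj; apply: eq_Rintegral => w _.
  rewrite big_cons {1}/B' eqxx /h (BB' (fun i b => \1_b (Xs i w))); ring.
Qed.

(* The factors indexed by [s2] carry the induction on [s1]: one summand at a time
   is moved to [s2] by the addition formulas. *)
Lemma exp_cos_sin_sum (th : nat -> R -> R) (s1 s2 : seq nat) (f : nat -> R -> R) :
  (forall i, measurable_fun setT (th i)) ->
  uniq (s1 ++ s2) -> (forall i, bmeas (f i)) ->
  let z i := (\int[P]_w cos (th i (Xs i w)) +i* \int[P]_w sin (th i (Xs i w)))%C in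
  let Z := \prod_(i <- s1) z i in
  \int[P]_w (cos (\sum_(i <- s1) th i (Xs i w)) * \prod_(i <- s2) f i (Xs i w)) =
    complex.Re Z * \prod_(i <- s2) (\int[P]_w f i (Xs i w)) /\
  \int[P]_w (sin (\sum_(i <- s1) th i (Xs i w)) * \prod_(i <- s2) f i (Xs i w)) =
    complex.Im Z * \prod_(i <- s2) (\int[P]_w f i (Xs i w)).
Proof.
move=> mth; elim: s1 s2 f => [|j s1 IH] s2 f us bf z Z.
  rewrite /Z big_nil /= mul0r mul1r.
  have e0 : \int[P]_w \prod_(i <- s2) f i (Xs i w) =
      \prod_(i <- s2) (\int[P]_w f i (Xs i w)).
    have := @exp_prod_indep s2 [::] f (fun=> setT); rewrite cats0 => /(_ us bf).
    move=> /(_ (fun=> measurableT)); rewrite big_nil mulr1 => <-.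
    by apply: eq_Rintegral => w _; rewrite big_nil mulr1.
  split.
    by rewrite -e0; apply: eq_Rintegral => w _; rewrite big_nil cos0 mul1r.
  under eq_Rintegral do rewrite big_nil sin0 mul0r.
  by rewrite exp_cst.
move: us => /= /andP[js us].
have us' : uniq (s1 ++ j :: s2) by rewrite -cat1s uniq_catCA /= js.
pose fu (u : R -> R) i := if i == j then u else f i.
have bc : bmeas (fun x => cos (th j x)) by exact: bmeas_cos.
have bs : bmeas (fun x => sin (th j x)) by exact: bmeas_sin.
have bfu u : bmeas u -> forall i, bmeas (fu u i).
  by move=> bu i; rewrite /fu; case: ifP.
have fuE u F : \prod_(i <- j :: s2) F i (fu u i) = F j u * \prod_(i <- s2) F i (f i) :> R.
  rewrite big_cons {1}/fu eqxx; congr (_ * _).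
  rewrite [LHS]big_seq [RHS]big_seq; apply: eq_bigr => i is2; rewrite /fu.
  by case: eqP => // ij; move: js; rewrite mem_cat -ij is2 orbT.
have [c1 s1c] := IH (j :: s2) _ us' (bfu _ bc).
have [c2 s2c] := IH (j :: s2) _ us' (bfu _ bs).
rewrite !(fuE _ (fun i g => \int[P]_w g (Xs i w))) in c1 s1c c2 s2c.
have bX th' i : bmeas th' -> bmeas (fun w => th' (Xs i w)) by move=> ?; exact: bmeas_comp.
have mS : measurable_fun setT (fun w => \sum_(i <- s1) th i (Xs i w)).
  by apply: measurable_sum => i; exact: measurableT_comp.
have bp u : bmeas u -> bmeas (fun w => \prod_(i <- j :: s2) fu u i (Xs i w)).
  by move=> bu; apply: bmeas_prod => i; apply: bX; exact: bfu.
pose prd := \prod_(i <- s2) (\int[P]_w f i (Xs i w)).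
rewrite /Z big_cons; set Z' := \prod_(i <- s1) z i in c1 s1c c2 s2c *.
have [a [b Zab]] : exists a b, Z' = (a +i* b)%C by case: (Z') => a b; exists a, b.
rewrite Zab /= in c1 s1c c2 s2c *.
split.
  transitivity (\int[P]_w (cos (\sum_(i <- s1) th i (Xs i w)) *
       \prod_(i <- j :: s2) fu (fun x => cos (th j x)) i (Xs i w) -
      sin (\sum_(i <- s1) th i (Xs i w)) *
       \prod_(i <- j :: s2) fu (fun x => sin (th j x)) i (Xs i w))).
    apply: eq_Rintegral => w _; rewrite !(fuE _ (fun i g => g (Xs i w))) big_cons cosD.
    ring.
  rewrite expB; first by rewrite c1 s2c; ring.
    by apply: bmeasM; [exact: bmeas_cos|exact: bp].
  by apply: bmeasM; [exact: bmeas_sin|exact: bp].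
transitivity (\int[P]_w (sin (\sum_(i <- s1) th i (Xs i w)) *
     \prod_(i <- j :: s2) fu (fun x => cos (th j x)) i (Xs i w) +
    cos (\sum_(i <- s1) th i (Xs i w)) *
     \prod_(i <- j :: s2) fu (fun x => sin (th j x)) i (Xs i w))).
  apply: eq_Rintegral => w _; rewrite !(fuE _ (fun i g => g (Xs i w))) big_cons sinD.
  ring.
rewrite expD; first by rewrite s1c c2; ring.
  by apply: bmeasM; [exact: bmeas_sin|exact: bp].
by apply: bmeasM; [exact: bmeas_cos|exact: bp].
Qed.

End product_rule.

(** * Levy's continuity theorem *)

Section polynomial_step.
Context (R : realType).

Lemma bernoulli_le (u : R) (m : nat) : 0 <= u -> u <= 1 ->
  1 - m%:R * u <= (1 - u) ^+ m.
Proof.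
move=> u0 u1; elim: m => [|m IH]; first by rewrite mul0r subr0 expr0.
rewrite exprS -natr1; apply: le_trans (ler_wpM2l _ IH); last by rewrite subr_ge0.
have : 0 <= m%:R * u * u by rewrite !mulr_ge0.
nra.
Qed.

Lemma bernoulli_ge (u : R) (m : nat) : 0 <= u -> u <= 1 ->
  (1 - u) ^+ m * (1 + m%:R * u) <= 1.
Proof.
move=> u0 u1; elim: m => [|m IH]; first by rewrite mul0r addr0 expr0 mulr1.
apply: le_trans IH; rewrite exprS -mulrA mulrCA ler_wpM2l//.
  by rewrite exprn_ge0// subr_ge0.
rewrite -natr1; have : 0 <= m%:R * u * u by rewrite !mulr_ge0.
nra.
Qed.

(* Take [m] close to [(2 / (a + b)) ^ n] with [n] large, and apply Bernoulli's
   inequality on each side. *)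
Lemma poly_step (a b e : R) : 0 <= a -> a < b -> b <= 1 -> 0 < e ->
  exists n m : nat, forall y : R, 0 <= y -> y <= 1 ->
    (y <= a -> 1 - e <= (1 - y ^+ n) ^+ m) /\
    (b <= y -> (1 - y ^+ n) ^+ m <= e).
Proof.
move=> a0 ab b1 e0.
(* The inverse of the midpoint of [a] and [b], so that [l * a < 1 < l * b]. *)
pose l := 2 / (a + b).
have s0 : 0 < a + b by rewrite ltr_wpDl// (le_lt_trans a0).
have l0 : 0 < l by rewrite divr_gt0.
have la1 : l * a < 1 by rewrite /l mulrAC ltr_pdivrMr// mul1r; lra.
have lb1 : 1 < l * b by rewrite /l mulrAC ltr_pdivlMr// mul1r; lra.
have la0 : 0 <= l * a by rewrite mulr_ge0// ltW.
have e20 : 0 < e / 2 by rewrite divr_gt0.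
(* With [l ^+ n < m <= l ^+ n + 1], the first two bounds make [m * a ^+ n] at most [e], and the
   third makes [m * b ^+ n] at least [e^-1]. *)
have [n [H1 H2 H3]] : exists n, [/\ (l * a) ^+ n <= e / 2, a ^+ n <= e / 2 & ((l * b)^-1) ^+ n <= e].
  have c1 : \forall n \near \oo, (l * a) ^+ n < e / 2.
    by apply: (cvgr_lt (0 : R)) => //; apply: cvg_expr; rewrite ger0_norm.
  have c2 : \forall n \near \oo, a ^+ n < e / 2.
    apply: (cvgr_lt (0 : R)) => //; apply: cvg_expr; rewrite ger0_norm//.
    exact: lt_le_trans b1.
  have c3 : \forall n \near \oo, (l * b)^-1 ^+ n < e.
    apply: (cvgr_lt (0 : R)) => //; apply: cvg_expr.
    by rewrite ger0_norm ?invr_ge0 ?invf_lt1//; lra.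
  near \oo => n; exists n; split; apply/ltW; near: n; [exact: c1|exact: c2|exact: c3].
exists n, (Num.truncn (l ^+ n)).+1 => y y0 y1.
have yn0 : 0 <= y ^+ n by rewrite exprn_ge0.
have yn1 : y ^+ n <= 1 by rewrite exprn_ile1.
have ln0 : 0 < l ^+ n by rewrite exprn_gt0.
split.
  move=> ya; apply: le_trans (bernoulli_le _ yn0 yn1); rewrite lerB//.
  have yan : y ^+ n <= a ^+ n by rewrite lerXn2r// nnegrE.
  apply: (@le_trans _ _ ((l ^+ n + 1) * a ^+ n)).
    apply: ler_pM => //; by rewrite -natr1 lerD2r truncn_le ltW.
  by rewrite mulrDl mul1r -exprMn; lra.
move=> by_; have := bernoulli_ge (Num.truncn (l ^+ n)).+1 yn0 yn1.
set v := (_ ^+ _.+1) => vle.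
have v0 : 0 <= v by rewrite exprn_ge0// subr_ge0.
have lbn : e^-1 <= (l * b) ^+ n.
  have lbp : 0 < (l * b) ^+ n by rewrite exprn_gt0// mulr_gt0// (le_lt_trans a0).
  by rewrite -[leRHS]invrK lef_pV2 ?posrE ?invr_gt0// -exprVn.
have mle : (l * b) ^+ n <= 1 + (Num.truncn (l ^+ n)).+1%:R * y ^+ n.
  rewrite exprMn; apply: (@le_trans _ _ (l ^+ n * y ^+ n)).
    apply: ler_wpM2l; first exact: ltW.
    by rewrite lerXn2r// nnegrE// ltW// (le_lt_trans a0).
  by rewrite ler_wpDl// ler_wpM2r// ltW// truncnS_gt.
have : v * e^-1 <= 1.
  by apply: le_trans vle; rewrite ler_wpM2l// (le_trans lbn).
by rewrite ler_pdivrMr// mul1r.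
Unshelve. all: by end_near. Qed.

End polynomial_step.

(** * Trigonometric test functions *)

Section trig_test.
Context (R : realType) (m_ : nat -> probability R R).

Lemma bcos (r : R) : bmeas (fun x : R => cos (r * x)).
Proof. by apply: bmeas_cos; exact: measurable_funM. Qed.

Lemma bsin (r : R) : bmeas (fun x : R => sin (r * x)).
Proof. by apply: bmeas_sin; exact: measurable_funM. Qed.

(* Closed under multiplication by [sin (w * x)], hence by every polynomial in
   [sin (w * x)]. *)
Definition trig_cvg (g : R -> R) := bmeas g /\
  forall r s : R, cvgn (fun n => \int[m_ n]_x (g x * cos (r * x + s))).

Let bcosD (g : R -> R) (r s : R) : bmeas g -> bmeas (fun x : R => g x * cos (r * x + s)).
Proof.
move=> bg; apply: bmeasM => //; apply: bmeas_cos.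
by apply: measurable_funD => //; exact: measurable_funM.
Qed.

Lemma trig_cvgD g1 g2 : trig_cvg g1 -> trig_cvg g2 ->
  trig_cvg (fun x => g1 x + g2 x).
Proof.
move=> [b1 c1] [b2 c2]; split=> [|r s]; first exact: bmeasD.
rewrite (_ : (fun n => _) = (fun n => \int[m_ n]_x (g1 x * cos (r * x + s)) +
   \int[m_ n]_x (g2 x * cos (r * x + s)))); first exact: is_cvgD (c1 r s) (c2 r s).
apply/funext => n /=; rewrite -expD; [|exact: bcosD..].
by apply: eq_Rintegral => x _; rewrite mulrDl.
Qed.

Lemma trig_cvgZ c g : trig_cvg g -> trig_cvg (fun x => c * g x).
Proof.
move=> [b1 c1]; split=> [|r s]; first exact: bmeasZ.
rewrite (_ : (fun n => _) = (fun n => c * \int[m_ n]_x (g x * cos (r * x + s)))).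
  exact: is_cvgMr (c1 r s).
apply/funext => n /=; rewrite -expZ; last exact: bcosD.
by apply: eq_Rintegral => x _; rewrite mulrA.
Qed.

(** The phase [s] in [trig_cvg] serves here: the sine is a cosine shifted by [pi / 2], and a product
    of two cosines is half the sum of two cosines with other frequencies and phases. *)
Lemma trig_cvg_sin (w : R) g : trig_cvg g -> trig_cvg (fun x => g x * sin (w * x)).
Proof.
move=> [b1 c1]; split=> [|r s].
  by apply: bmeasM => //; apply: bmeas_sin; exact: measurable_funM.
rewrite (_ : (fun n => _) = (fun n => - 2^-1 *
    (\int[m_ n]_x (g x * cos ((w + r) * x + (pi / 2 + s))) +
     \int[m_ n]_x (g x * cos ((w - r) * x + (pi / 2 - s)))))).
  exact: is_cvgMr (is_cvgD (c1 _ _) (c1 _ _)).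
apply/funext => n /=; rewrite -expD; [|exact: bcosD..].
rewrite -expZ; last by apply: bmeasD; exact: bcosD.
apply: eq_Rintegral => x _.
rewrite (_ : (w + r) * x + _ = (w * x + pi / 2) + (r * x + s)); last by ring.
rewrite (_ : (w - r) * x + _ = (w * x + pi / 2) - (r * x + s)); last by ring.
rewrite -[sin _]opprK -cosDpihalf; set a := _ + pi / 2; set b := r * x + s.
by rewrite cosB (cosD a); field.
Qed.

Definition trig_mul (f : R -> R) :=
  forall g, trig_cvg g -> trig_cvg (fun x => g x * f x).

Lemma trig_mulX f n : trig_mul f -> trig_mul (fun x => f x ^+ n).
Proof.
move=> tf; elim: n => [|n IH] g tg.
  by under eq_fun do rewrite expr0 mulr1.
by under eq_fun do rewrite exprS mulrA; apply: IH; exact: tf.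
Qed.

Lemma trig_mul_affine (c1 c2 : R) f : trig_mul f -> trig_mul (fun x => c1 + c2 * f x).
Proof.
move=> tf g tg.
rewrite (_ : (fun x => _) = (fun x => c1 * g x + c2 * (g x * f x))).
  by apply: trig_cvgD; apply: trig_cvgZ => //; exact: tf.
by apply/funext => x; ring.
Qed.

End trig_test.

Lemma image_probability (R : realType) (D : set R) (q : R -> R) :
  measurable D -> measurable_fun D q -> lebesgue_measure D = 1%E ->
  exists mu : probability R R, forall B : set R, measurable B ->
    mu B = lebesgue_measure (D `&` q @^-1` B).
Proof.
move=> mD mq D1.
have mq' : measurable_fun setT (q \_ D) by apply/(measurable_restrictT _ _).1.
pose m2 := pushforward (mrestr lebesgue_measure mD) (q \_ D).
have m2E A : m2 A = lebesgue_measure (D `&` q @^-1` A).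
  rewrite /m2 /pushforward /mrestr; congr (lebesgue_measure _).
  apply/seteqP; split=> x /=; rewrite patchE.
    by move=> [+ xk]; rewrite mem_set.
  by move=> [xk ?]; rewrite mem_set.
pose mm : {measure set R -> \bar R} :=
  measure_function_pushforward__canonical__measure_function_Measure
    (mrestr lebesgue_measure mD) mq'.
have m1 : mm setT = 1%E by rewrite [LHS]m2E preimage_setT setIT.
(* The total mass is 1, so normalizing changes no value and yields the structure of a probability;
   the Dirac mass is the default for degenerate masses. *)
exists (mnormalize mm (dirac (0 : R))) => B mB.
rewrite /= /mnormalize m1 onee_eq0/= invr1 mule1.
exact: m2E.
Qed.

(** * Limit law of a tight sequence *)

Section limit_law.
Context (R : realType) (m_ : nat -> probability R R).
Hypothesis cos_cvg : forall t : R, cvgn (fun n => \int[m_ n]_x cos (t * x)).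
Hypothesis sin_cvg : forall t : R, cvgn (fun n => \int[m_ n]_x sin (t * x)).
Hypothesis tight : forall e : R, 0 < e ->
  exists T : R, \forall n \near \oo, fine (m_ n [set x | T < `|x|]) <= e.

Let F n := cdf (m_ n).

Lemma measurable_norm_gt (T : R) : measurable [set x : R | T < `|x|].
Proof.
rewrite (_ : [set _ | _] = (fun x : R => `|x|) @^-1` `]T, +oo[%classic).
  by rewrite -[X in measurable X]setTI; apply: normr_measurable.
by apply/seteqP; split=> x /=; rewrite in_itv/= andbT.
Qed.

Lemma tight_gt (e M : R) : 0 < e ->
  exists2 T : R, M < T & \forall n \near \oo, fine (m_ n [set x | T < `|x|]) <= e.
Proof.
move=> e0; have [T HT] := tight e0.
exists (Num.max T M + 1); first by rewrite ltr_pwDr// le_max lexx orbT.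
apply: filterS HT => n; apply: le_trans; rewrite fine_le ?fin_num_measure//.
- exact: measurable_norm_gt.
- exact: measurable_norm_gt.
- apply: le_measure; rewrite ?inE; [exact: measurable_norm_gt..|].
  move=> x /=; apply: le_lt_trans; rewrite ler_wpDr// le_max lexx//.
Qed.

Lemma cdf_exp n y : F n y = \int[m_ n]_x (\1_(`]-oo, y]%classic) x : R).
Proof. by rewrite exp_indic//; exact: measurable_itv. Qed.

(* On [-T, T] the function [(1 + sin (w * x)) / 2] increases from 0 to 1, so that
   [poly_step] provides a trigonometric polynomial separating [x <= a] from
   [b <= x]; its integrals converge.  This replaces Helly's selection theorem. *)
Lemma cdf_interlace (a b e : R) : a < b -> 0 < e ->
  exists N : nat, forall n k, (N <= n)%N -> (N <= k)%N -> F n a <= F k b + e.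
Proof.
(* Five errors: the accuracy of the polynomial and the mass outside [-T, T], once for [n] and once
   for [k], and the distance between the two integrals. *)
move=> ab e0'; pose e1 := e / 5; have e0 : 0 < e1 by rewrite divr_gt0.
have [T MT HT] := tight_gt (Num.max `|a| `|b|) e0.
have aT : `|a| < T by rewrite (le_lt_trans _ MT)// le_max lexx.
have bT : `|b| < T by rewrite (le_lt_trans _ MT)// le_max lexx orbT.
have T0 : 0 < T by rewrite (le_lt_trans _ aT).
pose w := pi / (2 * T).
have w0 : 0 < w by rewrite divr_gt0 ?pi_gt0 ?mulr_gt0.
have wT : w * T = pi / 2 by rewrite /w; field; rewrite gt_eqF.
have win x : `|x| <= T -> w * x \in `[- (pi / 2), pi / 2].
  rewrite ler_norml in_itv/= -wT -mulrN => /andP[H1 H2].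
  by rewrite !ler_pM2l ?H1.
pose y x : R := 2^-1 + 2^-1 * sin (w * x).
have y0 x : 0 <= y x by rewrite /y; have := sin_geN1 (w * x); lra.
have y1 x : y x <= 1 by rewrite /y; have := sin_le1 (w * x); lra.
have ylt x z : `|x| <= T -> `|z| <= T -> (y x < y z) = (x < z).
  move=> xT zT; rewrite /y ltrD2l ltr_pM2l// ltr_sin ?win// ltr_pM2l//.
have yle x z : `|x| <= T -> `|z| <= T -> x <= z -> y x <= y z.
  by move=> xT zT; rewrite !leNgt ylt.
have yab : y a < y b by rewrite ylt// ltW.
have [n0 [m0 H]] := poly_step (y0 a) yab (y1 b) e0.
pose p x : R := (1 + (-1) * y x ^+ n0) ^+ m0.
have pE x : p x = (1 - y x ^+ n0) ^+ m0 by rewrite /p mulN1r.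
have yn1 x : y x ^+ n0 <= 1 by rewrite exprn_ile1.
have p0 x : 0 <= p x by rewrite pE exprn_ge0// subr_ge0.
have p1 x : p x <= 1.
  by rewrite pE exprn_ile1// ?subr_ge0// gerBl exprn_ge0.
have [bp cp] : trig_cvg m_ (fun x => 1 * p x).
  apply: trig_mulX.
    apply: trig_mul_affine; apply: trig_mulX; apply: trig_mul_affine.
    by move=> g; exact: trig_cvg_sin.
  split=> [|r s]; first exact: bmeas_cst.
  rewrite (_ : (fun n => _) = (fun n => cos s * \int[m_ n]_x cos (r * x) -
      sin s * \int[m_ n]_x sin (r * x))).
    by apply: is_cvgB; apply: is_cvgMr; [exact: cos_cvg|exact: sin_cvg].
  apply/funext => n; rewrite -(expZ _ _ (bcos r)) -(expZ _ _ (bsin r)) -expB.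
  - by apply: eq_Rintegral => x _; rewrite mul1r cosD mulrC [sin s * _]mulrC.
  - exact: bmeasZ (bcos r).
  - exact: bmeasZ (bsin r).
have bp' : bmeas p by move: bp; under eq_fun do rewrite mul1r.
have pc : cvgn (fun n => \int[m_ n]_x p x).
  have := cp 0 0.
  rewrite (_ : (fun n => _) = (fun n => \int[m_ n]_x p x))//; apply/funext => n.
  by apply: eq_Rintegral => x _; rewrite mul0r addr0 cos0 mulr1 mul1r.
pose I1 (z : R) : R -> R := \1_(`]-oo, z]%classic).
pose I2 : R -> R := \1_([set x | T < `|x|]).
have bI1 z : bmeas (I1 z) by apply: bmeas_indic; exact: measurable_itv.
have bI2 : bmeas I2 by apply: bmeas_indic; exact: measurable_norm_gt.
have I1E z x : I1 z x = (x <= z)%R%:R.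
  rewrite /I1 indicE (_ : (x \in _) = (x <= z)%R)//.
  by apply/idP/idP => [/set_mem|?]; [|apply/mem_set]; rewrite /= in_itv.
have I2E x : I2 x = (T < `|x|)%R%:R.
  rewrite /I2 indicE (_ : (x \in _) = (T < `|x|)%R)//.
  by apply/idP/idP => [/set_mem//|?]; apply/mem_set.
have bge g : bmeas g -> bmeas (fun x => g x + e1).
  by move=> bg; apply: bmeasD => //; exact: bmeas_cst.
have sumE n g : bmeas g -> \int[m_ n]_x (g x + e1 + I2 x) =
    \int[m_ n]_x g x + e1 + fine (m_ n [set x | T < `|x|]).
  move=> bg; rewrite (@expD _ _ _ _ (fun x => g x + e1) I2)//; last exact: bge.
  rewrite (@expD _ _ _ _ g (fun=> e1))//; last exact: bmeas_cst.
  by rewrite exp_cst exp_indic//; exact: measurable_norm_gt.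
have up n : F n a <= \int[m_ n]_x p x + e1 + fine (m_ n [set x | T < `|x|]).
  rewrite cdf_exp -sumE//.
  apply: le_exp => [||x]; [exact: bI1|by apply: bmeasD => //; exact: bge|].
  rewrite -/(I1 a) I1E I2E; have := p0 x.
  case: (leP x a) => xa; case: ltP => Tx /=; rewrite ?mulr1n ?mulr0n; [lra| |lra|lra].
  by move: (H _ (y0 x) (y1 x)) => [/(_ (yle _ _ Tx (ltW aT) xa)) + _]; rewrite -pE; lra.
have dn n : \int[m_ n]_x p x <= F n b + e1 + fine (m_ n [set x | T < `|x|]).
  rewrite cdf_exp -sumE; last exact: bI1.
  apply: le_exp => [|| x]; [exact: bp'|by apply: bmeasD; [apply: bge; exact: bI1|exact: bI2]|].
  rewrite -/(I1 b) I1E I2E; have := p1 x.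
  case: (leP x b) => xb; case: ltP => Tx /=; rewrite ?mulr1n ?mulr0n; [lra|lra|lra|].
  by move: (H _ (y0 x) (y1 x)) => [_ /(_ (yle _ _ (ltW bT) Tx (ltW xb)))]; rewrite -pE; lra.
have /cvg_ex[l pl] := pc.
have [N1 _ HN1] : \forall n \near \oo, `|l - \int[m_ n]_x p x| < e1 / 2.
  by move/cvgrPdist_lt : pl; apply; rewrite divr_gt0.
have [N2 _ HN2] := HT.
exists (maxn N1 N2) => n k; rewrite !geq_max => /andP[n1 n2] /andP[k1 k2].
have := HN1 _ n1; have := HN1 _ k1; rewrite /= !ltr_norml => /andP[A1 A2] /andP[A3 A4].
have := HN2 _ n2; have := HN2 _ k2; rewrite /= => B1 B2.
have := up n; have := dn k; rewrite /e1 in A1 A2 A3 A4 B1 B2 *; lra.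
Qed.

(** [q] is the candidate for the quantile function of the limit. It exists without any convergence
    of [F n], and the limit law is the image of Lebesgue measure on ]0, 1[ under it. *)
Let S u := [set y | \forall n \near \oo, u <= F n y].
Let q u := inf (S u).

Let bI1 y : bmeas (\1_(`]-oo, y]%classic) : R -> R).
Proof. by apply: bmeas_indic; exact: measurable_itv. Qed.

Let bI2 T : bmeas (\1_([set x | T < `|x|]) : R -> R).
Proof. by apply: bmeas_indic; exact: measurable_norm_gt. Qed.

Lemma lower_quantile_has_inf u : 0 < u -> u < 1 -> has_inf (S u).
Proof.
move=> u0 u1; split.
  have [T HT] := tight (e := 1 - u) ltac:(by rewrite subr_gt0).
  exists T; rewrite /S/=; apply: filterS HT => n H.
  suff : 1 <= F n T + fine (m_ n [set x | T < `|x|]) by lra.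
  rewrite cdf_exp -(@exp_indic _ _ _ (m_ n)); last exact: measurable_norm_gt.
  rewrite -expD; do ?[exact: bI1|exact: bI2].
  rewrite -[leLHS](exp_cst (m_ n)); apply: le_exp; [exact: bmeas_cst| |move=> x].
    by apply: bmeasD; [exact: bI1|exact: bI2].
  rewrite !indicE; have [xT|xT] := leP x T; first by rewrite mem_set ?lerDl ?in_itv.
  have -> : (x \in [set x | T < `|x|]) = true.
    by rewrite mem_set//= (lt_le_trans xT)// ler_norm.
  by rewrite lerDr.
have [T HT] := tight (e := u / 2) ltac:(by rewrite divr_gt0).
exists (- T) => y Sy; rewrite leNgt; apply/negP => yT.
have [n [H1 H2]] : exists n, fine (m_ n [set x | T < `|x|]) <= u / 2 /\ u <= F n y.
  by have [n [? ?]] := filter_ex (filterI HT Sy); exists n.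
have : F n y <= fine (m_ n [set x | T < `|x|]).
  rewrite cdf_exp -(@exp_indic _ _ _ (m_ n)); last exact: measurable_norm_gt.
  apply: le_exp; [exact: bI1|exact: bI2|].
  move=> x; rewrite !indicE; case: (boolP (x \in `]-oo, y]%classic)) => //= /set_mem/=.
  rewrite in_itv/= => xy; rewrite mem_set//= -normrN (lt_le_trans _ (ler_norm _))//.
  by rewrite ltrNr (le_lt_trans xy).
lra.
Qed.

Lemma lower_quantile_mono u v : 0 < u -> u <= v -> v < 1 -> q u <= q v.
Proof.
move=> u0 uv v1; have [[y Sy] _] := lower_quantile_has_inf (lt_le_trans u0 uv) v1.
have [_ lbu] := lower_quantile_has_inf u0 (le_lt_trans uv v1).
apply: lb_le_inf; first by exists y.
move=> z Sz; apply: ge_inf => //.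
by apply: filterS Sz => n; exact: le_trans.
Qed.

Lemma measurable_lower_quantile : measurable_fun (`]0, 1[%classic : set R) q.
Proof.
apply: measurable_fun_itvNy => // y; apply: is_interval_measurable.
move=> a b /= [+ _] [+ qb] c /andP[ac cb]; rewrite !in_itv/= in qb *.
move=> /andP[a0 a1] /andP[b0 b1]; rewrite (lt_le_trans a0)//= (le_lt_trans cb)//.
split=> //; apply: le_trans qb; apply: lower_quantile_mono => //.
exact: lt_le_trans ac.
Qed.

(** The upper bound is the definition of [q u]. For the lower one, left continuity gives [v < u] and
    [z] with [q u - e < z < q v]; then [F k z < v] for arbitrarily large [k], and [cdf_interlace]
    carries this to all large [n] at the point [q u - e]. *)
Lemma quantile_cvg u : 0 < u -> u < 1 ->
  (forall y, y < q u -> exists v, [/\ 0 < v, v < u & y < q v]) ->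
  (fun n => quantile (F n) u) @ \oo --> q u.
Proof.
move=> u0 u1 qc; apply/cvgrPdist_le => /= e e0.
have [y Sy ye] := inf_adherent e0 (lower_quantile_has_inf u0 u1).
have up : \forall n \near \oo, quantile (F n) u <= q u + e.
  apply: filterS Sy => n uF; apply: le_trans (ltW ye).
  by rewrite quantile_le.
have [v [v0 vu qv]] := qc (q u - e) ltac:(by rewrite ltrBlDr ltrDl).
have v1 := lt_trans vu u1.
pose z := ((q u - e) + q v) / 2.
have z1 : q u - e < z by rewrite /z; lra.
have z2 : z < q v by rewrite /z; lra.
have [N HN] := @cdf_interlace _ _ ((u - v) / 2) z1 ltac:(by rewrite divr_gt0 ?subr_gt0).
have [k Nk Fk] : exists2 k, (N <= k)%N & F k z < v.
  apply: contrapT => H; suff : S v z.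
    move=> /(ge_inf (lower_quantile_has_inf v0 v1).2); rewrite leNgt.
    by rewrite -/(q v) z2.
  exists N => // n /= Nn; rewrite leNgt; apply/negP => Fn; apply: H.
  by exists n.
near=> n; rewrite ler_distlC; apply/andP; split; last by near: n.
have Nn : (N <= n)%N by near: n; exact: nbhs_infty_ge.
rewrite leNgt; apply/negP => /ltW; rewrite quantile_le//.
rewrite -/(F n) => uF; have := HN n k Nn Nk; lra.
Unshelve. all: by end_near. Qed.

Let jumps := [set u | 0 < u < 1 /\
  exists y, y < q u /\ forall v, 0 < v < u -> q v <= y].

(** [q] is monotone: its gaps at distinct left discontinuities are disjoint, and each contains a
    rational. *)
Lemma countable_jumps : countable jumps.
Proof.
pose J (r : rat) := [set u : R | 0 < u < 1 /\ (ratr r < q u /\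
  forall v, 0 < v < u -> q v <= ratr r)].
apply: (@sub_countable _ _ _ (\bigcup_(r in [set: rat]) J r)).
  apply: subset_card_le => u [u01 [y [yq H]]].
  have [r yr] := rat_in_itvoo yq; move: yr; rewrite in_itv/= => /andP[yr rq].
  exists r => //; split=> //; split=> // v vu.
  by rewrite (le_trans (H v vu))// ltW.
apply: bigcup_countable => // r _.
have [[u Ju]|nJ] := pselect (exists u, J r u); last first.
  rewrite (_ : J r = set0)//; apply/seteqP; split=> // u Ju; apply: nJ.
  by exists u.
apply: finite_set_countable; apply: (@sub_finite_set _ _ [set u]) => // v Jv /=.
have aux a b : J r a -> J r b -> a < b -> False.
  move=> [/andP[a0 a1] [ra _]] [_ [_ H]] ab.
  by have := H a; rewrite a0 ab => /(_ isT); rewrite leNgt ra.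
have [uv|vu|//] := ltgtP u v.
  by case: (aux u v).
by case: (aux v u).
Qed.

Lemma ae_quantile_cvg : {ae lebesgue_measure, forall u : R, `]0%R, 1%R[%classic u ->
  (fun n => quantile (F n) (u / 1)) @ \oo --> q u}.
Proof.
exists jumps; split.
- exact: countable_measurable countable_jumps.
- exact: countable_lebesgue_measure0 countable_jumps.
move=> u /= H; apply: contrapT => nJ; apply: H; rewrite in_itv/= => u01.
have /andP[u0 u1] := u01; rewrite divr1; apply: quantile_cvg => // y yq.
apply: contrapT => H; apply: nJ; split=> //; exists y; split=> // v /andP[v0 vu].
rewrite leNgt; apply/negP => yv; apply: H; exists v; split=> //.
Qed.

(** Skorokhod's representation: every [m_ n] and the limit are images of Lebesgue measure on ]0, 1[
    under quantile functions that converge almost everywhere. Bounded convergence then handles any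
    bounded function that is continuous at almost every [q u], including the indicator of a
    half-line ending at a continuity point. *)
Lemma limit_law_exists : exists mu : probability R R,
  (forall y, {for y, continuous (cdf mu)} -> F ^~ y @ \oo --> cdf mu y) /\
  forall g : R -> R, continuous g -> bmeas g ->
    (fun n => \int[m_ n]_x g x) @ \oo --> \int[mu]_x g x.
Proof.
have mD : measurable (`]0%R, 1%R[%classic : set R) by exact: measurable_itv.
have lD : lebesgue_measure (`]0%R, 1%R[%classic : set R) = 1%E.
  by rewrite lebesgue_measure_itv/= lte_fin ltr01 sube0.
have [mu muE] := image_probability mD measurable_lower_quantile lD.
have mqn n : measurable_fun (`]0, 1[%classic : set R) (fun u => quantile (F n) (u / 1)).
  exact: measurable_quantilel.
have mE n (B : set R) : measurable B -> m_ n B =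
    lebesgue_measure (`]0%R, 1%R[ `&` (fun u => quantile (F n) (u / 1)) @^-1` B).
  move=> mB; rewrite -(@quantile_image _ (m_ n) 1)//; first by rewrite mul1e.
  by move=> y; exact: quantilel_measure.
have dct (g : R -> R) : bmeas g ->
    {ae lebesgue_measure, forall u : R, `]0%R, 1%R[%classic u ->
      (fun n => g (quantile (F n) (u / 1))) @ \oo --> g (q u)} ->
    (fun n => \int[m_ n]_x g x) @ \oo --> \int[mu]_x g x.
  move=> [mg [M gM]] gq.
  rewrite (@Rintegral_image _ (measurableTypeR R) R _ _ _ _ _ mD measurable_lower_quantile muE mg).
  under eq_cvg do rewrite (@Rintegral_image _ (measurableTypeR R) R _ _ _ _ _ mD (mqn _) (mE _) mg).
  apply: (@Rintegral_dct _ _ _ _ _ _ _ (cst M)).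
  - exact: mD.
  - by move=> n; apply: measurableT_comp => //; exact: mqn.
  - by apply: measurableT_comp => //; exact: measurable_lower_quantile.
  - exact: gq.
  - apply: (integrable_bounded_itv (a := 0) (b := 1) (M := `|M|) mD) => //.
    exact: subset_itv_oo_cc.
  - by apply: nearW => n u _.
have aeF := ae_filter_ringOfSetsType (@lebesgue_measure R).
exists mu; split; last first.
  move=> g cg bg; apply: dct => //.
  apply: filterS ae_quantile_cvg => u H uD.
  exact: (cvg_comp _ _ (H uD) (cg (q u))).
move=> y cy.
(* A continuity point of the distribution function carries no atom, so [q u] differs from [y] for
   almost every [u]. *)
have muy0 : mu [set y] = 0%E.
  rewrite -[LHS]fineK ?fin_num_measure//; congr EFin.
  apply/eqP; rewrite eq_le fine_ge0// andbT; apply/ler_addgt0Pr => e e0.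
  rewrite add0r.
  have /cvgrPdist_lt /(_ e e0) := cy.
  move=> /nbhs_ballP[r /= r0 Hr].
  have := Hr (y - r / 2); rewrite /ball/= opprB addrC subrK.
  rewrite gtr0_norm ?divr_gt0// ltr_pdivrMr// ltr_pMr// ltr1n => /(_ isT).
  set z := y - r / 2 => Fz.
  have zy : z < y by rewrite /z ltrBlDr ltrDl divr_gt0.
  apply: le_trans (ltW Fz); apply: le_trans (ler_norm _).
  rewrite lerBrDr -lee_fin EFinD -cdfE fineK ?fin_num_measure// -cdfE.
  rewrite -measureU//; last first.
    by apply/seteqP; split=> // x [/= ->]; rewrite in_itv/= leNgt zy.
  apply: le_measure; rewrite ?inE.
  - by apply: measurableU => //; exact: measurable_itv.
  - exact: measurable_itv.
  - by move=> x [->|]/=; rewrite !in_itv/= ?lexx// => /le_trans; apply; exact: ltW.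
have -> : cdf mu y = \int[mu]_x (\1_(`]-oo, y]%classic) x : R).
  by rewrite exp_indic//; exact: measurable_itv.
under eq_cvg do rewrite cdf_exp.
apply: dct; first exact: bI1.
have aey : {ae lebesgue_measure, forall u : R, `]0%R, 1%R[%classic u -> q u != y}.
  exists (`]0%R, 1%R[%classic `&` q @^-1` [set y]); split.
  - exact: measurable_lower_quantile.
  - by rewrite -muE.
  - move=> u /= /existsNP[u01 /negP/negPn/eqP quy]; split=> //.
apply: filterS2 ae_quantile_cvg aey => u H H' uD.
have {}H := H uD; have {H' uD} := H' uD; rewrite neq_lt => /orP[qy|yq].
  have -> : \1_(`]-oo, y]%classic) (q u) = 1 :> R.
    by rewrite indicE mem_set//= in_itv/= ltW.
  apply: cvg_near_cst; have : \forall n \near \oo, quantile (F n) (u / 1) < y.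
    by apply: (cvgr_lt (q u)).
  by apply: filterS => n /= ?; rewrite indicE mem_set//= in_itv/= ltW.
have -> : \1_(`]-oo, y]%classic) (q u) = 0 :> R.
  by rewrite indicE memNset//= in_itv/= leNgt yq.
apply: cvg_near_cst; have : \forall n \near \oo, y < quantile (F n) (u / 1).
  by apply: (cvgr_gt (q u)).
by apply: filterS => n /= nq; rewrite indicE memNset//= in_itv/= leNgt nq.
Qed.

End limit_law.

Section levy.
Context (R : realType).
Implicit Types (m : probability R R).

Lemma continuous_compM (t : R) (f : R -> R) : continuous f ->
  continuous (fun x : R => f (t * x)).
Proof.
move=> cf x; apply: (cvg_comp (fun x : R => t * x) f); last exact: cf.
by apply: cvgMr; exact: cvg_id.
Qed.

Lemma integral_onemcos (x u : R) : x != 0 -> 0 < u ->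
  (\int[lebesgue_measure]_(t in `[0%R, u]) (1 - cos (t * x))%:E =
   (u - sin (u * x) / x)%:E)%E.
Proof.
move=> x0 u0.
pose G (t : R) : R := t - sin (t * x) / x.
have dG (t : R) : is_derive t 1 G (1 - cos (t * x)).
  apply: is_derive_eq; rewrite /GRing.scale/=.
  by field.
have cG (t : R) : G @ t --> G t.
  by apply: differentiable_continuous; apply/derivable1_diffP.
rewrite (@continuous_FTC2 _ _ G)//.
- by rewrite /G mul0r sin0 mul0r subr0 sube0.
- apply: continuous_subspaceT => t.
  apply: cvgB; first exact: cvg_cst.
  apply: (cvg_comp (fun t : R => t * x) cos); last exact: continuous_cos.
  by apply: cvgMl; exact: cvg_id.
- split; first by move=> t _.
    by apply: cvg_at_right_filter; exact: cG.
  by apply: cvg_at_left_filter; exact: cG.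
- by move=> t _; rewrite derive1E; exact: derive_val.
Qed.

Let chf m t := \int[m]_x cos (t * x).

Let bc (t : R) : bmeas (fun x : R => cos (t * x)).
Proof. exact: bcos. Qed.

Let b1c (t : R) : bmeas (fun x : R => 1 - cos (t * x)).
Proof. by apply: bmeasB => //; exact: bmeas_cst. Qed.

Let c1 (y : R) : 0 <= 1 - cos y.
Proof. by rewrite subr_ge0 cos_le1. Qed.

Let int1c m t : (\int[m]_x (1 - cos (t * x))%:E = (1 - chf m t)%:E)%E.
Proof.
rewrite -[LHS]fineK; last by apply: integrable_fin_num => //; exact: bmeas_integrable.
congr EFin; rewrite -[LHS]/(\int[m]_x (1 - cos (t * x))).
by rewrite (@expB _ _ _ m (cst 1))// ?exp_cst//; exact: bmeas_cst.
Qed.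

Let mprod : measurable_fun setT (fun z : measurableTypeR R * R => cos (z.1 * z.2)).
Proof.
apply: (measurableT_comp (f := @cos R)).
  by apply: continuous_measurable_fun; exact: continuous_cos.
by apply: measurable_funM; [exact: measurable_fst|exact: measurable_snd].
Qed.

Lemma measurable_chf m : measurable_fun setT (chf m : R -> R).
Proof.
pose f (z : measurableTypeR R * R) : \bar R := (1 - cos (z.1 * z.2))%:E.
have mf : measurable_fun setT f by apply/measurable_EFinP; exact: measurable_funB.
have := @measurable_fun_fubini_tonelli_F _ _ _ _ R m f mf
  (fun z => c1 (z.1 * z.2)).
rewrite (_ : fubini_F m f = EFin \o (fun t => 1 - chf m t)); last first.
  by apply/funext => t; rewrite /fubini_F int1c.
move/measurable_EFinP => H.
rewrite (_ : chf m = (fun t => 1 - (1 - chf m t))); last by apply/funext => t; ring.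
exact: measurable_funB.
Qed.

Lemma chf_le1 m t : `|chf m t| <= 1.
Proof. by apply: norm_exp_le => // x; rewrite ler_norml cos_geN1 cos_le1. Qed.

Lemma integrable_onemchf m (u : R) :
  lebesgue_measure.-integrable (`[0, u]%classic : set R)
    (EFin \o (fun t => 1 - chf m t)).
Proof.
apply: (@integrable_bounded_itv R 0 u 2) => //.
- by apply: measurable_funB => //; apply: measurable_funTS; exact: measurable_chf.
- by move=> t _; apply: (le_trans (ler_normB _ _)); rewrite normr1; have := chf_le1 m t; lra.
Qed.

(** After exchanging the integrals, the inner one is [u - sin (u * x) / x], which is at least
    [u / 2] as soon as [|x| > 2 / u]; elsewhere it is non-negative. *)
Lemma chf_tail m (u : R) : 0 < u ->
  u / 2 * fine (m [set x | 2 / u < `|x|]) <=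
    \int[lebesgue_measure]_(t in `[0, u]) (1 - chf m t).
Proof.
move=> u0; rewrite -lee_fin.
have mtail : measurable [set x : R | 2 / u < `|x|] by exact: measurable_norm_gt.
rewrite EFinM fineK ?fin_num_measure//.
rewrite /Rintegral fineK; last first.
  by apply: integrable_fin_num => //; exact: integrable_onemchf.
pose D : set R := `[0, u]%classic.
have mD : measurable D by exact: measurable_itv.
pose f (z : measurableTypeR R * R) : \bar R :=
  ((1 - cos (z.1 * z.2)) * \1_D z.1)%:E.
have mf : measurable_fun setT f.
  apply/measurable_EFinP; apply: measurable_funM; first exact: measurable_funB.
  by apply: measurableT_comp; [exact: measurable_indic|exact: measurable_fst].
have f0 z : (0 <= f z)%E by rewrite lee_fin mulr_ge0// indicE.
have D01 (g : R -> R) : (fun t => (g t * \1_D t)%:E) = ((EFin \o g) \_ D).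
  apply/funext => t; rewrite patchE indicE; case: ifP => tD /=; by rewrite ?mulr1 ?mulr0.
rewrite [leRHS](_ : _ = \int[lebesgue_measure]_t \int[m]_x f (t, x))%E; last first.
  rewrite integral_mkcond -(D01 (fun t => 1 - chf m t)); apply: eq_integral => t _.
  rewrite /f/=; under eq_integral do rewrite mulrC EFinM.
  rewrite ge0_integralZl//; first by rewrite int1c -EFinM mulrC.
  by apply/measurable_EFinP; exact: (b1c t).1.
rewrite (@fubini_tonelli _ _ (measurableTypeR R) R R lebesgue_measure m f)//.
rewrite -(integral_cst m mtail (u / 2)%:E) integral_mkcond.
apply: ge0_le_integral => //.
- by move=> x _; rewrite patchE; case: ifP => // _; rewrite lee_fin divr_ge0// ltW.
- apply/(measurable_restrictT _ _).1 => //.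
- exact: (@measurable_fun_fubini_tonelli_G _ _ (measurableTypeR R) R R lebesgue_measure f).
move=> x _; rewrite patchE; case: ifPn => [/set_mem/= ux|_]; last exact: integral_ge0.
rewrite (_ : (\int[_]_t _)%E = (\int[lebesgue_measure]_(t in D) (1 - cos (t * x))%:E)%E); last first.
  by rewrite [RHS]integral_mkcond -(D01 (fun t => 1 - cos (t * x))).
have x0 : x != 0 by rewrite -normr_gt0 (lt_trans _ ux)// divr_gt0.
rewrite integral_onemcos// lee_fin.
suff : sin (u * x) / x <= u / 2 by lra.
apply: (le_trans (ler_norm _)); rewrite normrM normfV.
rewrite ler_pdivrMr ?normr_gt0//; apply: (@le_trans _ _ 1).
  by rewrite ler_norml sin_geN1 sin_le1.
rewrite -ler_pdivrMl ?divr_gt0// mulr1 invf_div; exact: ltW.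
Qed.

(** Continuity of [C] at 0 makes the mean of [1 - C] on a short interval [0, u] small; [chf_tail]
    turns this into tightness. The functions [C] and [S] are then recognized by testing the limit
    law on cosines and sines. *)
Theorem levy_continuity (m_ : nat -> probability R R) (C S : R -> R) :
  (forall t, (fun n => \int[m_ n]_x cos (t * x)) @ \oo --> C t) ->
  (forall t, (fun n => \int[m_ n]_x sin (t * x)) @ \oo --> S t) ->
  C @ 0 --> (1 : R) ->
  exists mu : probability R R,
    [/\ forall y, {for y, continuous (cdf mu)} ->
          (fun n => cdf (m_ n) y) @ \oo --> cdf mu y,
        forall t, \int[mu]_x cos (t * x) = C t &
        forall t, \int[mu]_x sin (t * x) = S t].
Proof.
move=> mC mS C1.
have [|||mu [cdfcvg intcvg]] := @limit_law_exists R m_.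
- by move=> t; apply/cvg_ex; exists (C t); exact: mC.
- by move=> t; apply/cvg_ex; exists (S t); exact: mS.
- move=> e e0.
  (* The bound [e / 4] on [1 - C] leaves room for a mean below [e / 2] at all large [n], and the
     factor [u / 2] in [chf_tail] makes it [e]. *)
  have /cvgrPdist_le /(_ (e / 4) ltac:(by rewrite divr_gt0)) := C1.
  move=> /nbhs_ballP[r /= r0 Hr].
  pose u := r / 2; have u0 : 0 < u by rewrite divr_gt0.
  have Hu t : `[0, u]%classic t -> 1 - C t <= e / 4.
    rewrite /= in_itv/= => /andP[t0 tu]; apply: le_trans (ler_norm _) _.
    apply: Hr; rewrite /ball/= sub0r normrN ger0_norm// (le_lt_trans tu)//.
    by rewrite ltr_pdivrMr// ltr_pMr// ltr1n.
  have mchf n : measurable_fun (`[0, u]%classic : set R) (fun t => 1 - chf (m_ n) t).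
    apply: measurable_funB => //; apply: measurable_funTS.
    exact: measurable_chf.
  have mC' : measurable_fun (`[0, u]%classic : set R) (fun t => 1 - C t).
    apply: measurable_fun_cvg mchf _ => t _.
    by apply: cvgB; [exact: cvg_cst|exact: mC].
  have icst (M : R) : lebesgue_measure.-integrable (`[0, u]%classic : set R) (EFin \o cst M).
    exact: (@integrable_bounded_itv R 0 u `|M|).
  have Icvg : (fun n => \int[lebesgue_measure]_(t in `[0, u]) (1 - chf (m_ n) t)) @ \oo -->
      \int[lebesgue_measure]_(t in `[0, u]) (1 - C t).
    apply: (@Rintegral_dct _ _ _ _ _ _ _ (cst 2)) => //.
    - by apply: aeW => t _; apply: cvgB; [exact: cvg_cst|exact: mC].
    - apply: nearW => n t _ /=; apply: (le_trans (ler_normB _ _)).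
      by rewrite normr1; have := chf_le1 (m_ n) t; lra.
  have Ile : \int[lebesgue_measure]_(t in `[0, u]) (1 - C t) <= u * (e / 4).
    rewrite (_ : u * _ = \int[lebesgue_measure]_(t in `[0, u]) (e / 4)).
      apply: le_Rintegral; [exact: measurable_itv| |exact: icst|exact: Hu].
      apply: (integrable_bounded _ _ (icst 2)) => // t _.
      apply: (le_trans (ler_normB _ _)); rewrite normr1.
      suff : `|C t| <= 1 by move=> H; rewrite /cst; lra.
      by apply: (closed_cvg _ (@closed_le _ 1) _ _ (cvg_norm (mC t)));
        apply: nearW => n; exact: chf_le1.
    rewrite Rintegral_cst//= lebesgue_measure_itv/= lte_fin u0 sube0/=.
    by rewrite mulrC.
  exists (2 / u).
  have I2 : \forall n \near \oo, \int[lebesgue_measure]_(t in `[0, u]) (1 - chf (m_ n) t) < u * (e / 2).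
    apply: (cvgr_lt (\int[lebesgue_measure]_(t in `[0, u]) (1 - C t))) => //.
    by apply: le_lt_trans Ile _; rewrite ltr_pM2l//; lra.
  apply: filterS I2 => n H.
  have H2 := chf_tail (m_ n) u0.
  have := le_lt_trans H2 H; rewrite (_ : u * (e / 2) = u / 2 * e); last by field.
  by rewrite ltr_pM2l ?divr_gt0// => /ltW.
exists mu; split; first exact: cdfcvg.
- move=> t; have := intcvg (fun x => cos (t * x)) _ (bcos t).
  by move=> /(_ (@continuous_compM t _ (@continuous_cos R))) H; rewrite -(cvg_lim _ H)// (cvg_lim _ (mC t)).
- move=> t; have := intcvg (fun x => sin (t * x)) _ (bsin t).
  by move=> /(_ (@continuous_compM t _ (@continuous_sin R))) H; rewrite -(cvg_lim _ H)// (cvg_lim _ (mS t)).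
Qed.

End levy.

(** * Powers of characteristic functions *)

Section power_limit.
Context (R : realType).
Local Notation normc := (@Normc.normc R).

Lemma normc_le (a b : R) : normc (a +i* b)%C <= `|a| + `|b|.
Proof.
rewrite /Normc.normc/= -[leRHS]ger0_norm ?addr_ge0// -sqrtr_sqr ler_wsqrtr//.
rewrite sqrrD !real_normK ?num_real//.
have : 0 <= `|a| * `|b| by rewrite mulr_ge0.
lra.
Qed.

Lemma Re_le_normc (z : R[i]) : `|complex.Re z| <= normc z.
Proof.
case: z => a b /=; rewrite -sqrtr_sqr ler_wsqrtr//.
by rewrite lerDl sqr_ge0.
Qed.

Lemma Im_le_normc (z : R[i]) : `|complex.Im z| <= normc z.
Proof.
case: z => a b /=; rewrite -sqrtr_sqr ler_wsqrtr//.
by rewrite lerDr sqr_ge0.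
Qed.

Lemma normc_ge0 (z : R[i]) : 0 <= normc z.
Proof. by case: z => a b; exact: sqrtr_ge0. Qed.

Lemma normc_expr_le1 (z : R[i]) k : normc z <= 1 -> normc (z ^+ k) <= 1.
Proof.
move=> z1; elim: k => [|k IH]; first by rewrite expr0 Normc.normc1.
by rewrite exprS Normc.normcM mulr_ile1// normc_ge0.
Qed.

Lemma normc_expr_sub (z w : R[i]) k : normc z <= 1 -> normc w <= 1 ->
  normc (z ^+ k - w ^+ k) <= k%:R * normc (z - w).
Proof.
move=> z1 w1; elim: k => [|k IH].
  by rewrite !expr0 subrr Normc.normc0 mul0r.
have -> : z ^+ k.+1 - w ^+ k.+1 = z * (z ^+ k - w ^+ k) + (z - w) * w ^+ k.
  by rewrite !exprS; ring.
apply: (le_trans (le_normcD _ _)).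
rewrite !Normc.normcM -natr1 mulrDl mul1r lerD//.
  by apply: le_trans IH; rewrite ler_piMl// normc_ge0.
by rewrite ler_piMr// ?normc_ge0// normc_expr_le1.
Qed.

Lemma cvg_diff_quotient (f : R -> R) (l : R) (k : nat -> nat) :
  is_derive (0 : R) 1 f l ->
  (fun n => (k n)%:R : R) @ \oo --> +oo ->
  (fun n => (k n)%:R * (f (k n)%:R^-1 - f 0)) @ \oo --> l.
Proof.
move=> [df fl] koo.
have kpos : \forall n \near \oo, 0 < (k n)%:R :> R by apply: cvgry_gt.
have k0 : (fun n => (k n)%:R^-1 : R) @ \oo --> 0 by apply/gtr0_cvgV0.
have : (fun h => h^-1 *: (f (h *: 1 + 0) - f 0)) @ 0^' --> l.
  by move/cvg_ex : (df) => [l' dl']; rewrite -fl /derive (cvg_lim _ dl').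
move=> /cvgrPdist_lt H; apply/cvgrPdist_lt => e e0.
have [r /= r0 Hr] := H e e0.
have kr : \forall n \near \oo, `|(k n)%:R^-1| < r :> R.
  by move/cvgr0Pnorm_lt : k0; exact.
near=> n.
have kn : 0 < (k n)%:R :> R by near: n; exact: kpos.
have := Hr (k n)%:R^-1; rewrite /= sub0r normrN => /(_ ltac:(near: n; exact: kr)).
rewrite invr_eq0 gt_eqF// => /(_ isT).
by rewrite invrK /GRing.scale/= mulr1 addr0.
Unshelve. all: by end_near. Qed.

(** The base is compared with [exp ((re + i im) / k)], whose power [k] is exactly the limit. Since
    [|z ^ k - w ^ k| <= k |z - w|] in the unit disk, it suffices that both bases have the same
    first-order term in [1 / k]. The sign of [re] keeps the comparison base in the disk. *)
Lemma power_limit (k : nat -> nat) (c s : nat -> R) (re im : R) :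
  (fun n => (k n)%:R : R) @ \oo --> +oo ->
  (forall n, normc (c n +i* s n)%C <= 1) ->
  (fun n => (k n)%:R * (c n - 1)) @ \oo --> re ->
  (fun n => (k n)%:R * s n) @ \oo --> im ->
  (fun n => complex.Re ((c n +i* s n)%C ^+ k n)) @ \oo --> expR re * cos im /\
  (fun n => complex.Im ((c n +i* s n)%C ^+ k n)) @ \oo --> expR re * sin im.
Proof.
move=> koo z1 cre sim.
have c1 n : c n <= 1.
  by apply: le_trans (le_trans (Re_le_normc _) (z1 n)); exact: ler_norm.
have re0 : re <= 0.
  apply: (closed_cvg _ (@closed_le _ 0) _ _ cre); apply: nearW => n /=.
  by rewrite mulr_ge0_le0// subr_le0.
pose fc (t : R) : R := expR (re * t) * cos (im * t).
pose fs (t : R) : R := expR (re * t) * sin (im * t).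
pose w n : R[i] := (fc (k n)%:R^-1 +i* fs (k n)%:R^-1)%C.
have w1 n : normc (w n) <= 1.
  rewrite /w /= !exprMn -mulrDr cos2Dsin2 mulr1 sqrtr_sqr ger0_norm ?expR_ge0//.
  by rewrite expR_le1// mulr_le0_ge0.
have wX n j : w n ^+ j = (fc (j%:R * (k n)%:R^-1) +i* fs (j%:R * (k n)%:R^-1))%C.
  elim: j => [|j IH]; first by rewrite expr0 /fc /fs mul0r !mulr0 expR0 cos0 sin0 mulr1 mulr0.
  rewrite exprS IH /w; apply/eqP; rewrite eq_complex /= /fc /fs.
  rewrite -natr1 mulrDl mul1r !mulrDr !expRD cosD sinD.
  by apply/andP; split; apply/eqP; ring.
have kpos : \forall n \near \oo, 0 < (k n)%:R :> R by apply: cvgry_gt.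
have wk : \forall n \near \oo, w n ^+ k n = (expR re * cos im +i* (expR re * sin im))%C.
  near=> n; rewrite wX mulfV; first by rewrite /fc /fs !mulr1.
  by rewrite gt_eqF//; near: n; exact: kpos.
have dfc : is_derive (0 : R) 1 fc re.
  apply: is_derive_eq; rewrite /GRing.scale/= !mulr0 expR0 cos0 sin0; ring.
have dfs : is_derive (0 : R) 1 fs im.
  apply: is_derive_eq; rewrite /GRing.scale/= !mulr0 expR0 cos0 sin0; ring.
have e0 : (fun n => (k n)%:R * normc ((c n +i* s n)%C - w n)) @ \oo --> (0 : R).
  have fc0 : fc 0 = 1 by rewrite /fc !mulr0 expR0 cos0 mulr1.
  have fs0 : fs 0 = 0 by rewrite /fs !mulr0 sin0 mulr0.
  have H1 := cvg_diff_quotient dfc koo; have H2 := cvg_diff_quotient dfs koo.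
  pose bnd n := `|(k n)%:R * (c n - 1) - (k n)%:R * (fc (k n)%:R^-1 - fc 0)| +
    `|(k n)%:R * s n - (k n)%:R * (fs (k n)%:R^-1 - fs 0)|.
  have Hh : bnd @ \oo --> (0 : R).
    have -> : (0 : R) = `|0 : R| + `|0 : R| by rewrite normr0 addr0.
    have h1 : (fun n => (k n)%:R * (c n - 1) - (k n)%:R * (fc (k n)%:R^-1 - fc 0))
      @ \oo --> re - re by exact: cvgB.
    have h2 : (fun n => (k n)%:R * s n - (k n)%:R * (fs (k n)%:R^-1 - fs 0))
      @ \oo --> im - im by exact: cvgB.
    by rewrite !subrr in h1 h2; apply: cvgD; exact: cvg_norm.
  apply: (@squeeze_cvgr _ _ _ _ (fun=> 0) bnd); [|exact: cvg_cst|exact: Hh].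
  rewrite /bnd; apply: nearW => n; rewrite mulr_ge0 ?normc_ge0//= fc0 fs0 subr0.
  rewrite -!mulrBr !normrM normr_nat -mulrDr ler_wpM2l//.
  apply: le_trans (normc_le _ _) _; rewrite lerD//.
  by rewrite le_eqVlt; apply/orP; left; apply/eqP; congr `| _ |; ring.
have H : (fun n => normc ((c n +i* s n)%C ^+ k n -
   (expR re * cos im +i* (expR re * sin im))%C)) @ \oo --> (0 : R).
  apply: (@squeeze_cvgr _ _ _ _ (fun=> 0) _ _ _ _ _ e0); last exact: cvg_cst.
  near=> n; rewrite normc_ge0/=.
  by rewrite -(near wk n)//; exact: normc_expr_sub.
have lim (p : {additive R[i] -> R}) : (forall z, `|p z| <= normc z) ->
    (fun n => p ((c n +i* s n)%C ^+ k n)) @ \oo --> p (expR re * cos im +i* (expR re * sin im))%C.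
  move=> pz; apply/cvgrPdist_lt => e e1; near=> n.
  rewrite distrC -raddfB; apply: le_lt_trans (pz _) _; rewrite -[ltLHS]ger0_norm ?normc_ge0//.
  by near: n; move/cvgr0Pnorm_lt : H; exact.
by split; [exact: (lim (@complex.Re R) (@Re_le_normc))|exact: (lim (@complex.Im R) (@Im_le_normc))].
Unshelve. all: by end_near. Qed.

End power_limit.

(** * Heavy tails *)

Section heavy_tail.
Context (R : realType).
Local Notation lam := (@lebesgue_measure R).
Local Notation D0 := (`[0%R, +oo[%classic : set R).
Local Notation D1 := (`[1%R, +oo[%classic : set R).

Lemma cvg_powR_neg (s : R) : 0 < s -> (fun x : R => x `^ (- s)) @ +oo --> (0 : R).
Proof.
move=> s0; apply/cvgrPdist_lt => e e0; near=> x.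
have x0 : 0 < x by near: x; exact: nbhs_pinfty_gt.
rewrite sub0r normrN ger0_norm ?powR_ge0// powRN.
rewrite invf_plt ?posrE ?powR_gt0//.
have -> : e^-1 = (e^-1 `^ s^-1) `^ s.
  by rewrite -powRrM mulVf ?gt_eqF// powRr1// invr_ge0 ltW.
have xe : e^-1 `^ s^-1 < x by near: x; apply: nbhs_pinfty_gt; rewrite num_real.
by apply: gt0_ltr_powR; rewrite ?nnegrE ?powR_ge0// ltW.
Unshelve. all: by end_near. Qed.

Lemma integrable_powR_neg (r : R) : 1 < r ->
  lam.-integrable D1 (EFin \o (fun u => u `^ (- r))).
Proof.
move=> r1; have mp : measurable_fun D1 (fun u : R => u `^ (- r)).
  by apply: measurable_funTS; exact: measurable_powR.
apply/integrableP; split; first exact/measurable_EFinP.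
under eq_integral do rewrite /= ger0_norm ?powR_ge0//.
pose F (x : R) : R := - (r - 1)^-1 * x `^ (1 - r).
have dF (x : R) : 0 < x -> is_derive x 1 F (x `^ (- r)).
  move=> x0; have H := is_derive1_powR (1 - r) x0.
  have -> : x `^ (- r) = - (r - 1)^-1 *: ((1 - r) * x `^ (1 - r - 1)).
    rewrite (_ : 1 - r - 1 = - r); last by ring.
    rewrite /GRing.scale/=; field; lra.
  exact: is_deriveZ.
have cF (x : R) : 0 < x -> F @ x --> F x.
  move=> x0; apply: differentiable_continuous; apply/derivable1_diffP.
  by have [] := dF x x0.
rewrite (@ge0_continuous_FTC2y _ _ F 1 0)//.
- by rewrite -EFinB ltry.
- by move=> x _; exact: powR_ge0.
- apply: continuous_in_subspaceT => x; rewrite inE/= in_itv/= andbT => x1.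
  have x0 : 0 < x by exact: lt_le_trans x1.
  apply: differentiable_continuous; apply/derivable1_diffP.
  by apply: derivable_powR; rewrite in_itv/= andbT.
- rewrite -[X in _ --> X](mulr0 (- (r - 1)^-1)); apply: cvgMr.
  rewrite (_ : (1 - r) = - (r - 1)); last by ring.
  by apply: cvg_powR_neg; rewrite subr_gt0.
- by move=> x x1; have [] := dF x (lt_trans ltr01 x1).
- by apply: cvg_at_right_filter; exact: cF.
- move=> x; rewrite in_itv/= andbT => x1.
  by rewrite derive1E; have [_ ->] := dF x (lt_trans ltr01 x1).
Qed.

Lemma nonneg_setU : D0 = `[0%R, 1%R[ `|` D1.
Proof.
apply/seteqP; split=> u /=; rewrite !in_itv/= !andbT.
  by move=> u0; have [u1|u1] := ltP u 1; [left; rewrite u0|right].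
by move=> [/andP[]//|]; apply: le_trans.
Qed.

Lemma cvg_sqrtV (k : nat -> R) : k @ \oo --> +oo ->
  (fun n => (Num.sqrt (k n))^-1) @ \oo --> (0 : R).
Proof.
move=> koo; have kpos : \forall n \near \oo, 0 < Num.sqrt (k n).
  have : \forall n \near \oo, 0 < k n by apply: cvgry_gt.
  by apply: filterS => n; rewrite sqrtr_gt0.
apply/(gtr0_cvgV0 kpos)/cvgryPgt => M.
have : \forall n \near \oo, M ^+ 2 < k n by apply: cvgry_gt.
apply: filterS => n /= Mk; apply: le_lt_trans (ler_norm M) _.
by rewrite -sqrtr_sqr ltr_sqrt// (le_lt_trans _ Mk)// sqr_ge0.
Qed.

Definition hdom (r u : R) : R := if u < 1 then 1 else u `^ (- r).

Lemma integrable_hdom (r : R) : 1 < r -> lam.-integrable D0 (EFin \o hdom r).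
Proof.
move=> r1.
have mh : measurable_fun D0 (hdom r).
  apply: measurable_funTS; apply: measurable_fun_ifT.
  - by apply: measurable_fun_ltr => //; exact: measurable_cst.
  - exact: measurable_cst.
  - exact: measurable_powR.
apply/integrableP; split; first exact/measurable_EFinP.
have /integrableP[_ fi] := integrable_powR_neg r1.
rewrite nonneg_setU ge0_integral_setU//=; last 2 first.
- by rewrite -nonneg_setU; apply/measurable_EFinP; exact: measurableT_comp.
- apply/disj_setPS => u [] /=; rewrite !in_itv/= andbT => /andP[_ u1].
  by rewrite leNgt u1.
apply: lte_add_pinfty.
  rewrite (eq_integral (cst 1%E)).
    by rewrite integral_cst//= mul1e lebesgue_measure_itv/= lte_fin ltr01 sube0 ltry.
  by move=> u; rewrite inE/= in_itv/= /hdom => /andP[_ ->]; rewrite normr1.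
apply: le_lt_trans fi; rewrite le_eqVlt; apply/orP; left; apply/eqP.
apply: eq_integral => u; rewrite inE/= in_itv/= andbT /hdom => u1.
by rewrite ltNge u1.
Qed.

Section dct.
Variables (E : set R) (rho K C : R) (g : R -> R).
Hypotheses (mE : measurable E) (ED : E `<=` D0) (rho12 : 1 / 2 < rho) (K0 : 0 <= K).
Hypothesis g2 : forall x, 0 <= x -> `|g x| <= C * x ^+ 2.
(** Boundedness is asked only for [u < 1] in [E], where the quantiles have no uniform bound. On [1,
    oo[ the condition is vacuous, which admits the unbounded function [y ^+ 3 / (1 + y ^+ 2)]. *)
Hypothesis g1 : forall u, E u -> u < 1 -> forall x, 0 <= x -> `|g x| <= C.

Let C0 : 0 <= C.
Proof. by have := g2 ler01; rewrite expr1n mulr1; exact: le_trans. Qed.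

Lemma hdom_bound (p : R -> R) : (forall u, 0 <= p u) ->
  (forall u, 1 <= u -> p u <= K * u `^ (- rho)) ->
  forall u, E u -> `|g (p u)| <= C * (1 + K ^+ 2) * hdom (2 * rho) u.
Proof.
move=> p0 pK u Eu; rewrite /hdom; case: ltP => u1.
  rewrite mulr1; apply: le_trans (g1 Eu u1 (p0 u)) _.
  by rewrite ler_peMr// lerDl sqr_ge0.
apply: le_trans (g2 (p0 u)) _; rewrite -mulrA ler_wpM2l//.
apply: (@le_trans _ _ (K ^+ 2 * u `^ (- (2 * rho)))); last first.
  by rewrite ler_wpM2r ?powR_ge0// lerDr.
have -> : u `^ (- (2 * rho)) = (u `^ (- rho)) ^+ 2.
  rewrite -powR_mulrn ?powR_ge0// -powRrM; congr (_ `^ _); ring.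
by rewrite -exprMn lerXn2r// ?nnegrE ?mulr_ge0 ?powR_ge0// pK.
Qed.

Let ih : lam.-integrable E (EFin \o (fun u => C * (1 + K ^+ 2) * hdom (2 * rho) u)).
Proof.
have r1 : 1 < 2 * rho by rewrite mulrC -ltr_pdivrMr.
apply: (@integrableS _ (measurableTypeR R) _ lam D0 E).
- exact: measurable_itv.
- exact: mE.
- exact: ED.
- have H := @integrableZl _ (measurableTypeR R) R lam D0 (measurable_itv _)
    (C * (1 + K ^+ 2)) _ (integrable_hdom r1).
  exact: H.
Qed.

Hypothesis cg : measurable_fun setT g.

Lemma htail_integrable (p : R -> R) : measurable_fun E p ->
  (forall u, E u -> 0 <= p u) ->
  (forall u, 1 <= u -> p u <= K * u `^ (- rho)) ->
  lam.-integrable E (EFin \o (fun u => g (p u))).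
Proof.
move=> mp p0 pK.
pose p' u := Num.max 0 (p u).
apply: (@integrable_bounded _ (measurableTypeR R) R lam E _ _ mE _ ih).
  exact: measurableT_comp.
move=> u Eu; have -> : p u = p' u by rewrite /p' max_r// p0.
apply: hdom_bound => //; first by move=> v; rewrite le_max lexx.
by move=> v v1; rewrite ge_max pK// mulr_ge0// powR_ge0.
Qed.

Lemma htail_dct (p : nat -> R -> R) (q : R -> R) : continuous g ->
  (forall n, measurable_fun setT (p n)) -> measurable_fun E q ->
  (forall n u, 0 <= p n u) ->
  {ae lam, forall u : R, `]0%R, +oo[%classic u -> p ^~ u @ \oo --> q u} ->
  (\forall n \near \oo, forall u, 1 <= u -> p n u <= K * u `^ (- rho)) ->
  (fun n => \int[lam]_(u in E) g (p n u)) @ \oo --> \int[lam]_(u in E) g (q u).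
Proof.
move=> ctg mp mq p0 pq pK.
apply: (@Rintegral_dct _ (measurableTypeR R) R lam E _ _ _ mE _ _ _ ih).
- by move=> n; apply: measurableT_comp => //; apply: measurable_funTS; exact: mp.
- exact: measurableT_comp.
- have aeF := ae_filter_ringOfSetsType lam.
  have ae0 : {ae lam, forall u : R, u != 0}.
    exists [set 0]; split => //; first exact: lebesgue_measure_set1.
    by move=> u /= /negP/negPn/eqP.
  apply: filterS2 pq ae0 => u H u0 /ED/=; rewrite in_itv/= andbT le_eqVlt eq_sym.
  rewrite (negbTE u0)/= => u0'.
  have Hu : `]0%R, +oo[%classic u by rewrite /= in_itv/= u0'.
  exact: (cvg_comp _ _ (H Hu) (ctg (q u))).
- apply: filterS pK => n pKn u Eu; exact: hdom_bound.
Qed.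

End dct.

(* The support condition gives [u ^ (- rho) / sqrt k <= u ^ (- rho - 1/2)]. *)
Lemma htail_sqrt (rho K : R) (k : nat -> R) (p : nat -> R -> R) :
  1 / 2 < rho -> 0 <= K -> k @ \oo --> +oo ->
  (forall n, measurable_fun setT (p n)) -> (forall n u, 0 <= p n u) ->
  (forall n u, k n <= u -> p n u = 0) ->
  (\forall n \near \oo, forall u, 1 <= u -> p n u <= K * u `^ (- rho)) ->
  (fun n => (Num.sqrt (k n))^-1 * \int[lam]_(u in D1) p n u) @ \oo --> (0 : R).
Proof.
move=> rho12 K0 koo mp p0 pk pK.
have rho1 : 1 < rho + 1 / 2 by lra.
have kpos : \forall n \near \oo, 0 < k n by apply: cvgry_gt.
have s0 := cvg_sqrtV koo.
have ih : lam.-integrable D1 (EFin \o (fun u => K * u `^ (- (rho + 1 / 2)))).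
  have H := @integrableZl _ (measurableTypeR R) R lam D1 (measurable_itv _)
    K _ (integrable_powR_neg rho1).
  exact: H.
have dom : \forall n \near \oo, forall u : R, D1 u ->
    `|(Num.sqrt (k n))^-1 * p n u| <= K * u `^ (- (rho + 1 / 2)).
  near=> n => u /=; rewrite in_itv/= andbT => u1.
  have u0 : 0 < u by exact: lt_le_trans u1.
  rewrite ger0_norm ?mulr_ge0 ?invr_ge0 ?sqrtr_ge0//.
  have [ku|uk] := leP (k n) u; first by rewrite pk// mulr0 mulr_ge0// powR_ge0.
  have -> : u `^ (- (rho + 1 / 2)) = u `^ (- rho) * (Num.sqrt u)^-1.
    rewrite opprD powRD; last by rewrite (gt_eqF u0)/= implybT.
    by rewrite powRN (powRN u (1 / 2)) mul1r powR12_sqrt// ltW.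
  rewrite mulrA [leRHS]mulrC ler_pM ?invr_ge0 ?sqrtr_ge0//.
    by rewrite lef_pV2 ?posrE ?sqrtr_gt0 ?(lt_trans u0 uk)// ler_wsqrtr// ltW.
  by move: u u1 {u0 uk}; near: n.
have cv : (fun n => \int[lam]_(u in D1) ((Num.sqrt (k n))^-1 * p n u)) @ \oo -->
    \int[lam]_(u in D1) (0 : R).
  apply: (@Rintegral_dct _ (measurableTypeR R) R lam D1 _ _ _ _ _ _ _ ih) => //.
  - by move=> n; apply: measurable_funM => //; apply: measurable_funTS; exact: mp.
  - apply: aeW => u /=; rewrite in_itv/= andbT => u1.
    apply: (@squeeze_cvgr _ _ _ _ (fun=> 0)
      (fun n => (Num.sqrt (k n))^-1 * (K * u `^ (- rho)))); last 2 first.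
    + exact: cvg_cst.
    + by rewrite -[X in _ --> X](mul0r (K * u `^ (- rho))); apply: cvgMl.
    near=> n; rewrite mulr_ge0 ?invr_ge0 ?sqrtr_ge0//= ler_wpM2l ?invr_ge0 ?sqrtr_ge0//.
    by move: u u1; near: n.
rewrite Rintegral_cst// mul0r in cv.
apply: cvg_trans cv; apply: near_eq_cvg; near=> n.
apply: RintegralZl => //.
have kn0 : 0 < k n by near: n.
have domn : forall u : R, D1 u ->
    `|(Num.sqrt (k n))^-1 * p n u| <= K * u `^ (- (rho + 1 / 2)) by near: n.
have sk0 : 0 < Num.sqrt (k n) by rewrite sqrtr_gt0.
have ih' := @integrableZl _ (measurableTypeR R) R lam D1 (measurable_itv _)
  (Num.sqrt (k n)) _ ih.
apply: (@integrable_bounded _ (measurableTypeR R) R lam D1 _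
  (fun u => Num.sqrt (k n) * (K * u `^ (- (rho + 1 / 2))))) => //.
  by apply: measurable_funTS; exact: mp.
move=> u Du; have := domn u Du; rewrite normrM normfV (gtr0_norm sk0).
by rewrite ler_pdivrMl.
Unshelve. all: by end_near. Qed.

End heavy_tail.

(** * Rescaled quantiles of triangular arrays *)

Section affine.
Context (R : realType).
Local Notation lam := (@lebesgue_measure R).

Lemma lebesgue_measure_affine (a b : R) (B : set R) : a != 0 -> measurable B ->
  (`|a|%:E * lam ((fun u => (a * u + b)%R) @^-1` B) = lam B)%E.
Proof.
move=> a0 mB.
have mf : measurable_fun [set: measurableTypeR R] (fun u : measurableTypeR R => a * u + b : measurableTypeR R).
  by apply: measurable_funD => //; exact: measurable_funM.
have na0 : 0 <= `|a| by [].
pose m2 := measure_function_mscale__canonical__measure_function_Measure (NngNum na0)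
   (measure_function_pushforward__canonical__measure_function_Measure lam mf).
apply/esym; transitivity (m2 B); last by [].
apply: lebesgue_measure_unique => // X [[x y] /= _ <-].
rewrite /mscale/= /pushforward.
have [xy|yx] := ltP x y; last first.
  by rewrite set_itv_ge ?bnd_simp -?leNgt// preimage_set0 !measure0 mule0.
have [a1|a1] := ltP 0 a.
  rewrite (_ : _ @^-1` _ = `](x - b) / a, (y - b) / a]%classic); last first.
    apply/seteqP; split=> u /=; rewrite !in_itv/= ltr_pdivrMr// ler_pdivlMr//;
      by rewrite ltrBlDr lerBrDr (mulrC u).
  rewrite !lebesgue_measure_itv/= !lte_fin xy ltr_pM2r ?invr_gt0// ltrD2r xy.
  by rewrite -!EFinB -EFinM gtr0_norm//; congr EFin; field; rewrite gt_eqF.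
have {}a1 : a < 0 by rewrite lt_neqAle a0.
rewrite (_ : _ @^-1` _ = `[(y - b) / a, (x - b) / a[%classic); last first.
  apply/seteqP; split=> u /=; rewrite !in_itv/= ltr_ndivlMr// ler_ndivrMr//;
    by rewrite ltrBlDr lerBrDr (mulrC u) andbC.
rewrite !lebesgue_measure_itv/= !lte_fin xy ltr_nM2r ?invr_lt0// ltrD2r xy.
by rewrite -!EFinB -EFinM ltr0_norm//; congr EFin; field; rewrite lt_eqF.
Qed.

Lemma integral_affine (a b : R) (I : set R) (f : R -> \bar R) : a != 0 ->
  measurable I -> measurable_fun I f -> (forall s, I s -> 0 <= f s)%E ->
  (`|a|%:E^-1 * \int[lam]_(s in I) f s =
    \int[lam]_(u in (fun u => (a * u + b)%R) @^-1` I) f (a * u + b)%R)%E.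
Proof.
move=> a0 mI mf f0.
have na0 : 0 <= `|a|^-1 by rewrite invr_ge0.
have na1 : `|a| != 0 by rewrite normr_eq0.
rewrite inver (negbTE na1).
rewrite -(@ge0_integral_mscale _ _ R lam I mI (NngNum na0) f)//.
pose q (u : measurableTypeR R) : measurableTypeR R := a * u + b.
rewrite -[X in _ = (\int[_]_(_ in X) _)%E]setTI.
apply: (@integral_image_measure _ (measurableTypeR R) R _ (measurableTypeR R) lam setT q
  (mscale (NngNum na0) lam)) => //.
- by apply: measurable_funD => //; exact: measurable_funM.
move=> B mB _; rewrite setTI; transitivity (`|a|^-1%:E * lam B)%E; first by [].
have H : (`|a|%:E * lam (q @^-1` B) = lam B)%E by exact: lebesgue_measure_affine.
by rewrite -H muleA -EFinM mulVf// mul1e.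
Qed.

End affine.

Section array.
Context (R : realType) (m : probability R R).
Local Notation lam := (@lebesgue_measure R).
Local Notation D0 := (`[0%R, +oo[%classic : set R).
Local Notation D1 := (`[1%R, +oo[%classic : set R).
Let F := cdf m.
Variables (k A : R).

(** Positive parts of the rescaled quantiles read from the two ends, extended by 0. Defined for all
    [u], they admit one dominating function for all [n]; vanishing from [k] on, they are integrable
    at infinity before the limit. *)
Definition lower_array u : R :=
  if (0 < u) && (u < k) then Num.max 0 (- (quantile F (u / k) / A)) else 0.

Definition upper_array u : R :=
  if (0 < u) && (u < k) then Num.max 0 (quantile F (1 - u / k) / A) else 0.

Lemma lower_array_ge0 u : 0 <= lower_array u.
Proof. by rewrite /lower_array; case: ifP => // _; rewrite le_max lexx. Qed.

Lemma upper_array_ge0 u : 0 <= upper_array u.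
Proof. by rewrite /upper_array; case: ifP => // _; rewrite le_max lexx. Qed.

Lemma lower_array_eq0 u : k <= u -> lower_array u = 0.
Proof. by rewrite /lower_array [u < k]ltNge => ->; rewrite andbF. Qed.

Lemma upper_array_eq0 u : k <= u -> upper_array u = 0.
Proof. by rewrite /upper_array [u < k]ltNge => ->; rewrite andbF. Qed.

Let restrE (f : R -> R) : (fun u => if (0 < u) && (u < k) then f u else 0) =
  f \_ (`]0, k[%classic).
Proof.
apply/funext => u; rewrite patchE; congr (if _ then _ else _).
by apply/idP/idP => [H|/set_mem//]; apply/mem_set; rewrite /= in_itv.
Qed.

Hypothesis k0 : 0 < k.

Lemma measurable_lower_array : measurable_fun setT lower_array.
Proof.
rewrite /lower_array (restrE (fun u => Num.max 0 (- (quantile F (u / k) / A)))).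
apply/(measurable_restrictT _ _).1 => //.
apply: measurable_maxr => //; apply: measurable_funN.
by apply: measurable_funM => //; exact: measurable_quantilel.
Qed.

Lemma measurable_upper_array : measurable_fun setT upper_array.
Proof.
rewrite /upper_array (restrE (fun u => Num.max 0 (quantile F (1 - u / k) / A))).
apply/(measurable_restrictT _ _).1 => //.
apply: measurable_maxr => //.
by apply: measurable_funM => //; exact: measurable_quantiler.
Qed.

Lemma Rintegral_quantile (q f : R -> R) :
  measurable_fun `]0, k[ q ->
  (forall y, lam (`]0, k[ `&` q @^-1` `]-oo, y]) = (k * F y)%:E) ->
  bmeas f ->
  k * \int[m]_y f y = \int[lam]_(u in `]0, k[) f (q u).
Proof.
move=> mq qE bf; have intf := bmeas_integrable m bf.
have mf : measurable_fun setT (EFin \o f) by apply/measurable_EFinP; exact: bf.1.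
rewrite /Rintegral [in RHS]integralE.
have -> : (\int[lam]_(u in `]0%R, k[) (fun u => (f (q u))%:E)^\+ u =
    k%:E * \int[m]_y (EFin \o f)^\+ y)%E.
  rewrite (integral_quantile k0 mq qE)//; last exact: measurable_funepos.
  by apply: eq_integral => u _; rewrite !funeposE.
have -> : (\int[lam]_(u in `]0%R, k[) (fun u => (f (q u))%:E)^\- u =
    k%:E * \int[m]_y (EFin \o f)^\- y)%E.
  rewrite (integral_quantile k0 mq qE)//; last exact: measurable_funeneg.
  by apply: eq_integral => u _; rewrite !funenegE.
have fp := integrable_pos_fin_num measurableT intf.
have fn := integrable_neg_fin_num measurableT intf.
rewrite -muleBr//; last exact: fin_num_adde_defr.
by rewrite fineM//; [rewrite -integralE|rewrite fin_numB fp fn].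
Qed.

(** Since [g 0 = 0], [g x] is the sum of its values at the negative and at the positive part of [x].
    Each summand is integrated along the quantile read from its own end, both quantiles having image
    [k * m]. *)
Lemma array_integral (g : R -> R) : bmeas g -> g 0 = 0 ->
  k * \int[m]_x g (x / A) =
  \int[lam]_(u in D0) g (- lower_array u) + \int[lam]_(u in D0) g (upper_array u).
Proof.
move=> bg g0.
have [mg [M gM]] := bg.
have mdiv : measurable_fun setT (fun x : R => x / A) by exact: measurable_funM.
have bl : bmeas (fun x : R => g (- Num.max 0 (- (x / A)))).
  apply: (bmeas_comp bg); apply: measurable_funN; apply: measurable_maxr => //.
  exact: measurable_funN.
have bu : bmeas (fun x : R => g (Num.max 0 (x / A))).
  by apply: (bmeas_comp bg); apply: measurable_maxr.
have split x : g x = g (- Num.max 0 (- x)) + g (Num.max 0 x).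
  have [x0|x0] := leP 0 x.
    by rewrite max_l ?oppr_le0// oppr0 g0 add0r.
  by rewrite max_r ?oppr_ge0 ?ltW// opprK g0 addr0.
under eq_Rintegral do rewrite split.
rewrite expD// mulrDr.
rewrite (Rintegral_quantile (measurable_quantilel m k0) (quantilel_measure m k0) bl).
rewrite (Rintegral_quantile (measurable_quantiler m k0) (quantiler_measure m k0) bu).
have E (f p : R -> R) : (forall u, `]0, k[%classic u -> f u = g (p u)) ->
    (forall u, ~ `]0, k[%classic u -> p u = 0) ->
    \int[lam]_(u in `]0, k[) f u = \int[lam]_(u in D0) g (p u).
  move=> fp p0; rewrite Rintegral_mkcond [RHS]Rintegral_mkcond.
  apply: eq_Rintegral => u _; rewrite !patchE.
  have [uk|uk] := pselect (`]0, k[%classic u).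
    rewrite mem_set// mem_set ?fp//; move: uk; rewrite /= !in_itv/= andbT.
    by move=> /andP[/ltW].
  by rewrite memNset//; case: ifP => // _; rewrite p0// g0 ?oppr0 ?g0.
congr (_ + _).
- rewrite (E _ (fun u => - lower_array u))//.
  + by move=> u; rewrite /= in_itv/= /lower_array => ->.
  + by move=> u; rewrite /= in_itv/= /lower_array => /negP/negbTE ->; rewrite oppr0.
- rewrite (E _ upper_array)//.
  + by move=> u; rewrite /= in_itv/= /upper_array => ->.
  + by move=> u; rewrite /= in_itv/= /upper_array => /negP/negbTE ->.
Qed.

Section centering.
Hypotheses (A0 : 0 < A) (k2 : 2 <= k) (F0k : k^-1 < F 0) (F1k : F 0 < 1 - k^-1).
Let I := (`[k^-1, 1 - k^-1]%classic : set R).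
Let Q := quantile F.

Let ki0 : 0 < k^-1. Proof. by rewrite invr_gt0. Qed.

Let I01 s : I s -> 0 < s /\ s < 1.
Proof.
rewrite /I/= in_itv/= => /andP[s1 s2]; split; first exact: lt_le_trans s1.
by apply: (le_lt_trans s2); rewrite gtrBl.
Qed.

Let mQ : measurable_fun I Q.
Proof.
have := measurable_quantilel m (k := 1) ltr01.
have -> : (fun u : R => quantile (cdf m) (u / 1)) = Q by apply/funext => u; rewrite divr1.
by apply: measurable_funS => // s /I01[s0 s1]; rewrite /= in_itv/= s0.
Qed.

Let Qbound s : I s -> `|Q s| <= Num.max `|Q k^-1| `|Q (1 - k^-1)|.
Proof.
move=> Is; have [s0 s1] := I01 Is; move: Is; rewrite /I/= in_itv/= => /andP[ks sk].
have Q1 : Q k^-1 <= Q s by apply: quantile_mono.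
have Q2 : Q s <= Q (1 - k^-1) by apply: quantile_mono => //; rewrite gtrBl.
have [Q0|Q0] := leP 0 (Q s).
  by rewrite ger0_norm// le_max (le_trans Q2 (ler_norm _)) orbT.
rewrite ltr0_norm// le_max; apply/orP; left.
by rewrite -normrN (le_trans _ (ler_norm _))// lerN2.
Qed.

Let mI : measurable I. Proof. exact: measurable_itv. Qed.

(** Used with [a = - k^-1], [b = 1] for the upper array and [a = k^-1], [b = 0] for the lower one:
    both maps send [1, k - 1] onto [I]. *)
Let affine_side (a b M : R) (h p : R -> R) : `|a| = k^-1 ->
  (fun u => a * u + b) @^-1` I = `[1, k - 1]%classic ->
  measurable_fun I h -> (forall s, I s -> 0 <= h s <= M) -> measurable_fun setT p ->
  (forall u, 1 <= u <= k - 1 -> h (a * u + b) = A * p u) ->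
  (forall u, k - 1 < u -> p u = 0) ->
  k * \int[lam]_(s in I) h s = A * \int[lam]_(u in D1) p u.
Proof.
move=> ak aI mh hM mp hp p0.
have a0 : a != 0 by rewrite -normr_eq0 ak gt_eqF.
have J1 u : `[1, k - 1]%classic u -> I (a * u + b) by rewrite -aI.
have ih : lam.-integrable I (EFin \o h).
  apply: (@integrable_bounded_itv R k^-1 (1 - k^-1) M) => // s Is.
  by have /andP[h0 ?] := hM s Is; rewrite ger0_norm.
have ip : lam.-integrable (`[1, k - 1]%classic : set R) (EFin \o p).
  apply: (@integrable_bounded_itv R 1 (k - 1) (A^-1 * M)) => //.
    exact: measurable_funTS.
  move=> u uJ; have /andP[h0 hMu] := hM _ (J1 u uJ).
  have pE : p u = A^-1 * h (a * u + b).
    by rewrite hp ?mulKf ?gt_eqF//; move: uJ; rewrite /= in_itv.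
  by rewrite pE ger0_norm ?ler_wpM2l ?mulr_ge0 ?invr_ge0 ?(ltW A0).
have -> : k * \int[lam]_(s in I) h s = \int[lam]_(u in `[1, k - 1]) h (a * u + b).
  have := @integral_affine R a b I (EFin \o h) a0 mI.
  rewrite aI ak inver gt_eqF// invrK => H.
  rewrite /Rintegral -[X in X * _]/(fine k%:E) -fineM//.
    congr fine; rewrite H//; first exact/measurable_EFinP.
    by move=> s Is; rewrite lee_fin; have /andP[] := hM s Is.
  exact: integrable_fin_num.
transitivity (\int[lam]_(u in `[1, k - 1]) (A * p u)).
  by apply: eq_Rintegral => u; rewrite inE/= in_itv/= => /hp.
rewrite RintegralZl//; congr (_ * _).
rewrite Rintegral_mkcond [RHS]Rintegral_mkcond; apply: eq_Rintegral => u _; rewrite !patchE.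
have [u1|u1] := pselect (1 <= u); last first.
  by rewrite !memNset//= in_itv/= ?andbT//; apply/negP; rewrite negb_and (introN idP u1).
have [uk|uk] := leP u (k - 1); first by rewrite !mem_set//= in_itv/= u1.
rewrite memNset; first by rewrite mem_set ?p0//= in_itv/= u1.
by rewrite /= in_itv/= u1/= leNgt uk.
Qed.

(** The substitution covers only [u] in [1, k - 1]. Beyond [k - 1] both arrays vanish, because
    [k^-1 < F 0 < 1 - k^-1] gives [Q (u / k)] and [Q (1 - u / k)] the signs that the positive parts
    discard. *)
Lemma array_centering :
  k * \int[lam]_(s in I) Q s / A =
  \int[lam]_(u in D1) upper_array u - \int[lam]_(u in D1) lower_array u.
Proof.
have k1E : 1 - k^-1 = (k - 1) / k by field; rewrite gt_eqF.
have kk u : 1 <= u <= k - 1 -> (0 < u) && (u < k).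
  move=> /andP[u1 uk]; rewrite (lt_le_trans ltr01 u1)/= (le_lt_trans uk)//.
  by rewrite gtrBl.
have mpos : measurable_fun I (fun s => Num.max 0 (Q s)) by apply: measurable_maxr.
have mneg : measurable_fun I (fun s => Num.max 0 (- Q s)).
  by apply: measurable_maxr => //; exact: measurable_funN.
pose M := Num.max `|Q k^-1| `|Q (1 - k^-1)|.
have max0 s (x : R) : I s -> `|x| = `|Q s| -> 0 <= Num.max 0 x <= M.
  move=> Is xQ; rewrite le_max lexx ge_max le_max normr_ge0/= (le_trans (ler_norm _))//.
  by rewrite xQ; exact: Qbound.
have ipos : lam.-integrable I (EFin \o (fun s => Num.max 0 (Q s))).
  apply: (@integrable_bounded_itv R k^-1 (1 - k^-1) M) => // s Is.
  by have /andP[/ger0_norm ->] := max0 s _ Is (erefl `|Q s|).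
have ineg : lam.-integrable I (EFin \o (fun s => Num.max 0 (- Q s))).
  apply: (@integrable_bounded_itv R k^-1 (1 - k^-1) M) => // s Is.
  by have /andP[/ger0_norm ->] := max0 s _ Is (normrN (Q s)).
have -> : \int[lam]_(s in I) Q s =
    \int[lam]_(s in I) Num.max 0 (Q s) - \int[lam]_(s in I) Num.max 0 (- Q s).
  rewrite -RintegralB//; apply: eq_Rintegral => s _.
  have [Q0|Q0] := leP 0 (Q s); first by rewrite max_l ?oppr_le0// subr0.
  by rewrite max_r ?oppr_ge0 ?ltW// sub0r opprK.
have maxZ (x : R) : Num.max 0 x = A * Num.max 0 (x / A).
  by rewrite maxr_pMr ?ltW// mulr0 mulrC divfK// gt_eqF.
have tail u : k - 1 < u -> 1 - k^-1 < u / k by move=> uk; rewrite k1E ltr_pM2r ?invr_gt0.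
have up : k * \int[lam]_(s in I) Num.max 0 (Q s) = A * \int[lam]_(u in D1) upper_array u.
  apply: (@affine_side (- k^-1) 1 M) => //.
  - by rewrite normrN gtr0_norm.
  - apply/seteqP; split=> u; rewrite /I /= !in_itv/= mulNr mulrC => /andP[H1 H2].
      rewrite addrC lerD2l lerN2 -[X in X <= _]mul1r ler_pM2r// in H2.
      rewrite addrC lerBrDr -lerBrDl k1E ler_pM2r ?invr_gt0// in H1.
      by rewrite H2.
    rewrite addrC lerD2l lerN2 -[X in _ && (X <= _)]mul1r ler_pM2r// H1 andbT.
    by rewrite lerBrDr -lerBrDl k1E ler_pM2r ?invr_gt0.
  - by move=> s Is; exact: max0 Is _.
  - exact: measurable_upper_array.
  - by move=> u /kk uk; rewrite /upper_array uk -maxZ addrC mulNr (mulrC _ u).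
  - move=> u /tail H2; rewrite /upper_array; case: ifP => // /andP[u0 u1].
    have H1 : u / k < 1 by rewrite ltr_pdivrMr// mul1r.
    rewrite max_l// pmulr_lle0 ?invr_gt0// quantile_le ?subr_gt0// ?gtrBl ?divr_gt0//.
    by move: F0k H2; rewrite /F; lra.
have dn : k * \int[lam]_(s in I) Num.max 0 (- Q s) = A * \int[lam]_(u in D1) lower_array u.
  apply: (@affine_side k^-1 0 M) => //.
  - by rewrite gtr0_norm.
  - apply/seteqP; split=> u; rewrite /I /= !in_itv/= addr0 mulrC => /andP[H1 H2].
      rewrite -[X in X <= _]mul1r ler_pM2r// in H1.
      by rewrite k1E ler_pM2r ?invr_gt0// in H2; rewrite H1.
    rewrite -[X in (X <= _) && _]mul1r ler_pM2r// H1/=.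
    by rewrite k1E ler_pM2r ?invr_gt0.
  - by move=> s Is; exact: max0 Is (normrN _).
  - exact: measurable_lower_array.
  - by move=> u /kk uk; rewrite /lower_array uk -mulNr -maxZ addr0 (mulrC _ u).
  - move=> u /tail H2; rewrite /lower_array; case: ifP => // /andP[u0 u1].
    have H1 : u / k < 1 by rewrite ltr_pdivrMr// mul1r.
    rewrite max_l// oppr_le0 mulr_ge0 ?invr_ge0 ?(ltW A0)// ltW// ltNge.
    by rewrite quantile_le ?divr_gt0// -ltNge (lt_trans F1k).
by rewrite mulrBr up dn -mulrBr mulrC mulrA mulVf ?mul1r// gt_eqF.
Qed.

End centering.

End array.

(** * Bounds on the integrands of the characteristic exponent *)

Section trig_bounds.
Context (R : realType).

Lemma mvt_bound (f df : R -> R) (M x : R) : (forall y : R, is_derive y 1 f (df y)) ->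
  f 0 = 0 -> (forall y, `|y| <= `|x| -> `|df y| <= M) -> `|f x| <= M * `|x|.
Proof.
move=> fdf f0 dfM.
have cf (a b : R) : {within `[a, b], continuous f}.
  apply: continuous_subspaceT => y; apply: differentiable_continuous.
  by apply/derivable1_diffP; have [] := fdf y.
have [x0|x0] := leP 0 x.
  have [c] := MVT_segment x0 (fun y _ => fdf y) (cf 0 x).
  rewrite in_itv/= => /andP[c0 cx]; rewrite f0 !subr0 => ->.
  by rewrite normrM ler_wpM2r// dfM// !ger0_norm.
have [c] := MVT_segment (ltW x0) (fun y _ => fdf y) (cf x 0).
rewrite in_itv/= => /andP[c0 cx]; rewrite f0 !sub0r => /(congr1 Num.norm).
rewrite normrN => ->; rewrite normrM normrN ler_wpM2r// dfM//.
by rewrite !ler0_norm ?lerN2// ltW.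
Qed.

Lemma norm_sin_le (x : R) : `|sin x| <= `|x|.
Proof.
rewrite -[leRHS]mul1r; apply: (mvt_bound (df := cos)); rewrite ?sin0// => y _.
by rewrite ler_norml cos_geN1 cos_le1.
Qed.

Lemma norm_cosB1_le (x : R) : `|cos x - 1| <= `|x|.
Proof.
rewrite -[leRHS]mul1r; apply: (@mvt_bound (fun y => cos y - 1) (fun y => - sin y)).
- by move=> y; apply: is_derive_eq; rewrite subr0.
- by rewrite cos0 subrr.
- by move=> y _; rewrite normrN ler_norml sin_geN1 sin_le1.
Qed.

Lemma norm_cosB1_le_sqr (x : R) : `|cos x - 1| <= x ^+ 2.
Proof.
rewrite -real_normK ?num_real// expr2.
apply: (@mvt_bound (fun y => cos y - 1) (fun y => - sin y)).
- by move=> y; apply: is_derive_eq; rewrite subr0.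
- by rewrite cos0 subrr.
- by move=> y yx; rewrite normrN; apply: le_trans yx; exact: norm_sin_le.
Qed.

Lemma norm_sinBid_le_sqr (x : R) : `|sin x - x| <= x ^+ 2.
Proof.
rewrite -real_normK ?num_real// expr2.
apply: (@mvt_bound (fun y => sin y - y) (fun y => cos y - 1)).
- by rewrite sin0 subrr.
- by move=> y yx; apply: le_trans yx; exact: norm_cosB1_le.
Qed.

End trig_bounds.

Section truncation.
Context (R : realType).

Definition trunc1 (y : R) : R := y / (1 + y ^+ 2).

Lemma onesqr_gt0 (y : R) : 0 < 1 + y ^+ 2.
Proof. by rewrite ltr_pwDl// sqr_ge0. Qed.

Lemma norm_trunc1_le1 (y : R) : `|trunc1 y| <= 1.
Proof.
rewrite /trunc1 normrM normfV (ger0_norm (ltW (onesqr_gt0 y))).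
rewrite ler_pdivrMr ?onesqr_gt0// mul1r -(real_normK (num_real y)).
by have := normr_ge0 y; nra.
Qed.

(** This identity explains the shape of [Theta]: the truncation appears on [0, 1] and its complement
    on [1, oo[. *)
Lemma trunc1_compl (y : R) : y - trunc1 y = y ^+ 3 / (1 + y ^+ 2).
Proof. by rewrite /trunc1; field; rewrite gt_eqF// onesqr_gt0. Qed.

Lemma norm_trunc1_compl_le (y : R) : `|y ^+ 3 / (1 + y ^+ 2)| <= y ^+ 2.
Proof.
rewrite normrM normfV (ger0_norm (ltW (onesqr_gt0 y))).
rewrite ler_pdivrMr ?onesqr_gt0// normrX -(real_normK (num_real y)).
by have := normr_ge0 y; nra.
Qed.

Lemma continuous_trunc1 : continuous trunc1.
Proof.
move=> y; apply: cvgM; first exact: cvg_id.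
apply: cvgV; first by rewrite gt_eqF// onesqr_gt0.
by apply: cvgD; [exact: cvg_cst|exact: exprn_continuous].
Qed.

Lemma continuous_trunc1_compl : continuous (fun y : R => y ^+ 3 / (1 + y ^+ 2)).
Proof.
rewrite (_ : (fun _ => _) = (fun y => y - trunc1 y)).
  by move=> y; apply: cvgB; [exact: cvg_id|exact: continuous_trunc1].
by apply/funext => y; rewrite trunc1_compl.
Qed.

Lemma bmeas_continuous (g : R -> R) (M : R) : continuous g ->
  (forall x, `|g x| <= M) -> bmeas g.
Proof. by move=> cg gM; split; [exact: continuous_measurable_fun|exists M]. Qed.

Lemma continuous_cosB1 (t : R) : continuous (fun y : R => cos (t * y) - 1).
Proof.
move=> y; apply: cvgB; last exact: cvg_cst.
exact: (@continuous_compM _ t _ (@continuous_cos R) y).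
Qed.

Lemma continuous_sin_trunc (t : R) : continuous (fun y : R => sin (t * y) - t * trunc1 y).
Proof.
move=> y; apply: cvgB; last by apply: cvgMr; exact: continuous_trunc1.
exact: (@continuous_compM _ t _ (@continuous_sin R) y).
Qed.

(** The quadratic and the uniform bound share the constant [2 + t ^+ 2], as [array_integral_cvg]
    asks for a single one. *)
Lemma cosB1_le (t y : R) : `|cos (t * y) - 1| <= (2 + t ^+ 2) * y ^+ 2.
Proof.
apply: le_trans (norm_cosB1_le_sqr _) _; rewrite exprMn ler_wpM2r ?sqr_ge0//.
by rewrite lerDr.
Qed.

Lemma cosB1_le2 (t y : R) : `|cos (t * y) - 1| <= 2 + t ^+ 2.
Proof.
apply: le_trans (ler_normB _ _) _; rewrite normr1.
have : `|cos (t * y)| <= 1 by rewrite ler_norml cos_geN1 cos_le1.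
by have := sqr_ge0 t; lra.
Qed.

(** The linear terms cancel: both [sin (t * y) - t * y] and [y - trunc1 y] are bounded by
    squares. *)
Lemma sin_trunc_le (t y : R) :
  `|sin (t * y) - t * trunc1 y| <= (1 + `|t| + t ^+ 2) * y ^+ 2.
Proof.
rewrite (_ : _ - _ = (sin (t * y) - t * y) + t * (y - trunc1 y)); last by ring.
apply: le_trans (ler_normD _ _) _.
rewrite normrM trunc1_compl -addrA addrC.
have := norm_sinBid_le_sqr (t * y); rewrite exprMn => H1.
have H2 := ler_wpM2l (normr_ge0 t) (norm_trunc1_compl_le y).
by rewrite !mulrDl; have := sqr_ge0 y; lra.
Qed.

Lemma sin_trunc_le1 (t y : R) :
  `|sin (t * y) - t * trunc1 y| <= 1 + `|t| + t ^+ 2.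
Proof.
apply: le_trans (ler_normB _ _) _.
have H1 : `|sin (t * y)| <= 1 by rewrite ler_norml sin_geN1 sin_le1.
have H2 : `|t * trunc1 y| <= `|t|.
  by rewrite normrM ler_piMr// norm_trunc1_le1.
by have := sqr_ge0 t; lra.
Qed.

Lemma integrable_trunc1_compl (rho K : R) (p : R -> R) : 1 / 2 < rho -> 0 <= K ->
  measurable_fun (`[1%R, +oo[%classic : set R) p -> (forall u, 1 <= u -> 0 <= p u) ->
  (forall u, 1 <= u -> p u <= K * u `^ (- rho)) ->
  lebesgue_measure.-integrable `[1%R, +oo[ (EFin \o (fun u => p u ^+ 3 / (1 + p u ^+ 2))).
Proof.
move=> rho12 K0 mp p0 pK.
apply: (@htail_integrable R `[1%R, +oo[ rho K 1 (fun y => y ^+ 3 / (1 + y ^+ 2))) => //.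
- by move=> u /=; rewrite !in_itv/= !andbT; exact: le_trans.
- by move=> x _; rewrite mul1r; exact: norm_trunc1_compl_le.
- by move=> u /=; rewrite in_itv/= andbT leNgt => /negbTE ->.
- exact: continuous_measurable_fun (@continuous_trunc1_compl).
- by move=> u /=; rewrite in_itv/= andbT; exact: p0.
Qed.

End truncation.

(** * Passage to the limit in the arrays *)

Section array_limit.
Context (R : realType) (m : probability R R).
Local Notation lam := (@lebesgue_measure R).
Local Notation D0 := (`[0%R, +oo[%classic : set R).
Local Notation D1 := (`[1%R, +oo[%classic : set R).
Let F := cdf m.
Variables (kn : nat -> nat) (A : nat -> R) (q1 q2 : R -> R) (rho K : R).
Local Notation k n := ((kn n)%:R : R).
Let pl n := lower_array m (k n) (A n).
Let pu n := upper_array m (k n) (A n).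
Hypotheses (koo : (fun n => k n) @ \oo --> +oo) (A0 : \forall n \near \oo, 0 < A n).
Hypotheses (F0 : 0 < F 0) (F1 : F 0 < 1).
Hypotheses (mq1 : measurable_fun D0 q1) (mq2 : measurable_fun D0 q2).
Hypothesis cvg1 : {ae lam, forall u : R, `]0%R, +oo[%classic u -> pl ^~ u @ \oo --> q1 u}.
Hypothesis cvg2 : {ae lam, forall u : R, `]0%R, +oo[%classic u -> pu ^~ u @ \oo --> q2 u}.
Hypotheses (rho12 : 1 / 2 < rho) (K0 : 0 <= K).
Hypothesis dom1 : \forall n \near \oo, forall u, 1 <= u -> pl n u <= K * u `^ (- rho).
Hypothesis dom2 : \forall n \near \oo, forall u, 1 <= u -> pu n u <= K * u `^ (- rho).

Let mpl n : measurable_fun setT (pl n).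
Proof.
have [k0|k0] := ltP 0 (k n); first exact: measurable_lower_array.
rewrite (_ : pl n = cst 0)//; apply/funext => u; rewrite /pl /lower_array.
by case: ifP => // /andP[u0 uk]; have := le_lt_trans k0 (lt_trans u0 uk); rewrite ltxx.
Qed.

Let mpu n : measurable_fun setT (pu n).
Proof.
have [k0|k0] := ltP 0 (k n); first exact: measurable_upper_array.
rewrite (_ : pu n = cst 0)//; apply/funext => u; rewrite /pu /upper_array.
by case: ifP => // /andP[u0 uk]; have := le_lt_trans k0 (lt_trans u0 uk); rewrite ltxx.
Qed.

(** When [q1] and [q2] invert the tails of the Levy measure, this is the integral of [g] against
    that measure; see [levy_image_integral]. *)
Definition levy_int (g : R -> R) : R :=
  \int[lam]_(u in D0) g (- q1 u) + \int[lam]_(u in D0) g (q2 u).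

Let mD0 : @measurable _ (measurableTypeR R) D0. Proof. exact: measurable_itv. Qed.
Let mD1 : @measurable _ (measurableTypeR R) D1. Proof. exact: measurable_itv. Qed.

Lemma array_integral_cvg (g : R -> R) (C : R) : continuous g ->
  (forall x, `|g x| <= C * x ^+ 2) -> (forall x, `|g x| <= C) ->
  (fun n => k n * \int[m]_x g (x / A n)) @ \oo --> levy_int g.
Proof.
move=> cg g2 g1.
have g0 : g 0 = 0 by apply/eqP; rewrite -normr_le0 (le_trans (g2 0))// expr0n/= mulr0.
have bg : bmeas g by exact: bmeas_continuous g1.
have cgN : continuous (fun x => g (- x)).
  move=> x; apply: (cvg_comp (fun x : R => - x) g); last exact: cg.
  by apply: cvgN; exact: cvg_id.
have L1 : (fun n => \int[lam]_(u in D0) g (- pl n u)) @ \oo --> \int[lam]_(u in D0) g (- q1 u).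
  apply: (@htail_dct R D0 rho K C (fun x => g (- x))) => //.
  - by move=> x _; rewrite -sqrrN.
  - exact: continuous_measurable_fun.
  - by move=> n u; exact: lower_array_ge0.
have L2 : (fun n => \int[lam]_(u in D0) g (pu n u)) @ \oo --> \int[lam]_(u in D0) g (q2 u).
  apply: (@htail_dct R D0 rho K C g) => //.
  - exact: continuous_measurable_fun.
  - by move=> n u; exact: upper_array_ge0.
have LD : (fun n => \int[lam]_(u in D0) g (- pl n u) + \int[lam]_(u in D0) g (pu n u))
    @ \oo --> levy_int g by exact: cvgD.
apply: cvg_trans LD; apply: near_eq_cvg; near=> n.
apply/esym/array_integral => //; near: n.
by apply: cvgry_gt.
Unshelve. all: by end_near. Qed.

Let b n : R := \int[lam]_(s in `[(k n)^-1, 1 - (k n)^-1]) quantile F s / A n.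

Let near_good : \forall n \near \oo, [/\ 0 < A n, 2 <= k n,
  (k n)^-1 < F 0 & F 0 < 1 - (k n)^-1].
Proof.
have kinv : (fun n => (k n)^-1) @ \oo --> (0 : R).
  by apply/gtr0_cvgV0 => //; apply: cvgry_gt.
near=> n; split; near: n => //.
- by apply: cvgry_ge.
- by apply: (cvgr_lt (0 : R)).
- have : \forall n \near \oo, (k n)^-1 < 1 - F 0.
    by apply: (cvgr_lt (0 : R)) => //; rewrite subr_gt0.
  by apply: filterS => n; lra.
Unshelve. all: by end_near. Qed.

Let integrable_bounded_support (f : R -> R) (D : set R) (M kk : R) :
  @measurable _ (measurableTypeR R) D -> D `<=` D0 ->
  measurable_fun setT f -> (forall u, D u -> `|f u| <= M) ->
  (forall u, kk <= u -> f u = 0) -> lam.-integrable D (EFin \o f).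
Proof.
move=> mD DD mf fM fk; apply/integrable_mkcond => //.
have mI : @measurable _ (measurableTypeR R) (`[0%R, kk]%classic : set R) by exact: measurable_itv.
have -> : (EFin \o f) \_ D = (EFin \o f) \_ (D `&` `[0%R, kk]).
  apply/funext => u; rewrite !patchE; have [Du|Du] := boolP (u \in D); last first.
    by rewrite memNset// => -[/mem_set]; rewrite (negbTE Du).
  have [uk|uk] := leP u kk.
    have u0 : 0 <= u by have := DD u (set_mem Du); rewrite /= in_itv/= andbT.
    by rewrite mem_set//; split; [exact: set_mem|rewrite /= in_itv/= u0].
  rewrite memNset/= ?fk ?(ltW uk)// => -[_]; rewrite in_itv/= => /andP[_].
  by rewrite leNgt uk.
have mDI : @measurable _ (measurableTypeR R) (D `&` `[0%R, kk]) by exact: measurableI.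
apply: (@proj1 _ _ (@integrable_mkcond _ (measurableTypeR R) R lam (D `&` `[0%R, kk]) (EFin \o f) mDI)).
apply: (@integrable_bounded_itv R 0 kk M) => //.
- exact: measurable_funTS.
- by move=> u [Du _]; exact: fM.
Qed.

(** On [1, oo[ the integrands combine into [- p ^+ 3 / (1 + p ^+ 2)], which the square of the
    dominating function controls. The integral of [p] over [1, oo[ is finite here by bounded
    support, but may diverge in the limit, so only the combination is passed to it. *)
Let trunc1_split (p : R -> R) (kk : R) : 1 <= kk -> measurable_fun setT p ->
  (forall u, 0 <= p u) -> (forall u, kk <= u -> p u = 0) ->
  (forall u, 1 <= u -> p u <= K * u `^ (- rho)) ->
  \int[lam]_(u in D0) trunc1 (p u) - \int[lam]_(u in D1) p u = Theta p.
Proof.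
move=> kk1 mp p0 pk pK.
have mtp : measurable_fun setT (fun u => trunc1 (p u)).
  by apply: measurableT_comp => //; exact: continuous_measurable_fun (@continuous_trunc1 R).
have D10 : D1 `<=` D0 by move=> u /=; rewrite !in_itv/= !andbT; exact: le_trans.
have iT : lam.-integrable D0 (EFin \o (fun u => trunc1 (p u))).
  apply: (@integrable_bounded_support _ D0 1 kk) => //.
  - by move=> u _; exact: norm_trunc1_le1.
  - by move=> u /pk ->; rewrite /trunc1 mul0r.
have ip : lam.-integrable D1 (EFin \o p).
  apply: (@integrable_bounded_support _ D1 K kk) => // u /=.
  rewrite in_itv/= andbT => u1; rewrite ger0_norm// (le_trans (pK u u1))//.
  have rho0 : - rho <= 0 by move: rho12; lra.
  by rewrite ler_piMr// -(powRr0 u) ler_powR.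
have icompl := integrable_trunc1_compl rho12 K0 (measurable_funTS mp) (fun u _ => p0 u) pK.
have iT0 : lam.-integrable `[0%R, 1%R[ (EFin \o (fun u => trunc1 (p u))).
  apply: (@integrableS _ (measurableTypeR R) R lam D0) => //.
  by rewrite nonneg_setU; left.
rewrite {1}nonneg_setU (@Rintegral_setU _ (measurableTypeR R))//; last 2 first.
- by rewrite -nonneg_setU.
- apply/disj_setPS => u [] /=; rewrite !in_itv/= andbT => /andP[_ u1].
  by rewrite leNgt u1.
rewrite Rintegral_itv_bndo_bndc// -addrA; congr (_ + _).
rewrite -[LHS]opprK opprB -RintegralB//; last first.
  by apply: (@integrableS _ (measurableTypeR R) R lam D0).
by congr (- _); apply: eq_Rintegral => u _; rewrite trunc1_compl.
Qed.

Let Theta_cvg (p : nat -> R -> R) (q : R -> R) :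
  (forall n, measurable_fun setT (p n)) -> measurable_fun D0 q ->
  (forall n u, 0 <= p n u) ->
  {ae lam, forall u : R, `]0%R, +oo[%classic u -> p ^~ u @ \oo --> q u} ->
  (\forall n \near \oo, forall u, 1 <= u -> p n u <= K * u `^ (- rho)) ->
  (fun n => Theta (p n)) @ \oo --> Theta q.
Proof.
move=> mp mq p0 pq pK; apply: cvgB; last first.
  apply: (@htail_dct R D1 rho K 1 (fun y => y ^+ 3 / (1 + y ^+ 2))) => //.
  - by move=> u /=; rewrite !in_itv/= !andbT; exact: le_trans.
  - by move=> x _; rewrite mul1r; exact: norm_trunc1_compl_le.
  - by move=> u /=; rewrite in_itv/= andbT leNgt => /negbTE ->.
  - exact: continuous_measurable_fun (@continuous_trunc1_compl R).
  - exact: continuous_trunc1_compl.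
  - apply: measurable_funS mq => //.
    by move=> u /=; rewrite !in_itv/= !andbT; exact: le_trans.
have mt := continuous_measurable_fun (@continuous_trunc1 R).
have mq01 : measurable_fun (`[0%R, 1%R]%classic : set R) q.
  by apply: measurable_funS mq => // u /=; rewrite !in_itv/= andbT => /andP[].
apply: (@Rintegral_dct _ (measurableTypeR R) R lam `[0%R, 1%R]
  (fun n u => trunc1 (p n u)) (fun u => trunc1 (q u)) (cst 1)) => //.
- by move=> n; apply: measurableT_comp => //; apply: measurable_funTS; exact: mp.
- exact: measurableT_comp.
- have aeF := ae_filter_ringOfSetsType lam.
  have ae0 : {ae lam, forall u : R, u != 0}.
    exists [set 0]; split => //; first exact: lebesgue_measure_set1.
    by move=> u /= /negP/negPn/eqP.
  apply: filterS2 pq ae0 => u H u0 /=; rewrite in_itv/= le_eqVlt eq_sym.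
  rewrite (negbTE u0)/= => /andP[u0' _].
  have Hu : `]0%R, +oo[%classic u by rewrite /= in_itv/= u0'.
  exact: (cvg_comp _ _ (H Hu) (@continuous_trunc1 R (q u))).
- by apply: (@integrable_bounded_itv R 0 1 1) => // u _; rewrite /= normr1.
- by apply: nearW => n u _; exact: norm_trunc1_le1.
Qed.

(** For large [n] the left side equals [Theta (pu n) - Theta (pl n)]: [trunc1] is odd, and
    [trunc1_split] applies to each array. *)
Lemma centering_cvg : (fun n => k n * \int[m]_x trunc1 (x / A n) - k n * b n) @ \oo -->
  Theta q2 - Theta q1.
Proof.
have : (fun n => Theta (pu n) - Theta (pl n)) @ \oo --> Theta q2 - Theta q1.
  apply: cvgB; apply: Theta_cvg => //.
  - by move=> n u; exact: upper_array_ge0.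
  - by move=> n u; exact: lower_array_ge0.
apply: cvg_trans; apply: near_eq_cvg; near=> n.
have [An kn2 H1 H2] : [/\ 0 < A n, 2 <= k n, (k n)^-1 < F 0 & F 0 < 1 - (k n)^-1] by near: n.
have k0 : 0 < k n by lra.
have k1 : 1 <= k n by lra.
have b1 := bmeas_continuous (@continuous_trunc1 R) (@norm_trunc1_le1 R).
rewrite array_integral//; last by rewrite /trunc1 mul0r.
rewrite /b mulrA array_centering//.
rewrite -(trunc1_split k1 (mpu n)) => [|u|u|]; last first.
- by near: n.
- exact: upper_array_eq0.
- exact: upper_array_ge0.
rewrite -(trunc1_split k1 (mpl n)) => [|u|u|]; last first.
- by near: n.
- exact: lower_array_eq0.
- exact: lower_array_ge0.
have -> : \int[lam]_(u in D0) trunc1 (- lower_array m (k n) (A n) u) =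
  - \int[lam]_(u in D0) trunc1 (pl n u).
  have -> : (fun u => trunc1 (- lower_array m (k n) (A n) u)) =
    (fun u => - 1 * trunc1 (pl n u)).
    by apply/funext => u; rewrite /trunc1 sqrrN mulN1r mulNr.
  rewrite RintegralZl//; first by rewrite mulN1r.
  apply: (@integrable_bounded_support _ D0 1 (k n)) => //.
  - by apply: measurableT_comp => //; exact: continuous_measurable_fun (@continuous_trunc1 R).
  - by move=> u _; exact: norm_trunc1_le1.
  - by move=> u ku; rewrite /pl lower_array_eq0// /trunc1 mul0r.
rewrite /pl /pu; ring.
Unshelve. all: by end_near. Qed.

(* [k n * b n] need not be bounded, but this gives [k n * b n ^+ 2 --> 0]. *)
Lemma centering_small : (fun n => Num.sqrt (k n) * b n) @ \oo --> (0 : R).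
Proof.
have S1 : (fun n => (Num.sqrt (k n))^-1 * \int[lam]_(u in D1) pu n u) @ \oo --> (0 : R).
  apply: (htail_sqrt rho12 K0 koo) => //.
  - by move=> n u; exact: upper_array_ge0.
  - by move=> n u; exact: upper_array_eq0.
have S2 : (fun n => (Num.sqrt (k n))^-1 * \int[lam]_(u in D1) pl n u) @ \oo --> (0 : R).
  apply: (htail_sqrt rho12 K0 koo) => //.
  - by move=> n u; exact: lower_array_ge0.
  - by move=> n u; exact: lower_array_eq0.
have : (fun n => (Num.sqrt (k n))^-1 * \int[lam]_(u in D1) pu n u -
  (Num.sqrt (k n))^-1 * \int[lam]_(u in D1) pl n u) @ \oo --> (0 : R).
  by rewrite -(subr0 (0 : R)); exact: cvgB.
apply: cvg_trans; apply: near_eq_cvg; near=> n.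
have [An kn2 H1 H2] : [/\ 0 < A n, 2 <= k n, (k n)^-1 < F 0 & F 0 < 1 - (k n)^-1] by near: n.
have k0 : 0 < k n by lra.
have skE : (Num.sqrt (k n))^-1 * k n = Num.sqrt (k n).
  rewrite -{2}(sqr_sqrtr (ltW k0)) expr2 mulrA mulVf ?mul1r//.
  by rewrite gt_eqF// sqrtr_gt0.
rewrite -mulrBr -array_centering// /b -[X in _ = X * _]skE.
by rewrite -!mulrA.
Unshelve. all: by end_near. Qed.

(** The addition formulas separate the shift by [b n]. What it contributes beyond the linear term
    [t * (k n * b n)] is of order [k n * (t * b n) ^+ 2], or a convergent sequence times a null one,
    and tends to 0. *)
Lemma array_limit (t : R) :
  (fun n => k n * (\int[m]_x cos (t * (x / A n - b n)) - 1)) @ \oo -->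
    levy_int (fun y => cos (t * y) - 1) /\
  (fun n => k n * \int[m]_x sin (t * (x / A n - b n))) @ \oo -->
    levy_int (fun y => sin (t * y) - t * trunc1 y) + t * (Theta q2 - Theta q1).
Proof.
pose C n := \int[m]_x cos (t * (x / A n)); pose S n := \int[m]_x sin (t * (x / A n)).
have mxA n : measurable_fun setT (fun x : R => t * (x / A n)).
  by apply: measurable_funM => //; exact: measurable_funM.
have mtA n : measurable_fun setT (fun x : R => x / A n) by exact: measurable_funM.
have bC n := bmeas_cos (mxA n); have bS n := bmeas_sin (mxA n).
have b1 := bmeas_continuous (@continuous_trunc1 R) (@norm_trunc1_le1 R).
have bT n : bmeas (fun x : R => trunc1 (x / A n)) by exact: bmeas_comp.
have LC : (fun n => k n * (C n - 1)) @ \oo --> levy_int (fun y => cos (t * y) - 1).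
  have := array_integral_cvg (@continuous_cosB1 R t) (@cosB1_le R t) (cosB1_le2 t).
  apply: cvg_trans; apply: near_eq_cvg; apply: nearW => n; congr (_ * _).
  by rewrite expB ?exp_cst//; exact: bmeas_cst.
have LS : (fun n => k n * S n - t * (k n * b n)) @ \oo -->
    levy_int (fun y => sin (t * y) - t * trunc1 y) + t * (Theta q2 - Theta q1).
  have H1 := array_integral_cvg (@continuous_sin_trunc R t) (@sin_trunc_le R t) (sin_trunc_le1 t).
  have H2 : (fun n => k n * \int[m]_x (sin (t * (x / A n)) - t * trunc1 (x / A n)) +
     t * (k n * \int[m]_x trunc1 (x / A n) - k n * b n)) @ \oo -->
    levy_int (fun y => sin (t * y) - t * trunc1 y) + t * (Theta q2 - Theta q1).
    by apply: cvgD => //; apply: cvgMr; exact: centering_cvg.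
  apply: cvg_trans H2; apply: near_eq_cvg; apply: nearW => n.
  rewrite expB//; last exact: bmeasZ.
  by rewrite expZ// /S; ring.
have bE : \forall n \near \oo, b n = (Num.sqrt (k n))^-1 * (Num.sqrt (k n) * b n).
  near=> n; rewrite mulrA mulVf ?mul1r// gt_eqF// sqrtr_gt0.
  by near: n; exact: cvgry_gt.
have b0 : b @ \oo --> (0 : R).
  have H : (fun n => (Num.sqrt (k n))^-1 * (Num.sqrt (k n) * b n)) @ \oo --> (0 : R).
    by rewrite -(mulr0 (0 : R)); apply: cvgM; [exact: cvg_sqrtV|exact: centering_small].
  by apply: cvg_trans H; apply: near_eq_cvg; apply: filterS bE => n <-.
have kb2 : (fun n => k n * (t * b n) ^+ 2) @ \oo --> (0 : R).
  have H : (fun n => t ^+ 2 * (Num.sqrt (k n) * b n) ^+ 2) @ \oo --> (0 : R).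
    rewrite -[X in _ --> X](mulr0 (t ^+ 2)); apply: cvgMr.
    rewrite -[X in _ --> X](mulr0 (0 : R)) .
    by apply: cvgM; exact: centering_small.
  apply: cvg_trans H; apply: near_eq_cvg; apply: nearW => n.
  by rewrite (exprMn _ t) (exprMn _ _ (b n)) sqr_sqrtr// mulrCA.
have tb0 : (fun n => t * b n) @ \oo --> (0 : R) by rewrite -(mulr0 t); exact: cvgMr.
have cosb : (fun n => cos (t * b n)) @ \oo --> (1 : R).
  by rewrite -(@cos0 R); apply: (cvg_comp _ _ tb0); exact: continuous_cos.
have sinb : (fun n => sin (t * b n)) @ \oo --> (0 : R).
  by rewrite -(@sin0 R); apply: (cvg_comp _ _ tb0); exact: continuous_sin.
have sq0 (f : R -> R) : (forall x, `|f x| <= x ^+ 2) ->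
    (fun n => k n * f (t * b n)) @ \oo --> (0 : R).
  move=> fx; apply/norm_cvg0P.
  apply: (@squeeze_cvgr _ _ _ _ (fun=> 0) (fun n => k n * (t * b n) ^+ 2)) => //.
  - by apply: nearW => n; rewrite normr_ge0/= normrM normr_nat ler_wpM2l.
  - exact: cvg_cst.
have kcosb := sq0 _ (@norm_cosB1_le_sqr R).
have ksinb := sq0 _ (@norm_sinBid_le_sqr R).
pose sg n := k n * S n - t * (k n * b n).
(* [k n * S n] may be unbounded. It is replaced by the convergent [sg n] plus [t * (k n * b n)], and
   the latter times [sin (t * b n)] is governed by [k n * (t * b n) ^+ 2]. *)
have kSsin : (fun n => k n * S n * sin (t * b n)) @ \oo --> (0 : R).
  have H : (fun n => sg n * sin (t * b n) + k n * (t * b n) ^+ 2 +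
      (k n * (sin (t * b n) - t * b n)) * (t * b n)) @ \oo -->
      ((levy_int (fun y => sin (t * y) - t * trunc1 y) + t * (Theta q2 - Theta q1)) * 0 + 0 + 0 * 0 : R).
    apply: cvgD; last exact: cvgM.
    by apply: cvgD => //; exact: cvgM.
  rewrite !(mulr0, addr0) in H.
  apply: cvg_trans H; apply: near_eq_cvg; apply: nearW => n; rewrite /sg; ring.
have kScos : (fun n => k n * S n * (cos (t * b n) - 1)) @ \oo --> (0 : R).
  have H : (fun n => sg n * (cos (t * b n) - 1) +
      (k n * (cos (t * b n) - 1)) * (t * b n)) @ \oo -->
      ((levy_int (fun y => sin (t * y) - t * trunc1 y) + t * (Theta q2 - Theta q1)) * (1 - 1) + 0 * 0 : R).
    apply: cvgD; last exact: cvgM.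
    by apply: cvgM => //; apply: cvgB => //; exact: cvg_cst.
  rewrite subrr !(mulr0, addr0) in H.
  apply: cvg_trans H; apply: near_eq_cvg; apply: nearW => n; rewrite /sg; ring.
split.
- have H : (fun n => k n * (C n - 1) * cos (t * b n) + k n * (cos (t * b n) - 1) +
      k n * S n * sin (t * b n)) @ \oo --> levy_int (fun y => cos (t * y) - 1) * 1 + 0 + 0.
    by apply: cvgD => //; apply: cvgD => //; exact: cvgM.
  rewrite mulr1 !addr0 in H.
  apply: cvg_trans H; apply: near_eq_cvg; apply: nearW => n.
  under [in RHS]eq_Rintegral do rewrite mulrBr cosB [X in X + _]mulrC [X in _ + X]mulrC.
  rewrite expD//; [|exact: bmeasZ|exact: bmeasZ].
  by rewrite !expZ// -/(C n) -/(S n); ring.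
- have H : (fun n => sg n + k n * S n * (cos (t * b n) - 1) -
      (k n * (C n - 1) * sin (t * b n) + k n * (sin (t * b n) - t * b n))) @ \oo -->
      levy_int (fun y => sin (t * y) - t * trunc1 y) + t * (Theta q2 - Theta q1) + 0 -
      (levy_int (fun y => cos (t * y) - 1) * 0 + 0).
    apply: cvgB; first exact: cvgD.
    by apply: cvgD => //; exact: cvgM.
  rewrite mulr0 !addr0 subr0 in H.
  apply: cvg_trans H; apply: near_eq_cvg; apply: nearW => n.
  under [in RHS]eq_Rintegral do rewrite mulrBr sinB [X in X - _]mulrC [X in _ - X]mulrC.
  rewrite expB//; [|exact: bmeasZ|exact: bmeasZ].
  by rewrite !expZ// -/(C n) -/(S n) /sg; ring.
Unshelve. all: by end_near. Qed.

End array_limit.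

(** * The Levy measure *)

Section levy_measure.
Context (R : realType).
Local Notation lam := (@lebesgue_measure R).
Local Notation D0 := (`[0%R, +oo[%classic : set R).
Local Notation Do := (`]0%R, +oo[%classic : set R).
Local Notation neg := (`]-oo, 0%R[%classic : set R).
Variables (q1 q2 G1 G2 : R -> R) (rho K : R).
Hypotheses (mq1 : measurable_fun setT q1) (mq2 : measurable_fun setT q2).
Hypotheses (q1_ge0 : forall u, 0 <= q1 u) (q2_ge0 : forall u, 0 <= q2 u).
Hypotheses (G1_ge0 : forall x, 0 <= G1 x) (G2_ge0 : forall x, 0 <= G2 x).
Hypothesis G1q : forall u x, 0 < u -> 0 < x -> (u < G1 x) = (x < q1 u).
Hypothesis G2q : forall u x, 0 < u -> 0 < x -> (u < G2 x) = (x < q2 u).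
Hypotheses (rho12 : 1 / 2 < rho) (K0 : 0 <= K).
Hypothesis q1K : forall u, 1 <= u -> q1 u <= K * u `^ (- rho).
Hypothesis q2K : forall u, 1 <= u -> q2 u <= K * u `^ (- rho).

Let mneg : @measurable _ (measurableTypeR R) neg. Proof. exact: measurable_itv. Qed.
Let mDo : @measurable _ (measurableTypeR R) Do. Proof. exact: measurable_itv. Qed.
Let mD0 : @measurable _ (measurableTypeR R) D0. Proof. exact: measurable_itv. Qed.

Let mNq1 : measurable_fun [set: measurableTypeR R] (fun u : measurableTypeR R => (- q1 u : R)).
Proof. exact: measurable_funN. Qed.
Let mq2' : measurable_fun [set: measurableTypeR R] (fun u : measurableTypeR R => (q2 u : R)).
Proof. exact: mq2. Qed.
Let mnegR : measurable (neg : set R). Proof. exact: measurable_itv. Qed.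
Let mDoR : measurable (Do : set R). Proof. exact: measurable_itv. Qed.

(** The images under [- q1] and [q2] are restricted to open half-lines: the points where a quantile
    vanishes, possibly of infinite measure, would otherwise charge 0. *)
Let lam0 : {measure set (measurableTypeR R) -> \bar R} := mrestr lam mDo.
Let nu1 : {measure set R -> \bar R} :=
  mrestr (measure_function_pushforward__canonical__measure_function_Measure lam0 mNq1) mnegR.
Let nu2 : {measure set R -> \bar R} :=
  mrestr (measure_function_pushforward__canonical__measure_function_Measure lam0 mq2') mDoR.
Definition levy_image : {measure set R -> \bar R} := measure_add nu1 nu2.

Lemma levy_imageE (B : set R) : levy_image B =
  (lam ((fun u => - q1 u)%R @^-1` (B `&` neg) `&` Do) + lam (q2 @^-1` (B `&` Do) `&` Do))%E.
Proof. exact: measure_addE. Qed.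

Let negDo : neg `&` Do = set0.
Proof.
apply/seteqP; split=> // x []/=; rewrite !in_itv/= andbT => x0 /(lt_trans x0).
by rewrite ltxx.
Qed.

Lemma levy_image_neg (B : set R) : B `<=` neg ->
  levy_image B = lam (Do `&` (fun u => - q1 u) @^-1` B).
Proof.
move=> Bneg; rewrite levy_imageE (setIidl Bneg) setIC.
suff -> : B `&` Do = set0 by rewrite preimage_set0 set0I measure0 adde0.
by apply/seteqP; split=> // x [/Bneg Bx Dx]; rewrite -negDo.
Qed.

Lemma levy_image_pos (B : set R) : B `<=` Do ->
  levy_image B = lam (Do `&` q2 @^-1` B).
Proof.
move=> Bpos; rewrite levy_imageE (setIidl Bpos) addeC setIC.
suff -> : B `&` neg = set0 by rewrite preimage_set0 set0I measure0 adde0.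
by apply/seteqP; split=> // x [/Bpos Bx Dx]; rewrite -negDo.
Qed.

Lemma levy_image0 : levy_image [set 0] = 0%E.
Proof.
rewrite levy_imageE.
have -> : [set 0] `&` neg = set0.
  by apply/seteqP; split=> // x [/= ->]; rewrite in_itv/= ltxx.
have -> : [set 0] `&` Do = set0.
  by apply/seteqP; split=> // x [/= ->]; rewrite in_itv/= ltxx.
by rewrite !preimage_set0 set0I measure0 adde0.
Qed.

Let lam_itv (G q : R -> R) (x : R) : (forall y, 0 <= G y) ->
  (forall u y, 0 < u -> 0 < y -> (u < G y) = (y < q u)) -> 0 < x ->
  lam (Do `&` [set u | x < q u]) = (G x)%:E.
Proof.
move=> G0 Gq x0.
have -> : Do `&` [set u | x < q u] = (`]0%R, (G x)%R[%classic : set R).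
  apply/seteqP; split=> u /=; rewrite !in_itv/= ?andbT.
    by move=> [u0 xu]; rewrite u0 Gq.
  by move=> /andP[u0]; rewrite Gq.
rewrite lebesgue_measure_itv/= lte_fin; case: ltP => [_|Gx]; first by rewrite sube0.
by congr EFin; apply: le_anti; rewrite Gx G0.
Qed.

Lemma levy_image_lt (y : R) : y < 0 -> levy_image [set` `]-oo, y[] = (G1 (- y))%:E.
Proof.
move=> y0; rewrite levy_image_neg; last first.
  by move=> x /=; rewrite !in_itv/= => /lt_trans; apply.
rewrite -(lam_itv G1_ge0 G1q) ?oppr_gt0//; congr (lam (_ `&` _)).
by apply/seteqP; split=> u /=; rewrite in_itv/= ltrNl.
Qed.

Lemma levy_image_gt (x : R) : 0 < x -> levy_image [set` `]x, +oo[] = (G2 x)%:E.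
Proof.
move=> x0; rewrite levy_image_pos; last first.
  by move=> y /=; rewrite !in_itv/= !andbT; exact: lt_trans.
rewrite -(lam_itv G2_ge0 G2q)//; congr (lam (_ `&` _)).
by apply/seteqP; split=> u /=; rewrite in_itv/= andbT.
Qed.

(** [p] is [- q1] or [q2], and [h] is [g] with the sign absorbed, so that the domination concerns
    the non-negative [q]. Where [p u] misses [E] one has [q u = 0] and [h 0 = 0]: such [u]
    contribute nothing. *)
Let image_side (E : set R) (p q g h : R -> R) (C : R) :
  measurable E -> measurable_fun setT p -> measurable_fun setT q ->
  (forall u, 0 <= q u) -> (forall u, 1 <= u -> q u <= K * u `^ (- rho)) ->
  (forall B : set R, B `<=` E -> levy_image B = lam (Do `&` p @^-1` B)) ->
  measurable_fun setT g -> measurable_fun setT h -> (forall u, g (p u) = h (q u)) ->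
  (forall x, `|h x| <= C * x ^+ 2) -> (forall x, `|h x| <= C) ->
  (forall u, 0 < u -> ~ E (p u) -> q u = 0) ->
  levy_image.-integrable E (EFin \o g) /\
  \int[levy_image]_(x in E) g x = \int[lam]_(u in D0) h (q u).
Proof.
move=> mE mp mq q0 qK pE mg mh gh h2 h1 Eq.
have h0 : h 0 = 0 by apply/eqP; rewrite -normr_le0 (le_trans (h2 0))// expr0n/= mulr0.
have DoD0 : Do `<=` D0 by move=> u /=; rewrite !in_itv/= !andbT; exact: ltW.
have ih : lam.-integrable D0 (EFin \o (fun u => h (q u))).
  by apply: (@htail_integrable R D0 rho K C h) => //; exact: measurable_funTS.
have ihDo : lam.-integrable Do (EFin \o (fun u => h (q u))).
  exact: (@integrableS _ (measurableTypeR R) R lam D0 _ _ mD0 mDo DoD0 ih).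
have mpDo : measurable_fun (Do : set (measurableTypeR R)) (fun u : measurableTypeR R => (p u : R)).
  by apply: measurable_funTS; exact: mp.
have mDp : @measurable _ (measurableTypeR R) (Do `&` p @^-1` E) by exact: mpDo.
have ghE : EFin \o g \o p = EFin \o (fun u => h (q u)).
  by apply/funext => u /=; rewrite gh.
have imE (B : set R) : measurable B -> B `<=` E -> levy_image B = lam (Do `&` p @^-1` B).
  by move=> _; exact: pE.
have mgE : measurable_fun E (EFin \o g) by apply/measurable_EFinP; exact: measurable_funTS.
split.
  apply: (@integrable_image_measure _ (measurableTypeR R) R _ _ lam Do p levy_image E) => //.
  rewrite -/(comp _ _) ghE.
  exact: (@integrableS _ (measurableTypeR R) R lam Do _ _ mDo mDp (@subIsetl _ _ _) ihDo).
transitivity (\int[lam]_(u in Do `&` p @^-1` E) h (q u)).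
  rewrite /Rintegral; congr fine.
  rewrite (@integral_image_measure _ (measurableTypeR R) R _ _ lam Do p levy_image E)//.
  by apply: eq_integral => u _; rewrite /= gh.
rewrite -Rintegral_itv_obnd_cbnd// Rintegral_mkcond [RHS]Rintegral_mkcond.
apply: eq_Rintegral => u _; rewrite !patchE.
have [uDo|uDo] := boolP (u \in Do); last first.
  by rewrite memNset// => -[/mem_set]; rewrite (negbTE uDo).
have [Eu|Eu] := pselect (E (p u)).
  by rewrite mem_set//; split => //; exact: set_mem.
rewrite memNset; last by case.
have u0 : 0 < u by have := set_mem uDo; rewrite /= in_itv/= andbT.
by rewrite Eq.
Qed.

Lemma levy_image_integral (g : R -> R) (C : R) : continuous g ->
  (forall x, `|g x| <= C * x ^+ 2) -> (forall x, `|g x| <= C) ->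
  \int[levy_image]_(x in `]-oo, 0[ `|` `]0, +oo[) g x = levy_int q1 q2 g.
Proof.
move=> cg g2 g1.
have mg : measurable_fun setT g by exact: continuous_measurable_fun.
have mgN : measurable_fun setT (fun x : R => g (- x)).
  by apply: measurableT_comp => //; exact: measurable_funN.
have [i1 E1] : levy_image.-integrable neg (EFin \o g) /\
    \int[levy_image]_(x in neg) g x = \int[lam]_(u in D0) g (- q1 u).
  apply: (@image_side neg (fun u => - q1 u) q1 g (fun x : R => g (- x)) C) => //.
  - exact: levy_image_neg.
  - by move=> x; rewrite -sqrrN.
  - move=> u u0 /=; rewrite in_itv/= oppr_lt0 => /negP; rewrite -leNgt => H.
    by apply: le_anti; rewrite H q1_ge0.
have [i2 E2] : levy_image.-integrable Do (EFin \o g) /\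
    \int[levy_image]_(x in Do) g x = \int[lam]_(u in D0) g (q2 u).
  apply: (@image_side Do q2 q2 g g C) => //.
  - exact: levy_image_pos.
  - move=> u u0 /=; rewrite in_itv/= andbT => /negP; rewrite -leNgt => H.
    by apply: le_anti; rewrite H q2_ge0.
rewrite /levy_int -E1 -E2 Rintegral_setU//; last by apply/disj_set2P; exact: negDo.
apply/integrableP; split.
  by apply/measurable_EFinP; exact: measurable_funTS.
have mA : measurable_fun (neg `|` Do) (fun x => `|(g x)%:E|%E).
  by apply: measurableT_comp => //; apply/measurable_EFinP; exact: measurable_funTS.
rewrite ge0_integral_setU//=; last by apply/disj_set2P; exact: negDo.
have /integrableP[_ j1] := i1; have /integrableP[_ j2] := i2.
exact: lte_add_pinfty.
Qed.

End levy_measure.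

(** * Geometric tails and their inverses *)

Section semistable_quantile.
Context (R : realType).
Local Notation lam := (@lebesgue_measure R).
Variables (nu beta : R).
Hypotheses (nu_gt0 : 0 < nu) (beta_gt0 : 0 < beta).

(* [geo_tail c1 2^-1] and [geo_tail 1 1] are the left and right tails of the Levy
   measure.  Their generalized inverses are [- psi1] and [- psi2] on the positive
   reals. *)
Definition geo_tail (c th x : R) : R :=
  c * expR (- nu * (Num.floor ((2 * beta)^-1 * ln x + th))%:~R).

Definition geo_quantile (c th u : R) : R :=
  if c == 0 then 0
  else expR (2 * beta * ((Num.ceil ((ln c - ln u) / nu))%:~R - th)).

Let b2 : 0 < 2 * beta. Proof. by rewrite mulr_gt0. Qed.

Lemma geo_tail_ge0 c th x : 0 <= c -> 0 <= geo_tail c th x.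
Proof. by move=> c0; rewrite mulr_ge0// expR_ge0. Qed.

Lemma geo_quantile_ge0 c th u : 0 <= geo_quantile c th u.
Proof. by rewrite /geo_quantile; case: ifP => // _; exact: expR_ge0. Qed.

(** After taking logarithms, with [y = ln x / (2 * beta) + th] and [z = (ln c - ln u) / nu]:
    [floor y < z] iff [floor y < ceil z] iff [y < ceil z]. *)
Lemma geo_galois c th u x : 0 <= c -> 0 < u -> 0 < x ->
  (u < geo_tail c th x) = (x < geo_quantile c th u).
Proof.
(* The case [c = 0] is apart because [ln 0] is 0 by convention, so the exponential formula would
   give a positive value there. *)
move=> c0 u0 x0; rewrite /geo_quantile /geo_tail; case: eqP => [->|/eqP c'].
  by rewrite mul0r !ltNge !ltW.
have {c0 c'} c0 : 0 < c by rewrite lt_neqAle eq_sym c'.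
rewrite -ltr_ln ?posrE ?mulr_gt0 ?expR_gt0// lnM ?posrE ?expR_gt0// expRK.
rewrite -[RHS]ltr_ln ?posrE ?expR_gt0// expRK.
have -> : (ln u < ln c + - nu * (Num.floor ((2 * beta)^-1 * ln x + th))%:~R) =
    ((Num.floor ((2 * beta)^-1 * ln x + th))%:~R < (ln c - ln u) / nu).
  by rewrite ltr_pdivlMr//; apply/idP/idP; lra.
rewrite ltNge -ceil_le_int -ltNge.
by rewrite ltNge floor_ge_int -ltNge -ltrBrDr ltr_pdivrMl.
Qed.

Lemma measurable_geo_quantile c th : measurable_fun setT (geo_quantile c th).
Proof.
rewrite /geo_quantile; case: (c == 0); first exact: measurable_cst.
apply: measurableT_comp => //; apply: measurable_funM => //; apply: measurable_funB => //.
have mc : measurable_fun setT (fun y : R => ((Num.ceil y)%:~R : R)).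
  by apply: nondecreasing_measurable => // x y xy; rewrite ler_int le_ceil.
apply: (measurableT_comp mc); apply: measurable_funM => //.
by apply: measurable_funB => //; exact: measurable_ln.
Qed.

Lemma geo_quantile_le c th : 0 <= c ->
  exists2 K, 0 <= K & forall u, 1 <= u -> geo_quantile c th u <= K * u `^ (- (2 * beta / nu)).
Proof.
move=> c0; exists (expR (2 * beta * (ln c / nu + 1 - th))); first exact: expR_ge0.
move=> u u1; have u0 : 0 < u by rewrite (lt_le_trans ltr01).
rewrite /geo_quantile; case: ifP => _; first by rewrite mulr_ge0 ?expR_ge0 ?powR_ge0.
rewrite /powR gt_eqF// -expRD ler_expR.
have /andP[+ _] := ceil_itv ((ln c - ln u) / nu); rewrite intrB.
set z := (_%:~R); move=> H.
rewrite [leRHS](_ : _ = 2 * beta * ((ln c - ln u) / nu + 1 - th)); last by field; rewrite gt_eqF.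
by rewrite ler_pM2l// lerD2r ltW// -ltrBlDr.
Qed.

Lemma geo_quantiles_le (c1 c2 th1 th2 : R) : 0 <= c1 -> 0 <= c2 ->
  exists2 K, 0 <= K & forall u, 1 <= u ->
    geo_quantile c1 th1 u <= K * u `^ (- (2 * beta / nu)) /\
    geo_quantile c2 th2 u <= K * u `^ (- (2 * beta / nu)).
Proof.
move=> c10 c20; have [K1 K10 H1] := geo_quantile_le th1 c10.
have [K2 K20 H2] := geo_quantile_le th2 c20.
exists (K1 + K2) => [|u u1]; first exact: addr_ge0.
split; [apply: le_trans (H1 u u1) _|apply: le_trans (H2 u u1) _].
- by rewrite ler_wpM2r ?powR_ge0// lerDl.
- by rewrite ler_wpM2r ?powR_ge0// lerDr.
Qed.

Lemma inf_geo_tail c th s : 0 <= c -> 0 < s ->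
  inf [set x | x < 0 /\ s < geo_tail c th (- x)] = - geo_quantile c th s.
Proof.
move=> c0 s0.
have -> : [set x | x < 0 /\ s < geo_tail c th (- x)] = `]- geo_quantile c th s, 0[%classic.
  apply/seteqP; split=> x /=; rewrite in_itv/=.
    by move=> [x0]; rewrite geo_galois ?oppr_gt0// ltrNl x0 => ->.
  by move=> /andP[qx x0]; rewrite geo_galois ?oppr_gt0// ltrNl.
have := geo_quantile_ge0 c th s; rewrite le_eqVlt => /predU1P[<-|q0].
  (* If the quantile is 0 the set is empty, and the convention that its infimum is 0 gives the right
     value. *)
  by rewrite oppr0 set_itv_ge ?inf0// bnd_simp ltxx.
by rewrite inf_itv// bnd_simp oppr_lt0.
Qed.

End semistable_quantile.

Section Theta_opp.
Context (R : realType).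
Local Notation lam := (@lebesgue_measure R).
Variables (rho K : R) (q psi : R -> R).
Hypotheses (rho12 : 1 / 2 < rho) (K0 : 0 <= K) (mq : measurable_fun setT q).
Hypotheses (q0 : forall u, 0 <= q u) (qK : forall u, 1 <= u -> q u <= K * u `^ (- rho)).
Hypothesis psiq : forall u, 0 < u -> psi u = - q u.

(** Both integrands of [Theta] are odd. The point 0, where nothing is assumed on [psi], is removed
    by passing from [0, 1] to ]0, 1]. *)
Lemma Theta_opp : Theta psi = - Theta q.
Proof.
have mt := continuous_measurable_fun (@continuous_trunc1 R).
have m01 : @measurable _ (measurableTypeR R) (`]0%R, 1%R]%classic : set R).
  exact: measurable_itv.
have mD1 : @measurable _ (measurableTypeR R) (`[1%R, +oo[%classic : set R).
  exact: measurable_itv.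
have i01 : lam.-integrable `]0%R, 1%R] (EFin \o (fun u => trunc1 (q u))).
  apply: (@integrable_bounded_itv R 0 1 1) => //.
  - exact: subset_itv_oc_cc.
  - by apply: measurable_funTS; exact: (measurableT_comp mt mq).
  - by move=> u _; exact: norm_trunc1_le1.
have iD1 := integrable_trunc1_compl rho12 K0 (measurable_funTS mq) (fun u _ => q0 u) qK.
have E1 u : `]0%R, 1%R]%classic u -> psi u / (1 + psi u ^+ 2) = - 1 * trunc1 (q u).
  rewrite /= in_itv/= => /andP[u0 _].
  by rewrite psiq// sqrrN mulN1r mulNr.
have E2 u : `[1%R, +oo[%classic u -> psi u ^+ 3 / (1 + psi u ^+ 2) =
    - 1 * (q u ^+ 3 / (1 + q u ^+ 2)).
  rewrite /= in_itv/= andbT => u1; rewrite psiq ?(lt_le_trans ltr01)//.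
  have -> : (- q u) ^+ 3 = - (q u ^+ 3) by ring.
  by rewrite sqrrN mulN1r mulNr.
rewrite /Theta.
have -> : \int[lam]_(s in `[0, 1]) (psi s / (1 + psi s ^+ 2)) =
   - \int[lam]_(s in `[0, 1]) (q s / (1 + q s ^+ 2)).
  rewrite -Rintegral_itv_obnd_cbnd; last first.
    apply: (@eq_integrable _ (measurableTypeR R) R lam _ m01
      (EFin \o (fun u => - 1 * trunc1 (q u)))).
      by move=> u; rewrite inE => /E1 /= ->.
    exact: (@integrableZl _ (measurableTypeR R) R lam _ m01 (- 1) _ i01).
  rewrite -[in RHS]Rintegral_itv_obnd_cbnd//.
  transitivity (\int[lam]_(u in `]0, 1]) (- 1 * trunc1 (q u))).
    by apply: eq_Rintegral => u; rewrite inE; exact: E1.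
  by rewrite RintegralZl// mulN1r.
have -> : \int[lam]_(s in `[1, +oo[) (psi s ^+ 3 / (1 + psi s ^+ 2)) =
   - \int[lam]_(s in `[1, +oo[) (q s ^+ 3 / (1 + q s ^+ 2)).
  transitivity (\int[lam]_(u in `[1, +oo[) (- 1 * (q u ^+ 3 / (1 + q u ^+ 2)))).
    by apply: eq_Rintegral => u; rewrite inE; exact: E2.
  by rewrite RintegralZl// mulN1r.
by rewrite opprB opprK addrC.
Qed.

End Theta_opp.

(** * Recognition of the semi-stable law *)

Section semistable_criterion.
Context (R : realType).
Variables (nu beta c1 : R).
Hypotheses (nu_gt0 : 0 < nu) (beta_gt0 : 0 < beta) (c1_ge0 : 0 <= c1).
Hypothesis alpha_lt2 : nu / (2 * beta) < 2.
Let ML (y : R) : R :=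
  c1 * expR (- nu * ((Num.floor (2^-1 + (2 * beta)^-1 * ln (- y)))%:~R
                        - (2 * beta)^-1 * ln (- y))).
Let MR (x : R) : R :=
  expR (- nu * ((Num.floor ((2 * beta)^-1 * ln x) + 1)%:~R
                   - (2 * beta)^-1 * ln x)).
Let q1 := geo_quantile nu beta c1 2^-1.
Let q2 := geo_quantile nu beta 1 1.

(** The term [(2 * beta)^-1 * ln x] in [ML] and [MR] is exactly the logarithm of [x ^ alpha] up to
    the factor [nu]. Division by [x ^ alpha] removes it and leaves a geometric step function. *)
Let mul_norm_powR (x z : R) : 0 < x ->
  expR (- nu * (z - (2 * beta)^-1 * ln x)) / x `^ (nu / (2 * beta)) = expR (- nu * z).
Proof.
move=> x0; rewrite /powR gt_eqF// -expRN -expRD; congr expR.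
by field; rewrite gt_eqF.
Qed.

Let LambdaLE x : x < 0 ->
  LambdaL (nu / (2 * beta)) ML x = geo_tail nu beta c1 2^-1 (- x).
Proof.
move=> x0; rewrite /LambdaL /ML /geo_tail ltr0_norm// -mulrA.
by rewrite mul_norm_powR ?oppr_gt0// [X in Num.floor X]addrC.
Qed.

Let LambdaRE x : 0 < x ->
  - LambdaR (nu / (2 * beta)) MR x = geo_tail nu beta 1 1 x.
Proof.
move=> x0; rewrite /LambdaR /MR /geo_tail opprK mul1r mul_norm_powR//.
by rewrite floorDrz// -[1]/(1%:~R) intrKfloor.
Qed.

Lemma quantile_rho : 1 / 2 < 2 * beta / nu.
Proof.
have := alpha_lt2; rewrite ltr_pdivrMr ?mulr_gt0// ltr_pdivlMr//; lra.
Qed.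

(** On positive reals [psi1] and [psi2] are the opposites of [q1] and [q2], whence the location is
    [Theta q2 - Theta q1], the limit of the centering. *)
Lemma semistable_law_of_chf (mu : probability R R) :
  (forall t : R,
    let re := levy_int q1 q2 (fun y => cos (t * y) - 1) in
    let im := levy_int q1 q2 (fun y => sin (t * y) - t * trunc1 y) +
              t * (Theta q2 - Theta q1) in
    \int[mu]_x cos (t * x) = expR re * cos im /\
    \int[mu]_x sin (t * x) = expR re * sin im) ->
  semistable_law (nu / (2 * beta)) ML MR mu.
Proof.
have mq1 := measurable_geo_quantile nu beta c1 2^-1.
have mq2 := measurable_geo_quantile nu beta 1 1.
have [K K0 qK] := geo_quantiles_le nu_gt0 beta_gt0 2^-1 1 c1_ge0 (@ler01 R).
have q1K u u1 := (qK u u1).1; have q2K u u1 := (qK u u1).2.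
have rho12 := quantile_rho.
have Th1 : Theta (psi1 (nu / (2 * beta)) ML) = - Theta q1.
  apply: (Theta_opp rho12 K0 mq1 (geo_quantile_ge0 nu beta c1 2^-1) q1K) => u u0.
  rewrite -(inf_geo_tail nu_gt0 beta_gt0)//; congr inf.
  by apply/seteqP; split=> x /= [x0]; rewrite LambdaLE.
have Th2 : Theta (psi2 (nu / (2 * beta)) MR) = - Theta q2.
  apply: (Theta_opp rho12 K0 mq2 (geo_quantile_ge0 nu beta 1 1) q2K) => u u0.
  rewrite -(inf_geo_tail nu_gt0 beta_gt0)//; congr inf.
  by apply/seteqP; split=> x /= [x0]; rewrite LambdaRE ?oppr_gt0.
move=> H; exists (levy_image mq1 mq2); split.
  split; first exact: levy_image0.
  split=> [y y0|x x0].
    rewrite LambdaLE// (@levy_image_lt _ _ _ (geo_tail nu beta c1 2^-1))//.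
    - by move=> x; exact: geo_tail_ge0.
    - by move=> u x u0 x0; exact: geo_galois.
  rewrite LambdaRE// (@levy_image_gt _ _ _ (geo_tail nu beta 1 1))//.
  - by move=> y; exact: geo_tail_ge0.
  - by move=> u y u0 y0; exact: geo_galois.
move=> t; have [] := H t.
rewrite /= /eta_loc Th1 Th2.
have I g C := @levy_image_integral R q1 q2 _ _ mq1 mq2 (geo_quantile_ge0 nu beta c1 2^-1)
  (geo_quantile_ge0 nu beta 1 1) rho12 K0 q1K q2K g C.
rewrite (I _ _ (@continuous_cosB1 R t) (@cosB1_le R t) (cosB1_le2 t)).
have -> : (fun x => sin (t * x) - t * x / (1 + x ^+ 2)) = (fun x => sin (t * x) - t * trunc1 x).
  by apply/funext => x; rewrite /trunc1 mulrA.
rewrite (I _ _ (@continuous_sin_trunc R t) (@sin_trunc_le R t) (sin_trunc_le1 t)).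
have -> : (- Theta q1 - - Theta q2) * t +
    levy_int q1 q2 (fun y => sin (t * y) - t * trunc1 y) =
    levy_int q1 q2 (fun y => sin (t * y) - t * trunc1 y) + t * (Theta q2 - Theta q1).
  by ring.
by [].
Qed.

End semistable_criterion.

(** * Tails of X *)

Section growth.
Context (R : realType).
Variables (beta : R) (L : R -> R).
Hypothesis beta_gt0 : 0 < beta.
Hypothesis L_sv : slowly_varying L.
Hypothesis L_mono : exists N : nat, forall n m : nat, (N <= n)%N -> (n <= m)%N ->
  L (expR n%:R) <= L (expR m%:R).

(** [X] is [amp W] with the sign of [(-1) ^ W]. The argument is real so that [amp_ratio] can shift
    it freely. *)
Definition amp (y : R) : R := L (expR y) * expR (beta * y).

Lemma expR_cvgy (f : nat -> R) : f @ \oo --> +oo -> (fun n => expR (f n)) @ \oo --> +oo.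
Proof.
move=> /cvgryPge foo; apply/cvgryPge => M; apply: filterS (foo M) => n Mf.
by apply: le_trans (expR_ge1Dx _); rewrite (le_trans Mf)// lerDr.
Qed.

Lemma cvgy_scale (a : R) (f : nat -> R) : 0 < a -> f @ \oo --> +oo ->
  (fun n => a * f n) @ \oo --> +oo.
Proof.
move=> a0 /cvgryPge foo; apply/cvgryPge => M.
by apply: filterS (foo (a^-1 * M)) => n; rewrite ler_pdivrMl.
Qed.

Lemma amp_ratio (f : nat -> R) (i : R) : f @ \oo --> +oo ->
  (fun n => amp (f n + i) / amp (f n)) @ \oo --> expR (beta * i).
Proof.
move=> foo; have [L0 Lr] := L_sv.
have H : (fun n => L (expR i * expR (f n)) / L (expR (f n)) * expR (beta * i)) @ \oo -->
    1 * expR (beta * i).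
  apply: cvgMl.
  exact: (cvg_comp _ (fun x => L (expR i * x) / L x) (expR_cvgy foo) (Lr _ (expR_gt0 i))).
rewrite mul1r in H; apply: cvg_trans H; apply: near_eq_cvg; near=> n.
have Ln : 0 < L (expR (f n)).
  by near: n; exact: (expR_cvgy foo) L0.
rewrite /amp mulrDr !expRD [expR (f n) * _]mulrC; field.
by rewrite !gt_eqF// expR_gt0.
Unshelve. all: by end_near. Qed.

(** Monotonicity of [L (expR n)] leaves the exponential factor as a lower bound for the growth, with
    exactly the rate [beta]. *)
Lemma amp_growth : exists M0 : nat, forall n m : nat, (M0 <= n)%N -> (n <= m)%N ->
  0 < amp n%:R /\ amp n%:R <= expR (- beta * (m - n)%N%:R) * amp m%:R.
Proof.
have [N1 LN] := L_mono; have [L0 _] := L_sv.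
have [N2 _ LN2] := expR_cvgy (@cvgr_idn R) L0.
exists (maxn N1 N2) => n m; rewrite geq_max => /andP[Nn Nn2] nm.
have Ln : 0 < L (expR n%:R) by exact: LN2.
split; first by rewrite mulr_gt0 ?expR_gt0.
rewrite /amp mulrCA -expRD natrB//.
rewrite (_ : - beta * _ + _ = beta * n%:R); last by ring.
by rewrite ler_wpM2r ?expR_ge0// LN.
Qed.

Lemma amp_cvgy : (fun n : nat => amp n%:R) @ \oo --> +oo.
Proof.
have [M0 H] := amp_growth.
have [aM _] := H M0 M0 (leqnn _) (leqnn _).
apply/cvgryPge => A.
have : (fun n : nat => expR (beta * n%:R)) @ \oo --> +oo.
  by apply: expR_cvgy; apply: cvgy_scale => //; exact: cvgr_idn.
move=> /cvgryPge/(_ (A / amp M0%:R * expR (beta * M0%:R))).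
move=> [N _ HN]; exists (maxn N M0) => // n /=; rewrite geq_max => /andP[/HN/= An Mn].
have [_ H1] := H M0 n (leqnn _) Mn.
have := ler_wpM2l (expR_ge0 (beta * (n - M0)%N%:R)) H1.
rewrite [leRHS]mulrA -expRD mulNr subrr expR0 mul1r; apply: le_trans.
rewrite natrB// mulrBr expRD expRN -ler_pdivrMr// ler_pdivlMr ?expR_gt0//.
Qed.

End growth.

(** * Parity tails of [W] and scaled tails of [X] *)

Section counting_variable.
Context d (Omega : measurableType d) (R : realType) (P : probability Omega R).
Variable W : Omega -> nat.
Hypothesis mW : measurable_fun setT W.

Definition pW (S : set nat) : R := fine (P (W @^-1` S)).

Let mWS (S : set nat) : measurable (W @^-1` S).
Proof. by rewrite -[X in measurable X]setTI; apply: mW. Qed.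

Lemma pW_ge0 S : 0 <= pW S.
Proof. by rewrite fine_ge0. Qed.

Lemma pWE S : (pW S)%:E = P (W @^-1` S).
Proof. by rewrite fineK// fin_num_measure. Qed.

Lemma pW_le1 S : pW S <= 1.
Proof. by rewrite -lee_fin pWE probability_le1. Qed.

Lemma le_pW S S' : S `<=` S' -> pW S <= pW S'.
Proof. by move=> SS; rewrite -lee_fin !pWE le_measure ?inE// => w; apply: SS. Qed.

Lemma pW_setU S S' : pW (S `|` S') <= pW S + pW S'.
Proof. by rewrite -lee_fin EFinD !pWE preimage_setU; apply: measureU2. Qed.

Lemma pW_setC S : pW (~` S) = 1 - pW S.
Proof. by apply: EFin_inj; rewrite EFinB !pWE preimage_setC (probability_setC _ (mWS S)). Qed.

Variables (nu c1 : R) (h1 h2 : R -> R).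
Hypotheses (nu_gt0 : 0 < nu) (c1_ge0 : 0 <= c1).
Hypothesis h1_pos : forall x, 0 < x -> 0 < h1 x.
Hypothesis h2_pos : forall x, 0 < x -> 0 < h2 x.
Hypothesis h21 : (fun x => h2 x / h1 x) @ +oo --> c1.
Hypothesis h1_reg : forall e : R, 0 < e -> exists M delta : R, 0 < delta /\
      forall x a : R, M < x -> `|a - 1| < delta -> `|h1 (a * x) / h1 x - 1| < e.
Hypothesis W_even : forall x : R, 0 < x ->
     P [set w | x <= (W w)%:R / 2 /\ ~~ odd (W w)] =
     (h1 (Num.ceil x)%:~R * expR (- nu * (Num.ceil x)%:~R))%:E.
Hypothesis W_odd : forall x : R, 0 < x ->
     P [set w | x <= ((W w)%:R - 1) / 2 /\ odd (W w)] =
     (h2 (Num.ceil x)%:~R * expR (- nu * (Num.ceil x)%:~R))%:E.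

Let hb (b : bool) := if b then h2 else h1.
Let cb (b : bool) := if b then c1 else 1.

Definition parity_tail (b : bool) (m : nat) : R :=
  pW [set i | odd i = b /\ (m.*2 + b <= i)%N].

Lemma parity_tailE b m : (0 < m)%N ->
  parity_tail b m = hb b m%:R * expR (- nu * m%:R).
Proof.
move=> m0; have m0R : 0 < m%:R :> R by rewrite ltr0n.
apply: EFin_inj; rewrite /parity_tail pWE.
have Eodd (i : nat) : (m%:R <= (i%:R - 1) / 2 :> R) = (m.*2 + 1 <= i)%N.
  by rewrite ler_pdivlMr// lerBrDr -natrM natr1 ler_nat muln2 addn1.
have Eeven (i : nat) : (m%:R <= i%:R / 2 :> R) = (m.*2 + 0 <= i)%N.
  by rewrite ler_pdivlMr// -natrM ler_nat muln2 addn0.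
case: b; rewrite /hb /=.
  have := W_odd m0R; rewrite (_ : m%:R = m%:~R)// intrKceil => <-; congr (P _).
  by apply/seteqP; split=> w /= [A B]; split=> //; move: B; rewrite -?Eodd// -Eodd.
have := W_even m0R; rewrite (_ : m%:R = m%:~R)// intrKceil => <-; congr (P _).
apply/seteqP; split=> w /= [A B].
  by split; [move: B; rewrite -Eeven|rewrite A].
by split; [exact/negbTE|rewrite -Eeven].
Qed.

(** A fixed shift is an asymptotically trivial dilation: the regularity of [h1] is used with the
    factor [(N + j) / N], which tends to 1. *)
Lemma h_ratio b (j : int) :
  (fun N : nat => hb b (N%:R + j%:~R) / h1 N%:R) @ \oo --> cb b.
Proof.
have Noo : (fun N : nat => N%:R + j%:~R : R) @ \oo --> +oo.
  apply/cvgryPge => M; have /cvgryPge/(_ (M - j%:~R)) := @cvgr_idn R.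
  by apply: filterS => n; rewrite lerBlDr.
have H1 : (fun N : nat => h1 (N%:R + j%:~R) / h1 N%:R) @ \oo --> (1 : R).
  apply/cvgrPdist_lt => e e0; have [M [de [de0 H]]] := h1_reg e0.
  near=> N.
  have N0 : 0 < N%:R :> R by near: N; apply: cvgry_gt; exact: cvgr_idn.
  rewrite distrC (_ : N%:R + j%:~R = ((N%:R + j%:~R) / N%:R) * N%:R); last first.
    by rewrite divfK// gt_eqF.
  apply: H; first by near: N; apply: cvgry_gt; exact: cvgr_idn.
  rewrite mulrDl divff ?gt_eqF// addrAC subrr add0r normrM normfV (gtr0_norm N0).
  rewrite ltr_pdivrMr// mulrC -ltr_pdivrMr//.
  by near: N; apply: cvgry_gt; exact: cvgr_idn.
case: b => //=; rewrite /hb /cb.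
have H2 : (fun N : nat => h2 (N%:R + j%:~R) / h1 (N%:R + j%:~R) *
    (h1 (N%:R + j%:~R) / h1 N%:R)) @ \oo --> c1 * 1.
  by apply: cvgM => //; exact: (cvg_comp _ _ Noo h21).
rewrite mulr1 in H2; apply: cvg_trans H2; apply: near_eq_cvg; near=> N.
have N0 : 0 < N%:R + j%:~R :> R by near: N; exact: cvgry_gt.
have N0' : 0 < N%:R :> R by near: N; apply: cvgry_gt; exact: cvgr_idn.
by field; rewrite !gt_eqF// h1_pos.
Unshelve. all: by end_near. Qed.

(** The slowly changing factors disappear and only the geometric dependence on the integer shift
    remains: the source of the step functions in the limit. [absz] is harmless since [N + j] is
    eventually positive. *)
Lemma parity_tail_ratio b (j : int) :
  (fun N : nat => parity_tail b (absz (N%:Z + j)) / parity_tail false N) @ \oo -->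
  cb b * expR (- nu * j%:~R).
Proof.
have H : (fun N : nat => hb b (N%:R + j%:~R) / h1 N%:R * expR (- nu * j%:~R)) @ \oo -->
    cb b * expR (- nu * j%:~R).
  by apply: cvgMl; exact: h_ratio.
apply: cvg_trans H; apply: near_eq_cvg; near=> N.
have N0' : 0 < N%:R :> R by near: N; apply: cvgry_gt; exact: cvgr_idn.
have N0 : 0 < N%:R + j%:~R :> R.
  have : - j%:~R < N%:R :> R by near: N; apply: cvgry_gt; exact: cvgr_idn.
  by lra.
have Nj : (absz (N%:Z + j)%R)%:R = N%:R + j%:~R :> R.
  rewrite natr_absz ger0_norm ?intrD// -(ler0z R) intrD; exact: ltW.
rewrite !parity_tailE; last 2 first.
- by move: N0'; rewrite ltr0n.
- by rewrite -(ltr0n R) Nj.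
rewrite Nj mulrDr expRD /hb; field.
by rewrite !gt_eqF ?expR_gt0 ?h1_pos.
Unshelve. all: by end_near. Qed.

Local Notation T := (parity_tail false).

Lemma parity_tail_gt0 b m : (0 < m)%N -> 0 < parity_tail b m.
Proof.
move=> m0; rewrite parity_tailE// mulr_gt0 ?expR_gt0// /hb.
by case: b; [apply: h2_pos|apply: h1_pos]; rewrite ltr0n.
Qed.

Lemma even_tail_ratio : (fun N : nat => T N.+1 / T N) @ \oo --> expR (- nu).
Proof.
have := @parity_tail_ratio false 1; rewrite mul1r mulr1.
apply: cvg_trans; apply: near_eq_cvg; apply: nearW => N.
by rewrite -PoszD addn1 absz_nat.
Qed.

(** A Potter-type bound: successive ratios eventually exceed [expR (- (nu + e))], and they are
    multiplied [i] times. *)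
Lemma even_tail_growth (e : R) : 0 < e -> exists2 M : nat, (0 < M)%N &
  forall N i : nat, (M <= N)%N -> T N <= expR ((nu + e) * i%:R) * T (N + i)%N.
Proof.
move=> e0.
have : \forall N \near \oo, expR (- (nu + e)) < T N.+1 / T N.
  by apply: (cvgr_gt (expR (- nu))); [exact: even_tail_ratio|rewrite ltr_expR; lra].
move=> [M _ HM]; exists (maxn M 1); first by rewrite leq_max orbT.
move=> N + MN; elim=> [|i IH]; first by rewrite mulr0 expR0 mul1r addn0.
apply: le_trans IH _.
have MNi : (maxn M 1 <= N + i)%N by rewrite (leq_trans MN)// leq_addr.
move: (MNi); rewrite geq_max => /andP[/HM/= + Ni0].
rewrite ltr_pdivlMr ?parity_tail_gt0// expRN => H.
rewrite -natr1 mulrDr mulr1 expRD -mulrA ler_wpM2l ?expR_ge0// addnS.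
by rewrite -ler_pdivrMl ?expR_gt0// ltW.
Qed.

Lemma even_tail_cvg0 : T @ \oo --> (0 : R).
Proof.
have : \forall N \near \oo, T N.+1 / T N < expR (- (nu / 2)).
  apply: (cvgr_lt (expR (- nu))); first exact: even_tail_ratio.
  by rewrite ltr_expR ltrN2; have := nu_gt0; lra.
move=> [M0 _ HM]; pose M := maxn M0 1.
have H i : T (i + M)%N <= expR (- (nu / 2) * i%:R) * T M.
  elim: i => [|i IH]; first by rewrite mulr0 expR0 mul1r.
  have : (maxn M0 1 <= i + M)%N by rewrite leq_addl.
  rewrite geq_max => /andP[/HM/= + Ni0].
  rewrite ltr_pdivrMr ?parity_tail_gt0// => /ltW/le_trans; apply.
  by rewrite -[i.+1%:R]natr1 mulrDr mulr1 addrC expRD -mulrA ler_wpM2l ?expR_ge0.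
have H0 : (fun i : nat => expR (- (nu / 2 * i%:R)) * T M) @ \oo --> (0 : R).
  rewrite -(mul0r (T M)); apply: cvgMl.
  apply: (cvg_comp _ (fun x : R => expR (- x)) _ (@cvgr_expR R)).
  by apply: cvgy_scale; [have := nu_gt0; lra|exact: cvgr_idn].
rewrite -(cvg_shiftn M).
apply: (squeeze_cvgr _ (cvg_cst (0 : R)) H0); apply: nearW => i.
by rewrite pW_ge0/= (le_trans (H i))// mulNr.
Qed.

(* With a shift of index: [num_terms N] is [k_(N+1)], and accordingly [A_(k_(N+1))]
   is [amp beta L (2 * N)]. *)
Definition num_terms (N : nat) : nat := absz (Num.ceil (expR (N%:R * nu) / h1 N%:R)).
Local Notation k N := ((num_terms N)%:R : R).

(** The number of terms is the ceiling of [(T N)^-1]; since [T N] tends to 0, the rounding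
    disappears in the product [k N * T N]. *)
Lemma num_terms_bounds (N : nat) : (0 < N)%N -> (T N)^-1 <= k N < (T N)^-1 + 1.
Proof.
move=> N0; have hN : 0 < h1 N%:R by apply: h1_pos; rewrite ltr0n.
have -> : (T N)^-1 = expR (N%:R * nu) / h1 N%:R.
  by rewrite parity_tailE// /hb invfM -expRN mulNr opprK mulrC [nu * _]mulrC.
have y0 : 0 < expR (N%:R * nu) / h1 N%:R by rewrite divr_gt0 ?expR_gt0.
rewrite /num_terms natr_absz ger0_norm; last by rewrite ceil_ge0 (lt_trans _ y0)// ltrN10.
have := ceil_itv (expR (N%:R * nu) / h1 N%:R); rewrite intrB => /andP[A ->] /=.
by rewrite -ltrBlDr.
Qed.

Lemma num_terms_tail : (fun N => k N * T N) @ \oo --> (1 : R).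
Proof.
have H : (fun N => 1 + T N) @ \oo --> (1 : R).
  by rewrite -[X in _ --> X]addr0; apply: cvgD; [exact: cvg_cst|exact: even_tail_cvg0].
apply: (squeeze_cvgr _ (cvg_cst (1 : R)) H); near=> N.
have N0 : (0 < N)%N by near: N; exists 1.
have T0 := parity_tail_gt0 false N0.
have /andP[A B] := num_terms_bounds N0.
rewrite -ler_pdivrMr// div1r A/= -ler_pdivlMr// mulrDl mul1r divff ?gt_eqF//.
exact: ltW.
Unshelve. all: by end_near. Qed.

Lemma num_terms_cvgy : (fun N => k N) @ \oo --> +oo.
Proof.
have T0 : \forall N \near \oo, 0 < T N by exists 1 => // N /= ?; exact: parity_tail_gt0.
have : (fun N => (T N)^-1) @ \oo --> +oo.
  have y0 : \forall N \near \oo, 0 < (T N)^-1 by apply: filterS T0 => N; rewrite invr_gt0.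
  apply/(gtr0_cvgV0 y0); apply: cvg_trans even_tail_cvg0.
  by apply: near_eq_cvg; apply: nearW => N; rewrite /= invrK.
move=> /cvgryPge H; apply/cvgryPge => M; near=> N.
have N0 : (0 < N)%N by near: N; exists 1.
have /andP[A _] := num_terms_bounds N0.
by apply: le_trans A; near: N; exact: H.
Unshelve. all: by end_near. Qed.

Lemma num_terms_parity_tail b (j : int) :
  (fun N : nat => k N * parity_tail b (absz (N%:Z + j))) @ \oo --> cb b * expR (- nu * j%:~R).
Proof.
have H : (fun N : nat => k N * T N * (parity_tail b (absz (N%:Z + j)) / T N)) @ \oo -->
    1 * (cb b * expR (- nu * j%:~R)).
  by apply: cvgM; [exact: num_terms_tail|exact: (@parity_tail_ratio b j)].
rewrite mul1r in H; apply: cvg_trans H; apply: near_eq_cvg; near=> N.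
have N0 : (0 < N)%N by near: N; exists 1.
by field; rewrite gt_eqF// parity_tail_gt0.
Unshelve. all: by end_near. Qed.

Variables (beta : R) (L : R -> R).
Hypothesis beta_gt0 : 0 < beta.
Hypothesis L_sv : slowly_varying L.
Hypothesis L_mono : exists N : nat, forall n m : nat, (N <= n)%N -> (n <= m)%N ->
  L (expR n%:R) <= L (expR m%:R).

Local Notation g m := (amp beta L (m%N)%:R).
Local Notation A N := (amp beta L (2 * (N%N)%:R)).
Let b2 : 0 < 2 * beta. Proof. by rewrite mulr_gt0. Qed.

Definition signed_amp (m : nat) : R := g m * (-1) ^+ m.

Lemma amp_double (N : nat) : A N = g N.*2.
Proof. by rewrite -natrM mul2n. Qed.

Lemma A_cvgy : (fun N => A N) @ \oo --> +oo.
Proof.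
have /cvgryPge H := amp_cvgy beta_gt0 L_sv L_mono; apply/cvgryPge => M.
have [N _ HN] := H M; exists N => // n /= Nn; rewrite amp_double; apply: HN => /=.
by rewrite (leq_trans Nn)// -addnn leq_addr.
Qed.

Lemma amp_initial_bound (M0 : nat) : exists2 C0 : R, 0 <= C0 &
  forall m, (m < M0)%N -> `|g m| <= C0.
Proof.
exists (\sum_(i < M0) `|g i|); first exact: sumr_ge0.
by move=> m mM; rewrite (bigD1 (Ordinal mM))//= lerDl sumr_ge0.
Qed.

(** Reduces comparison of [amp] with [x * A N] to comparison of indices. With [i = 2 * j + b] one
    has [expR (beta * (i - 2)) < x < expR (beta * i)], the left inequality being strict because [z]
    is not an integer; by slow variation the same order holds between the amplitudes near [2 * N]
    and [x * A N]. The bound on [- g m] disposes of indices of the other parity. *)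
Lemma amp_threshold (b : bool) (x : R) : 0 < x ->
  let z := (2 * beta)^-1 * ln x + (if b then 2^-1 else 1) in
  (Num.floor z)%:~R != z ->
  \forall N \near \oo, forall m : nat, - g m < x * A N /\
    (odd m = b ->
      (x * A N <= g m) = ((absz (N%:Z + Num.floor z)%R).*2 + b <= m)%N /\
      (x * A N < g m) = ((absz (N%:Z + Num.floor z)%R).*2 + b <= m)%N).
Proof.
move=> x0 z nz; set j := Num.floor z.
have [M0 gr] := amp_growth beta L_sv L_mono.
(* For [m < M0] neither the sign nor the order of the amplitudes is known; they are only bounded,
   and [x * A N] eventually exceeds their bound. *)
have [C0 C00 HC0] := amp_initial_bound M0.
have gmono n m : (M0 <= n)%N -> (n <= m)%N -> 0 < g n /\ g n <= g m.
  move=> Mn nm; have [gn gnm] := gr n m Mn nm; split=> //.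
  apply: le_trans gnm _; have [gm _] := gr m m (leq_trans Mn nm) (leqnn _).
  by rewrite ler_piMl ?(ltW gm)// -expR0 ler_expR mulNr oppr_le0 mulr_ge0// ltW.
have Noo : (fun N : nat => 2 * N%:R : R) @ \oo --> +oo.
  by apply: cvgy_scale => //; exact: cvgr_idn.
have /andP[jz zj] := floor_itv z; rewrite -/j in jz zj.
have jz' : j%:~R < z by rewrite lt_neqAle nz.
have xE : x = expR (beta * (2 * ((2 * beta)^-1 * ln x))).
  rewrite (_ : beta * _ = ln x) ?lnK ?posrE//; field; exact: lt0r_neq0.
pose i : R := 2 * j%:~R + (b : nat)%:R.
have R1 := @amp_ratio R beta L L_sv _ i Noo.
have R2 := @amp_ratio R beta L L_sv _ (i - 2) Noo.
have xi : x < expR (beta * i).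
  rewrite xE ltr_expR ltr_pM2l// /i; move: zj; rewrite /z intrD.
  by case: (b) => /=; lra.
have ix : expR (beta * (i - 2)) < x.
  rewrite xE ltr_expR ltr_pM2l// /i; move: jz'; rewrite /z.
  by case: (b) => /=; lra.
near=> N.
have AN : 0 < A N by near: N; apply: cvgry_gt; exact: A_cvgy.
have CA : C0 < x * A N.
  by near: N; apply: cvgry_gt; apply: cvgy_scale => //; exact: A_cvgy.
have H1 : x * A N < amp beta L (2 * N%:R + i).
  by rewrite -ltr_pdivlMr//; near: N; exact: (cvgr_gt _ R1).
have H2 : amp beta L (2 * N%:R + (i - 2)) < x * A N.
  by rewrite -ltr_pdivrMr//; near: N; exact: (cvgr_lt _ R2).
have Nj : M0.+1%:R <= N%:R + j%:~R :> R.
  rewrite -lerBlDr; near: N; apply: cvgry_ge; exact: cvgr_idn.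
have [p pE] : exists p : nat, (N%:Z + j)%R = p.
  exists (absz (N%:Z + j)); rewrite gez0_abs// -(ler0z R) intrD.
  by rewrite (le_trans _ Nj).
have pR : p%:R = N%:R + j%:~R :> R.
  by rewrite -[RHS](intrD _ N%:Z) pE.
have pM : (M0 < p)%N by rewrite -(ler_nat R) pR.
rewrite pE absz_nat.
have m1E : 2 * N%:R + i = (p.*2 + b)%N%:R.
  by rewrite natrD -mul2n natrM pR /i; ring.
have m2E : 2 * N%:R + (i - 2) = (p.-1.*2 + b)%N%:R.
  have p0 : (0 < p)%N by exact: leq_trans pM.
  rewrite natrD -mul2n natrM -subn1 natrB// pR /i; ring.
rewrite m1E in H1; rewrite m2E in H2.
have small m : (m < M0)%N -> g m < x * A N.
  by move=> mM; apply: le_lt_trans (ler_norm _) _; apply: le_lt_trans (HC0 m mM) CA.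
move=> m; split.
  have [mM|mM] := ltnP m M0.
    by apply: le_lt_trans (ler_norm _) _; rewrite normrN; apply: le_lt_trans (HC0 m mM) CA.
  have [gm _] := gmono m m mM (leqnn _).
  by rewrite (@lt_trans _ _ 0)// ?oppr_lt0// mulr_gt0.
move=> om; have [pm|mp] := leqP (p.*2 + b)%N m.
  have Mp : (M0 <= p.*2 + b)%N by rewrite (leq_trans (ltnW pM))// -addnn -addnA leq_addr.
  have [_ H] := gmono (p.*2 + b)%N m Mp pm.
  have xA := lt_le_trans H1 H.
  by rewrite ltW.
suff xA : g m < x * A N by rewrite leNgt xA ltNge ltW.
have [mM|mM] := ltnP m M0; first exact: small.
have mp' : (m <= p.-1.*2 + b)%N.
  move: mp; rewrite -(odd_double_half m) om addnC ltn_add2r leq_add2r ltn_double leq_double.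
  by move=> hp; rewrite -ltnS prednK// (leq_trans _ pM).
have [_ H] := gmono m _ mM mp'.
exact: le_lt_trans H H2.
Unshelve. all: by end_near. Qed.

(** Beyond the threshold only even [W] contribute on the right and only odd [W] on the left, hence
    the constants 1 and [c1]. *)
Lemma upper_tail_limit (x : R) : 0 < x ->
  (Num.floor ((2 * beta)^-1 * ln x + 1))%:~R != (2 * beta)^-1 * ln x + 1 ->
  (fun N => k N * pW [set m | x * A N < signed_amp m]) @ \oo --> geo_tail nu beta 1 1 x.
Proof.
move=> x0 nz; have th := @amp_threshold false x x0 nz.
have H := num_terms_parity_tail (b := false) (j := Num.floor ((2 * beta)^-1 * ln x + 1)).
apply: cvg_trans H; apply: near_eq_cvg; apply: filterS th => N thN; congr (_ * pW _).
apply/seteqP; split=> m /=; have [gm Hm] := thN m; rewrite /signed_amp -signr_odd.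
  by move=> [om]; have [_ <-] := Hm om; rewrite om expr0 mulr1.
case: (boolP (odd m)) => [|/negbTE] om.
  by rewrite expr1 mulrN1 => /(lt_trans gm); rewrite ltxx.
by rewrite expr0 mulr1; have [_ <-] := Hm om.
Qed.

Lemma lower_tail_limit (x : R) : 0 < x ->
  (Num.floor ((2 * beta)^-1 * ln x + 2^-1))%:~R != (2 * beta)^-1 * ln x + 2^-1 ->
  (fun N => k N * pW [set m | signed_amp m <= - (x * A N)]) @ \oo --> geo_tail nu beta c1 2^-1 x.
Proof.
move=> x0 nz; have th := @amp_threshold true x x0 nz.
have H := num_terms_parity_tail (b := true) (j := Num.floor ((2 * beta)^-1 * ln x + 2^-1)).
apply: cvg_trans H; apply: near_eq_cvg; apply: filterS th => N thN; congr (_ * pW _).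
apply/seteqP; split=> m /=; have [gm Hm] := thN m; rewrite /signed_amp -signr_odd.
  by move=> [om]; have [<- _] := Hm om; rewrite om expr1 mulrN1 lerN2.
case: (boolP (odd m)) => [|/negbTE] om.
  by rewrite expr1 mulrN1 lerN2; have [<- _] := Hm om.
by rewrite expr0 mulr1 lerNr leNgt gm.
Qed.

(** An amplitude above [expR (- (2 * beta * i)) * A N] forces [W >= 2 * (N - i)], by growth at rate
    [beta]. Going back [i] steps multiplies the even tail by at most [expR ((nu + e) * i)], the odd
    tail is comparable to the even one, and [k N * T N] is bounded. If [N - i] is below the range
    [M3] of these estimates, the probability is bounded by 1. *)
Lemma tail_bound (e : R) : 0 < e -> exists2 C : R, 0 <= C &
  \forall N \near \oo, forall i : nat,
    k N * pW [set m | expR (- (2 * beta * i%:R)) * A N < `|g m|] <= C * expR ((nu + e) * i%:R).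
Proof.
move=> e0.
have [M Mpos HM] := even_tail_growth e0.
have [M0 gr] := amp_growth beta L_sv L_mono.
have [C0 C00 HC0] := amp_initial_bound M0.
have [M1 _ HM1] : \forall m \near \oo, C0 < g m.
  by apply: cvgry_gt; exact: amp_cvgy.
have [M2 _ HM2] : \forall N \near \oo, parity_tail true N / T N < c1 + 1.
  have H := parity_tail_ratio (b := true) (j := 0).
  rewrite mulr0 expR0 mulr1 in H.
  have : \forall N \near \oo, parity_tail true (absz (N%:Z + 0)%R) / T N < c1 + 1.
    by apply: (cvgr_lt c1); [exact: H|rewrite ltrDl].
  by apply: filterS => N; rewrite addr0 absz_nat.
pose M3 := (M + M0 + M1 + M2)%N.
have T3 : 0 < T M3.
  by apply: parity_tail_gt0; rewrite !addn_gt0 Mpos.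
have c20 : 0 <= c1 + 2 by rewrite addr_ge0.
have iT3 : 0 <= 2 / T M3 by rewrite mulr_ge0// invr_ge0 ltW.
have nue : 0 <= nu + e by rewrite addr_ge0// ltW.
(* [k N * T N < 2] gives the factors 2; [c1 + 2] adds 1 for even values and [c1 + 1] for odd ones;
   the last term serves the case [N < i + M3]. *)
exists (2 * (c1 + 2) + 2 / T M3).
  by rewrite addr_ge0// mulr_ge0.
near=> N => i.
have AN : 0 < A N by near: N; apply: cvgry_gt; exact: A_cvgy.
have NM3 : (M3 <= N)%N by near: N; exists M3.
have kT : k N * T N < 2.
  near: N; apply: (cvgr_lt (1 : R)); last by rewrite ltr1n.
  exact: num_terms_tail.
have N0 : (0 < N)%N by rewrite (leq_trans _ NM3)// !addn_gt0 Mpos.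
have TN : 0 < T N by exact: parity_tail_gt0.
have kN : k N <= 2 / T N by rewrite ler_pdivlMr// ltW.
have [iN|Ni] := leqP (i + M3)%N N; last first.
  apply: (@le_trans _ _ (k N)).
    by rewrite ler_piMr// pW_le1.
  apply: le_trans kN _; rewrite [leRHS]mulrDl ler_wpDl//.
    by rewrite mulr_ge0 ?expR_ge0// mulr_ge0.
  have := HM M3 (N - M3)%N; rewrite subnKC// => H.
  have {}H : T M3 <= expR ((nu + e) * i%:R) * T N.
    apply: le_trans (H _) _; first by rewrite /M3 -!addnA leq_addr.
    rewrite ler_wpM2r ?(ltW TN)// ler_expR ler_wpM2l// ler_nat.
    by rewrite leq_subLR addnC ltnW.
  rewrite -mulrA ler_wpM2l// mulrC ler_pdivlMr// mulrC.
  by rewrite ler_pdivrMr.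
have iN' : (i <= N)%N by rewrite (leq_trans _ iN)// leq_addr.
pose n0 := (N - i)%N.
have Mn0 : (M3 <= n0)%N by rewrite leq_subRL.
have sub : [set m | expR (- (2 * beta * i%:R)) * A N < `|g m|] `<=`
  [set m | odd m = false /\ (n0.*2 + false <= m)%N] `|` [set m | odd m = true /\ (n0.*2 + true <= m)%N].
  move=> m /= H.
  suff nm : (n0.*2 <= m)%N.
    case: (boolP (odd m)) => om; [right|left]; last by rewrite addn0.
    split=> //; rewrite addn1 ltn_neqAle nm andbT; apply: contraTneq om => <-.
    by rewrite odd_double.
  rewrite leqNgt; apply/negP => mn; move: H; apply/negP; rewrite -leNgt.
  have n0N : (n0.*2 <= N.*2)%N by rewrite leq_double leq_subr.
  have M0n0 : (M0 <= n0.*2)%N.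
    rewrite -addnn (leq_trans _ (leq_addr _ _))// (leq_trans _ Mn0)//.
    by rewrite /M3 addnAC -!addnA addnCA leq_addr.
  have [mM|mM] := ltnP m M0.
    apply: le_trans (HC0 m mM) _.
    have M1n0 : (M1 <= n0.*2)%N.
      rewrite -addnn (leq_trans _ (leq_addr _ _))// (leq_trans _ Mn0)//.
      by rewrite /M3 addnAC addnC leq_addr.
    apply: le_trans (ltW (HM1 _ M1n0)) _.
    have [_] := gr n0.*2 N.*2 M0n0 n0N; rewrite -amp_double -doubleB subKn//.
    by rewrite (_ : - beta * _ = - (2 * beta * i%:R)) -?amp_double//; rewrite -mul2n natrM; ring.
  have mN : (m <= N.*2)%N by rewrite (leq_trans (ltnW mn)).
  have [gm gmN] := gr m N.*2 mM mN.
  rewrite gtr0_norm// (le_trans gmN)// -amp_double ler_wpM2r ?(ltW AN)// ler_expR.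
  rewrite mulNr lerN2 [2 * beta]mulrC -mulrA ler_wpM2l ?(ltW beta_gt0)//.
  rewrite -natrM ler_nat mul2n leq_subRL// -[X in (_ <= X.*2)%N](subnK iN') doubleD.
  by rewrite leq_add2r ltnW.
have Hp : pW [set m | expR (- (2 * beta * i%:R)) * A N < `|g m|] <= T n0 + parity_tail true n0.
  by apply: le_trans (le_pW sub) _; exact: pW_setU.
have n00 : (0 < n0)%N by rewrite (leq_trans _ Mn0)// !addn_gt0 Mpos.
have Tn0 : 0 < T n0 by exact: parity_tail_gt0.
have T12 : parity_tail true n0 <= (c1 + 1) * T n0.
  rewrite -ler_pdivrMr//; apply/ltW/HM2 => /=.
  by rewrite (leq_trans _ Mn0)// /M3 leq_addl.
have TT : T n0 <= expR ((nu + e) * i%:R) * T N.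
  have := HM n0 i; rewrite subnK//; apply.
  by rewrite (leq_trans _ Mn0)// /M3 -!addnA leq_addr.
rewrite [leRHS]mulrDl ler_wpDr//.
  by rewrite mulr_ge0 ?expR_ge0.
apply: (@le_trans _ _ (k N * ((c1 + 2) * (expR ((nu + e) * i%:R) * T N)))).
  rewrite ler_wpM2l//; apply: le_trans Hp _.
  apply: (@le_trans _ _ ((c1 + 2) * T n0)); first by move: T12; lra.
  by rewrite ler_wpM2l.
rewrite (_ : k N * _ = (k N * T N) * ((c1 + 2) * expR ((nu + e) * i%:R))); last by ring.
rewrite -[leRHS]mulrA ler_wpM2r ?mulr_ge0 ?expR_ge0//; exact: ltW.
Unshelve. all: by end_near. Qed.

(** Interpolation between the scales of [tail_bound]: rounding up [- ln y / (2 * beta)] costs a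
    factor [expR (2 * beta * a)]. From 1 to [V] the tail is at most its value at 1, and [V ^ a]
    compensates the decrease of [y ^ (- a)]. *)
Lemma tail_bound_powR (a V : R) : nu / (2 * beta) < a -> 1 <= V -> exists2 C : R, 0 <= C &
  \forall N \near \oo, forall y : R, 0 < y -> y <= V ->
    k N * pW [set m | y * A N < `|g m|] <= C * y `^ (- a).
Proof.
move=> na V1; have a0 : 0 < a by rewrite (lt_trans _ na)// divr_gt0.
(* This choice of [e] turns the rate [nu + e] into [2 * beta * a]. *)
have e0 : 0 < 2 * beta * a - nu by rewrite subr_gt0 mulrC -ltr_pdivrMr.
have [C C0 HC] := tail_bound e0; rewrite addrC subrK in HC.
have V0 : 0 < V by rewrite (lt_le_trans ltr01).
have C'0 : 0 <= C * expR (2 * beta * a) by rewrite mulr_ge0// expR_ge0.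
exists (C * expR (2 * beta * a) * V `^ a); first by rewrite mulr_ge0// powR_ge0.
near=> N => y y0 yV.
have AN : 0 < A N by near: N; apply: cvgry_gt; exact: A_cvgy.
have HN : forall i : nat,
    k N * pW [set m | expR (- (2 * beta * i%:R)) * A N < `|g m|] <= C * expR (2 * beta * a * i%:R).
  by near: N; exact: HC.
have small z : 0 < z -> z <= 1 ->
    k N * pW [set m | z * A N < `|g m|] <= C * expR (2 * beta * a) * z `^ (- a).
  move=> z0 z1; pose x := - ln z / (2 * beta).
  have x0 : 0 <= x by rewrite divr_ge0 ?(ltW b2)// oppr_ge0 ln_le0.
  have [i iE] : exists i : nat, Num.ceil x = i.
    by exists (absz (Num.ceil x)); rewrite gez0_abs// ceil_ge0 (lt_le_trans _ x0)// ltrN10.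
  have /andP[+ xi] := ceil_itv x; rewrite iE intrB => ix.
  rewrite iE in xi.
  have E1 : - ln z = 2 * beta * x by rewrite /x mulrC divfK// gt_eqF.
  apply: (@le_trans _ _ (k N * pW [set m | expR (- (2 * beta * i%:R)) * A N < `|g m|])).
    rewrite ler_wpM2l//; apply: le_pW => // m /=; apply: le_lt_trans.
    rewrite ler_wpM2r ?(ltW AN)// -[leRHS](@lnK _ z) ?posrE// ler_expR lerNl E1.
    by rewrite ler_pM2l.
  apply: le_trans (HN i) _; rewrite -[leRHS]mulrA ler_wpM2l// /powR gt_eqF// -expRD ler_expR.
  rewrite (_ : - a * ln z = 2 * beta * a * x); last by rewrite mulNr -mulrN E1; ring.
  rewrite -[X in X + _]mulr1 -mulrDr ler_wpM2l//.
    by rewrite mulr_ge0 ?ltW.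
  by rewrite addrC -lerBlDr ltW.
have [y1|y1] := leP y 1.
  apply: le_trans (small y y0 y1) _; rewrite ler_wpM2r ?powR_ge0//.
  by rewrite ler_peMr// -(powRr0 V) ler_powR// ltW.
apply: (@le_trans _ _ (k N * pW [set m | 1 * A N < `|g m|])).
  rewrite ler_wpM2l//; apply: le_pW => // m /=; apply: le_lt_trans.
  by rewrite ler_wpM2r ?ltW.
apply: le_trans (small 1 _ (lexx _)) _; first exact: ltr01.
rewrite powR1 mulr1 -[leRHS]mulrA ler_peMr// powRN ler_pdivlMr ?powR_gt0// mul1r.
by rewrite ge0_ler_powR ?nnegrE// ltW.
Unshelve. all: by end_near. Qed.

(** Beyond [V] the scaled tail meets no level [u >= 1]; the power bound is therefore required on ]0,
    V] only. *)
Lemma tail_small : exists2 V : R, 1 <= V &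
  \forall N \near \oo, k N * pW [set m | V * A N < `|g m|] < 1.
Proof.
have [J HJ] : exists J : nat, (1 + c1) * expR (- nu * J%:R) < 1.
  have H : (fun J : nat => (1 + c1) * expR (- (nu * J%:R))) @ \oo --> (0 : R).
    rewrite -(mulr0 (1 + c1)); apply: cvgMr.
    apply: (cvg_comp _ (fun x : R => expR (- x)) _ (@cvgr_expR R)).
    by apply: cvgy_scale => //; exact: cvgr_idn.
  have [J _ HJ] : \forall J \near \oo, (1 + c1) * expR (- (nu * J%:R)) < 1.
    by apply: (cvgr_lt (0 : R)).
  by exists J; rewrite mulNr; apply: HJ => /=.
(* The offset [1 / 4] keeps both [v + 1] and [v + 1 / 2] away from the integers, so that the two
   tail limits apply at [V]. *)
pose v : R := J%:R + 4^-1; pose V := expR (2 * beta * v).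
have V0 : 0 < V by exact: expR_gt0.
have VE : (2 * beta)^-1 * ln V = v by rewrite /V expRK mulKf// gt_eqF.
have jE0 : (J%:Z)%:~R = J%:R :> R by [].
have jE : (J.+1%:Z)%:~R = J%:R + 1 :> R by rewrite natr1.
have f1 : Num.floor (v + 1) = J.+1%:Z.
  by apply: floor_def; rewrite /v intrD jE; apply/andP; split; lra.
have f2 : Num.floor (v + 2^-1) = J%:Z.
  by apply: floor_def; rewrite /v intrD jE0; apply/andP; split; lra.
have n1 : (Num.floor ((2 * beta)^-1 * ln V + 1))%:~R != (2 * beta)^-1 * ln V + 1.
  by rewrite VE f1 /v jE lt_eqF//; lra.
have n2 : (Num.floor ((2 * beta)^-1 * ln V + 2^-1))%:~R != (2 * beta)^-1 * ln V + 2^-1.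
  by rewrite VE f2 /v jE0 lt_eqF//; lra.
have L1 := upper_tail_limit V0 n1; have L2 := lower_tail_limit V0 n2.
have LD : (fun N => k N * pW [set m | V * A N < signed_amp m] +
    k N * pW [set m | signed_amp m <= - (V * A N)]) @ \oo -->
    geo_tail nu beta 1 1 V + geo_tail nu beta c1 2^-1 V by exact: cvgD.
exists V; first by rewrite -expR0 ler_expR mulr_ge0 ?(ltW b2)// /v addr_ge0.
near=> N.
apply: (@le_lt_trans _ _ (k N * pW [set m | V * A N < signed_amp m] +
    k N * pW [set m | signed_amp m <= - (V * A N)])).
  rewrite -mulrDr ler_wpM2l//; apply: le_trans (pW_setU _ _).
  apply: le_pW => // m /=; rewrite /signed_amp -signr_odd.
  have -> : `|g m| = `|g m * (-1) ^+ odd m| by rewrite [RHS]normrM normrX normrN1 expr1n mulr1.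
  rewrite lter_normr => /orP[|] H; first by left.
  by right; rewrite lerNr ltW.
near: N; apply: (cvgr_lt _ LD).
rewrite /geo_tail VE f1 f2 mul1r; apply: le_lt_trans HJ.
rewrite mulrDl mul1r lerD2r ler_expR !mulNr lerN2 ler_wpM2l ?(ltW nu_gt0)//.
by rewrite ler_nat.
Unshelve. all: by end_near. Qed.

End counting_variable.

(** * Convergence of the rescaled quantiles *)

Section geo_convergence.
Context (R : realType).
Local Notation lam := (@lebesgue_measure R).
Variables (nu beta : R).
Hypotheses (nu_gt0 : 0 < nu) (beta_gt0 : 0 < beta).
Variables (c th : R).
Hypothesis c_ge0 : 0 <= c.

Let b2 : 0 < 2 * beta. Proof. by rewrite mulr_gt0. Qed.

(* Excludes the discontinuities of [geo_tail nu beta c th]. *)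
Definition off_lattice (x : R) : Prop :=
  (Num.floor ((2 * beta)^-1 * ln x + th))%:~R != (2 * beta)^-1 * ln x + th.

Lemma off_lattice_dense (x y : R) : 0 <= x -> x < y ->
  exists z, [/\ x < z, z < y & off_lattice z].
Proof.
move=> x0 xy; pose x' := (x + y) / 2.
have xx' : x < x' by rewrite /x'; lra.
have x'y : x' < y by rewrite /x'; lra.
have x'0 : 0 < x' by lra.
have y0 : 0 < y by lra.
pose l s := (2 * beta)^-1 * ln s + th.
have [z [z1 z2 nz]] : exists z, [/\ l x' < z, z < l y & (Num.floor z)%:~R != z].
  have lxy : l x' < l y by rewrite /l ltrD2r ltr_pM2l ?invr_gt0// ltr_ln.
  pose z0 := (l x' + l y) / 2.
  have [z0E|z0N] := eqVneq (Num.floor z0)%:~R z0; last first.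
    by exists z0; split=> //; rewrite /z0; lra.
  pose z := (z0 + Num.min (l y) (z0 + 1)) / 2.
  have zm : z0 < Num.min (l y) (z0 + 1).
    by rewrite lt_min ltrDl ltr01 andbT /z0; lra.
  have m1 : Num.min (l y) (z0 + 1) <= l y by rewrite ge_min lexx.
  have m2 : Num.min (l y) (z0 + 1) <= z0 + 1 by rewrite ge_min lexx orbT.
  exists z; split; [rewrite /z; move: zm; rewrite {1}/z0|rewrite /z|].
  - by rewrite /z0; lra.
  - by lra.
  - have -> : Num.floor z = Num.floor z0.
      by apply: floor_def; rewrite intrD z0E /z; apply/andP; split; lra.
    by rewrite z0E lt_eqF// /z; lra.
pose w := expR (2 * beta * (z - th)).
have wE : l w = z by rewrite /l /w expRK mulKf ?subrK// gt_eqF.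
have lK s : 0 < s -> expR (2 * beta * (l s - th)) = s.
  by move=> s0; rewrite /l addrK mulVKf ?gt_eqF// lnK.
exists w; split; last by rewrite /off_lattice -/(l w) wE.
- rewrite (lt_trans xx')// -(lK x')// ltr_expR ltr_pM2l// ltrD2r//.
- by rewrite -(lK y)// ltr_expR ltr_pM2l// ltrD2r.
Qed.

(** Points off the lattice are dense, so some lie just on each side of the quantile. As [u] is not a
    value of [geo_tail], the tail is strictly below [u] at the right ones, and by Galois strictly
    above at the left ones. *)
Lemma geo_squeeze (u : R) (p : nat -> R) : 0 < u -> (forall n, 0 <= p n) ->
  (forall x, 0 < x -> geo_tail nu beta c th x <> u) ->
  (forall x, 0 < x -> off_lattice x -> u < geo_tail nu beta c th x ->
    \forall n \near \oo, x <= p n) ->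
  (forall x, 0 < x -> off_lattice x -> geo_tail nu beta c th x < u ->
    \forall n \near \oo, p n <= x) ->
  p @ \oo --> geo_quantile nu beta c th u.
Proof.
move=> u0 p0 Gu plo pup; set q := geo_quantile nu beta c th u.
have q0 : 0 <= q by exact: geo_quantile_ge0.
apply/cvgrPdist_lt => e e0.
have [x [qx xe xl]] : exists z, [/\ q < z, z < q + e & off_lattice z].
  by apply: off_lattice_dense => //; rewrite ltrDl.
have x0 : 0 < x by exact: le_lt_trans qx.
have Gxu : geo_tail nu beta c th x < u.
  rewrite lt_neqAle; apply/andP; split; first by apply/eqP; exact: Gu.
  by rewrite leNgt (geo_galois nu_gt0 beta_gt0)// -leNgt ltW.
have H1 := pup x x0 xl Gxu.
have H2 : \forall n \near \oo, q - e < p n.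
  have [qe|qe] := ltP (q - e) 0; first by apply: nearW => n; exact: lt_le_trans (p0 n).
  have [y [qy yq yl]] : exists z, [/\ q - e < z, z < q & off_lattice z].
    by apply: off_lattice_dense => //; rewrite gtrBl.
  have y0 : 0 < y by exact: le_lt_trans qy.
  have uG : u < geo_tail nu beta c th y by rewrite (geo_galois nu_gt0 beta_gt0).
  by apply: filterS (plo y y0 yl uG) => n; exact: lt_le_trans.
near=> n.
have A : p n <= x by near: n.
have B : q - e < p n by near: n.
by rewrite ltr_norml; apply/andP; split; lra.
Unshelve. all: by end_near. Qed.

Lemma geo_levels_negligible :
  {ae lam, forall u : R, forall x, 0 < x -> geo_tail nu beta c th x <> u}.
Proof.
pose S := range (fun j : int => c * expR (- nu * j%:~R)).
have cS : countable S.
  apply: (@card_le_trans _ _ _ [set: int]); [exact: card_image_le|exact: countableP].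
exists S; split.
- exact: countable_measurable cS.
- exact: countable_lebesgue_measure0 cS.
- move=> u /= /existsNP[x /not_implyP[x0 /contrapT <-]].
  by exists (Num.floor ((2 * beta)^-1 * ln x + th)).
Qed.

End geo_convergence.

Section array_convergence.
Context (R : realType) (m : probability R R).
Local Notation lam := (@lebesgue_measure R).
Let F := cdf m.
Variables (kn : nat -> nat) (A : nat -> R).
Local Notation k n := ((kn n)%:R : R).
Hypotheses (koo : (fun n => k n) @ \oo --> +oo) (A0 : \forall n \near \oo, 0 < A n).

Let near_unit (u : R) : 0 < u -> \forall n \near \oo, [/\ 0 < A n, u < k n, 0 < u / k n & u / k n < 1].
Proof.
move=> u0; near=> n.
have un : u < k n by near: n; exact: cvgry_gt.
have k0 : 0 < k n by exact: lt_trans un.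
split=> //; [by near: n|by rewrite divr_gt0|by rewrite ltr_pdivrMr// mul1r].
Unshelve. all: by end_near. Qed.

Section convergence.
Variables (nu beta c th : R).
Hypotheses (nu_gt0 : 0 < nu) (beta_gt0 : 0 < beta) (c_ge0 : 0 <= c).

Lemma lower_array_cvg :
  (forall x, 0 < x -> off_lattice beta th x ->
    (fun n => k n * F (- (x * A n))) @ \oo --> geo_tail nu beta c th x) ->
  {ae lam, forall u : R, `]0%R, +oo[%classic u ->
    (fun n => lower_array m (k n) (A n) u) @ \oo --> geo_quantile nu beta c th u}.
Proof.
move=> tail; have aeF := ae_filter_ringOfSetsType lam.
apply: filterS (geo_levels_negligible nu beta c th) => u Gu /=.
rewrite in_itv/= andbT => u0.
apply: (geo_squeeze nu_gt0 beta_gt0) => // [n|x x0 xl uG|x x0 xl Gu'].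
- exact: lower_array_ge0.
- near=> n.
  have [An un s0 s1] : [/\ 0 < A n, u < k n, 0 < u / k n & u / k n < 1] by near: n; exact: near_unit.
  have H : u < k n * F (- (x * A n)) by near: n; apply: (cvgr_gt _ (tail x x0 xl)).
  rewrite /lower_array u0 un/= le_max; apply/orP; right.
  rewrite lerNr ler_pdivrMr// mulNr quantile_le// ler_pdivrMr ?(lt_trans u0)//.
  by rewrite mulrC ltW.
- near=> n.
  have [An un s0 s1] : [/\ 0 < A n, u < k n, 0 < u / k n & u / k n < 1] by near: n; exact: near_unit.
  have H : k n * F (- (x * A n)) < u by near: n; apply: (cvgr_lt _ (tail x x0 xl)).
  rewrite /lower_array u0 un/= ge_max (ltW x0)/= lerNl ler_pdivlMr// mulNr ltW//.
  by rewrite ltNge quantile_le// -ltNge ltr_pdivlMr ?(lt_trans u0)// mulrC.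
Unshelve. all: by end_near. Qed.

Lemma upper_array_cvg :
  (forall x, 0 < x -> off_lattice beta th x ->
    (fun n => k n * (1 - F (x * A n))) @ \oo --> geo_tail nu beta c th x) ->
  {ae lam, forall u : R, `]0%R, +oo[%classic u ->
    (fun n => upper_array m (k n) (A n) u) @ \oo --> geo_quantile nu beta c th u}.
Proof.
move=> tail; have aeF := ae_filter_ringOfSetsType lam.
apply: filterS (geo_levels_negligible nu beta c th) => u Gu /=.
rewrite in_itv/= andbT => u0.
apply: (geo_squeeze nu_gt0 beta_gt0) => // [n|x x0 xl uG|x x0 xl Gu'].
- exact: upper_array_ge0.
- near=> n.
  have [An un s0 s1] : [/\ 0 < A n, u < k n, 0 < u / k n & u / k n < 1] by near: n; exact: near_unit.
  have H : u < k n * (1 - F (x * A n)) by near: n; apply: (cvgr_gt _ (tail x x0 xl)).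
  have k0 : 0 < k n by exact: lt_trans un.
  have t0 : 0 < 1 - u / k n by rewrite subr_gt0.
  have t1 : 1 - u / k n < 1 by rewrite gtrBl.
  rewrite /upper_array u0 un/= le_max; apply/orP; right.
  rewrite ler_pdivlMr// ltW// ltNge quantile_le// -ltNge ltrBrDr -ltrBrDl.
  by rewrite ltr_pdivrMr// mulrC.
- near=> n.
  have [An un s0 s1] : [/\ 0 < A n, u < k n, 0 < u / k n & u / k n < 1] by near: n; exact: near_unit.
  have H : k n * (1 - F (x * A n)) < u by near: n; apply: (cvgr_lt _ (tail x x0 xl)).
  have k0 : 0 < k n by exact: lt_trans un.
  have t0 : 0 < 1 - u / k n by rewrite subr_gt0.
  have t1 : 1 - u / k n < 1 by rewrite gtrBl.
  rewrite /upper_array u0 un/= ge_max (ltW x0)/= ler_pdivrMr// quantile_le//.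
  by rewrite lerBlDr -lerBlDl ler_pdivlMr// mulrC ltW.
Unshelve. all: by end_near. Qed.

End convergence.

Section domination.
Variables (S : nat -> R -> R) (a V C : R).
Hypotheses (a_gt0 : 0 < a) (C_ge0 : 0 <= C).
(** [F (- (y * A n))] includes the endpoint while [S] will be a strict tail; halving [y] absorbs the
    difference. *)
Hypothesis S_lower : \forall n \near \oo, forall y, 0 < y -> k n * F (- (y * A n)) <= S n (y / 2).
Hypothesis S_upper : \forall n \near \oo, forall y, 0 < y -> k n * (1 - F (y * A n)) <= S n y.
Hypothesis S_pow : \forall n \near \oo, forall y, 0 < y -> y <= V -> S n y <= C * y `^ (- a).
Hypothesis S_small : \forall n \near \oo, forall y, V <= y -> S n y < 1.

(** Since [S n] is below 1 from [V] on, a level [u >= 1] can only be reached at some [w < V], where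
    the power bound may be inverted. *)
Let inverse_bound n u w : (forall y, 0 < y -> y <= V -> S n y <= C * y `^ (- a)) ->
  (forall y, V <= y -> S n y < 1) -> 1 <= u -> 0 < w -> u <= S n w ->
  w <= C `^ a^-1 * u `^ (- a^-1).
Proof.
move=> Sp Ss u1 w0 uS; have u0 : 0 < u by rewrite (lt_le_trans ltr01).
have [Vw|wV] := leP V w.
  by have := le_lt_trans (le_trans u1 uS) (Ss w Vw); rewrite ltxx.
have := le_trans uS (Sp w w0 (ltW wV)).
rewrite powRN ler_pdivlMr ?powR_gt0// mulrC -ler_pdivlMr// => H.
have -> : w = (w `^ a) `^ a^-1 by rewrite -powRrM divff ?gt_eqF// powRr1// ltW.
have -> : u `^ (- a^-1) = (u^-1) `^ a^-1 by rewrite -[u^-1]powR_inv1 ?(ltW u0)// -powRrM mulN1r.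
rewrite -powRM ?invr_ge0 ?(ltW u0)//.
by rewrite ge0_ler_powR ?nnegrE ?invr_ge0 ?powR_ge0 ?(ltW a_gt0)// mulr_ge0 ?invr_ge0 ?(ltW u0).
Qed.

Lemma array_domination : exists2 K : R, 0 <= K &
  (\forall n \near \oo, forall u, 1 <= u -> lower_array m (k n) (A n) u <= K * u `^ (- a^-1)) /\
  (\forall n \near \oo, forall u, 1 <= u -> upper_array m (k n) (A n) u <= K * u `^ (- a^-1)).
Proof.
(* The factor 2 comes from evaluating the tail at half the array entry: on the left through
   [S_lower], on the right to be strictly below the quantile. *)
exists (2 * C `^ a^-1); first by rewrite mulr_ge0// powR_ge0.
have Kge0 u : 0 <= 2 * C `^ a^-1 * u `^ (- a^-1) by rewrite !mulr_ge0// powR_ge0.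
split; near=> n => u u1; have u0 : 0 < u by rewrite (lt_le_trans ltr01).
- have An : 0 < A n by near: n.
  have Sp : forall y, 0 < y -> y <= V -> S n y <= C * y `^ (- a) by near: n.
  have Ss : forall y, V <= y -> S n y < 1 by near: n.
  have Sl : forall y, 0 < y -> k n * F (- (y * A n)) <= S n (y / 2) by near: n.
  rewrite /lower_array; case: ifP => [/andP[_ un]|//].
  rewrite ge_max Kge0/=; set v := - _.
  have [v0|v0] := leP v 0; first exact: le_trans (Kge0 u).
  have k0 : 0 < k n by exact: lt_trans un.
  rewrite -mulrA -ler_pdivrMl// mulrC; apply: (inverse_bound Sp Ss) => //; first by rewrite divr_gt0.
  apply: le_trans (Sl v v0); rewrite mulrC -ler_pdivrMr// -quantile_le ?divr_gt0//.
    by rewrite /v mulNr opprK divfK// gt_eqF.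
  by rewrite ltr_pdivrMr// mul1r.
- have An : 0 < A n by near: n.
  have Sp : forall y, 0 < y -> y <= V -> S n y <= C * y `^ (- a) by near: n.
  have Ss : forall y, V <= y -> S n y < 1 by near: n.
  have Su : forall y, 0 < y -> k n * (1 - F (y * A n)) <= S n y by near: n.
  rewrite /upper_array; case: ifP => [/andP[_ un]|//].
  rewrite ge_max Kge0/=; set v := _ / A n.
  have [v0|v0] := leP v 0; first exact: le_trans (Kge0 u).
  have k0 : 0 < k n by exact: lt_trans un.
  have w0 : 0 < v / 2 by rewrite divr_gt0.
  rewrite -mulrA -ler_pdivrMl// mulrC; apply: (inverse_bound Sp Ss) => //.
  apply: le_trans (Su _ w0); rewrite mulrC -ler_pdivrMr// lerBrDl -lerBrDr ltW//.
  rewrite ltNge -quantile_le ?subr_gt0 ?ltr_pdivrMr ?mul1r// ?gtrBl ?divr_gt0//.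
  rewrite -ltNge -ltr_pdivlMr// -/v; lra.
Unshelve. all: by end_near. Qed.

End domination.
End array_convergence.

(** * Convergence of the normalized sums *)

(** With [a], [b] the two means, [a cos + b sin <= (a ^ 2 + b ^ 2 + 1) / 2] pointwise; integrating
    makes the left side [a ^ 2 + b ^ 2]. *)
Lemma normc_chf_le1 d (T : measurableType d) (R : realType) (P : probability T R)
    (Y : T -> R) : measurable_fun setT Y ->
  Normc.normc ((\int[P]_w cos (Y w)) +i* (\int[P]_w sin (Y w)))%C <= 1.
Proof.
move=> mY; have bc := bmeas_cos mY; have bs := bmeas_sin mY.
set a := \int[P]_w cos (Y w); set b := \int[P]_w sin (Y w).
rewrite /Normc.normc -[leRHS]sqrtr1 ler_wsqrtr//.
have H : \int[P]_w (a * cos (Y w) + b * sin (Y w)) <= \int[P]_w ((a ^+ 2 + b ^+ 2 + 1) / 2).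
  apply: le_exp => [||w].
  - by apply: bmeasD; exact: bmeasZ.
  - exact: bmeas_cst.
  - have := cos2Dsin2 (Y w); have := sqr_ge0 (a - cos (Y w)); have := sqr_ge0 (b - sin (Y w)).
    by nra.
rewrite exp_cst expD ?expZ// in H; [|exact: bmeasZ|exact: bmeasZ].
by move: H; rewrite -/a -/b -!expr2; lra.
Qed.

Section small_argument.
Context (R : realType).
Local Notation lam := (@lebesgue_measure R).
Local Notation D0 := (`[0%R, +oo[%classic : set R).
Variables (q1 q2 : R -> R) (rho K : R).
Hypotheses (mq1 : measurable_fun setT q1) (mq2 : measurable_fun setT q2).
Hypotheses (q1_ge0 : forall u, 0 <= q1 u) (q2_ge0 : forall u, 0 <= q2 u).
Hypotheses (rho12 : 1 / 2 < rho) (K0 : 0 <= K).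
Hypothesis q1K : forall u, 1 <= u -> q1 u <= K * u `^ (- rho).
Hypothesis q2K : forall u, 1 <= u -> q2 u <= K * u `^ (- rho).

Let mD0 : @measurable _ (measurableTypeR R) D0. Proof. exact: measurable_itv. Qed.

Let side_cvg0 (q : R -> R) (h : nat -> R -> R) (C : R) :
  measurable_fun setT q -> (forall u, 0 <= q u) ->
  (forall u, 1 <= u -> q u <= K * u `^ (- rho)) ->
  (forall n, measurable_fun setT (h n)) ->
  (\forall n \near \oo, forall y, `|h n y| <= C * y ^+ 2 /\ `|h n y| <= C) ->
  (forall y, h ^~ y @ \oo --> (0 : R)) ->
  (fun n => \int[lam]_(u in D0) h n (q u)) @ \oo --> (0 : R).
Proof.
move=> mq q0 qK mh hC h0.
have E0 : \int[lam]_(u in D0) (fun=> 0 : R) u = 0 by rewrite /Rintegral integral0.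
rewrite -[X in _ --> X]E0 {E0}.
have r1 : 1 < 2 * rho by rewrite mulrC -ltr_pdivrMr.
have ih : lam.-integrable D0 (EFin \o (fun u => C * (1 + K ^+ 2) * hdom (2 * rho) u)).
  have H := @integrableZl _ (measurableTypeR R) R lam D0 mD0 (C * (1 + K ^+ 2)) _ (integrable_hdom r1).
  exact: H.
apply: (@Rintegral_dct _ (measurableTypeR R) R lam D0 _ _ _ mD0 _ _ _ ih).
- by move=> n; apply: measurable_funTS; exact: (measurableT_comp (mh n) mq).
- exact: measurable_cst.
- have aeF := ae_filter_ringOfSetsType lam.
  by apply: aeW => u _; exact: h0.
- apply: filterS hC => n hCn u Du.
  apply: (@hdom_bound R D0 rho K C (h n)) => //.
  + by move=> x _; have [] := hCn x.
  + by move=> v _ _ x _; have [] := hCn x.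
Qed.

Lemma levy_int_cvg0 (h : nat -> R -> R) (C : R) :
  (forall n, measurable_fun setT (h n)) ->
  (\forall n \near \oo, forall y, `|h n y| <= C * y ^+ 2 /\ `|h n y| <= C) ->
  (forall y, h ^~ y @ \oo --> (0 : R)) ->
  (fun n => levy_int q1 q2 (h n)) @ \oo --> (0 : R).
Proof.
move=> mh hC h0; rewrite -(addr0 (0 : R)); apply: cvgD; last exact: side_cvg0 hC _.
apply: (@side_cvg0 q1 (fun n x => h n (- x)) C) => //.
- by move=> n; apply: measurableT_comp => //; exact: measurable_funN.
- by apply: filterS hC => n hCn y; rewrite -sqrrN.
Qed.

(** The continuity at 0 required by [levy_continuity], tested along sequences [t n] by dominated
    convergence. *)
Lemma levy_chf_cvg1 (th : R) :
  (fun t : R => expR (levy_int q1 q2 (fun y => cos (t * y) - 1)) *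
    cos (levy_int q1 q2 (fun y => sin (t * y) - t * trunc1 y) + t * th)) @ (0 : R) --> (1 : R).
Proof.
apply/(@cvg_nbhsP _ R^o) => t t0.
have t1 : \forall n \near \oo, t n ^+ 2 <= 1 /\ `|t n| <= 1.
  have H : \forall n \near \oo, `|t n| < 1 by apply: cvgr0_norm_lt.
  apply: filterS H => n /ltW tn; split=> //.
  by rewrite -real_normK ?num_real// expr_le1.
have ty (y : R) : (fun n => t n * y) @ \oo --> (0 : R).
  by rewrite -[X in _ --> X](mul0r y); exact: cvgMl.
have re0 : (fun n => levy_int q1 q2 (fun y => cos (t n * y) - 1)) @ \oo --> (0 : R).
  (* For [|t| <= 1] both constants [2 + t ^ 2] and [1 + |t| + t ^ 2] are at most 3. *)
  apply: (@levy_int_cvg0 (fun n y => cos (t n * y) - 1) 3).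
  - by move=> n; exact: continuous_measurable_fun (@continuous_cosB1 R (t n)).
  - apply: filterS t1 => n [tn _] y; split.
      by apply: le_trans (cosB1_le _ _) _; rewrite ler_wpM2r ?sqr_ge0//; lra.
    by apply: le_trans (cosB1_le2 _ _) _; lra.
  - move=> y; have E0 : cos 0 - 1 = 0 :> R by rewrite cos0 subrr.
    rewrite -[X in _ --> X]E0; apply: cvgB; last exact: cvg_cst.
    exact: (cvg_comp (fun n => t n * y) cos (ty y) (@continuous_cos R 0)).
have im0 : (fun n => levy_int q1 q2 (fun y => sin (t n * y) - t n * trunc1 y)) @ \oo --> (0 : R).
  apply: (@levy_int_cvg0 (fun n y => sin (t n * y) - t n * trunc1 y) 3).
  - by move=> n; exact: continuous_measurable_fun (@continuous_sin_trunc R (t n)).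
  - apply: filterS t1 => n [tn tn'] y; split.
      by apply: le_trans (sin_trunc_le _ _) _; rewrite ler_wpM2r ?sqr_ge0//; lra.
    by apply: le_trans (sin_trunc_le1 _ _) _; lra.
  - move=> y; have E0 : sin 0 - 0 = 0 :> R by rewrite sin0 subrr.
    rewrite -[X in _ --> X]E0; apply: cvgB.
      exact: (cvg_comp (fun n => t n * y) sin (ty y) (@continuous_sin R 0)).
    exact: ty.
have E1 : expR 0 * cos (0 + 0 * th) = 1 :> R by rewrite mul0r addr0 expR0 cos0 mulr1.
rewrite -[X in _ --> X]E1; apply: cvgM.
  by apply: (cvg_comp _ _ re0); exact: continuous_expR.
apply: (cvg_comp (fun n => levy_int q1 q2 (fun y => sin (t n * y) - t n * trunc1 y) + t n * th)
  cos _ (@continuous_cos R _)).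
by apply: cvgD => //; exact: cvgMl.
Qed.

End small_argument.

Section centered_sums.
Context d (T : measurableType d) (R : realType) (P : probability T R).
Variables (Xs : nat -> {RV P >-> R}) (m : probability R R).
Hypothesis indep : mutually_independent Xs.
Hypothesis law : forall j B, measurable B -> m B = P (Xs j @^-1` B).
Variables (kn : nat -> nat) (A b : nat -> R) (re im : R -> R).
Local Notation k n := ((kn n)%:R : R).
Hypothesis koo : (fun n => k n) @ \oo --> +oo.
Hypothesis re_cvg : forall t, (fun n => k n * (\int[m]_x cos (t * (x / A n - b n)) - 1)) @ \oo --> re t.
Hypothesis im_cvg : forall t, (fun n => k n * \int[m]_x sin (t * (x / A n - b n))) @ \oo --> im t.
Hypothesis chf0 : (fun t => expR (re t) * cos (im t)) @ (0 : R) --> (1 : R).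

Lemma centered_sum_limit : exists mu : probability R R,
  [/\ forall y, {for y, continuous (cdf mu)} ->
        (fun n => fine (P [set w | \sum_(1 <= j < (kn n).+1) (Xs j w / A n - b n) <= y])) @ \oo --> cdf mu y,
      forall t, \int[mu]_x cos (t * x) = expR (re t) * cos (im t) &
      forall t, \int[mu]_x sin (t * x) = expR (re t) * sin (im t)].
Proof.
pose S n w : R := \sum_(1 <= j < (kn n).+1) (Xs j w / A n - b n).
have mS n : measurable_fun setT (S n).
  apply: measurable_sum => j; apply: measurable_funB => //; exact: measurable_funM.
pose SR n : {RV P >-> R} := mfun_Sub (mem_set (mS n)).
pose m_ n : probability R R := distribution P (SR n).
have mE n B : measurable B -> m_ n B = P (S n @^-1` B) by [].
have mth (t : R) n : measurable_fun setT (fun x : R => t * (x / A n - b n)).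
  by apply: measurable_funM => //; apply: measurable_funB => //; exact: measurable_funM.
have mcos : measurable_fun setT (@cos R) by exact: continuous_measurable_fun (@continuous_cos R).
have msin : measurable_fun setT (@sin R) by exact: continuous_measurable_fun (@continuous_sin R).
pose c (t : R) n := \int[m]_x cos (t * (x / A n - b n)).
pose s (t : R) n := \int[m]_x sin (t * (x / A n - b n)).
have chfE t n : \int[m_ n]_x cos (t * x) = complex.Re ((c t n +i* s t n)%C ^+ kn n) /\
    \int[m_ n]_x sin (t * x) = complex.Im ((c t n +i* s t n)%C ^+ kn n).
  have mt : measurable_fun setT (fun x : R => t * x) by exact: measurable_funM.
  rewrite (Rintegral_law (mS n) (@mE n) (measurableT_comp mcos mt)).
  rewrite (Rintegral_law (mS n) (@mE n) (measurableT_comp msin mt)).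
  have U : uniq (index_iota 1 (kn n).+1 ++ [::]) by rewrite cats0 iota_uniq.
  have := @exp_cos_sin_sum _ _ _ _ _ indep (fun _ x => t * (x / A n - b n)) _ [::] (fun _ _ => 0)
    (fun=> mth t n) U (fun=> bmeas_cst _ _).
  rewrite /= !big_nil !mulr1.
  under eq_bigr => j _.
    rewrite -(Rintegral_law _ (@law j) (measurableT_comp mcos (mth t n)))//.
    rewrite -(Rintegral_law _ (@law j) (measurableT_comp msin (mth t n)))//.
    over.
  rewrite prodr_const_nat subn1/= => -[<- <-].
  by split; apply: eq_Rintegral => w _; rewrite /S mulr_sumr mulr1.
have zle t n : Normc.normc (c t n +i* s t n)%C <= 1.
  exact: normc_chf_le1.
have [||mu [H1 H2 H3]] := levy_continuity (m_ := m_) (C := fun t => expR (re t) * cos (im t))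
   (S := fun t => expR (re t) * sin (im t)) _ _ chf0.
- move=> t; have [+ _] := power_limit koo (zle t) (@re_cvg t) (@im_cvg t).
  by apply: cvg_trans; apply: near_eq_cvg; apply: nearW => n; have [-> _] := chfE t n.
- move=> t; have [_ +] := power_limit koo (zle t) (@re_cvg t) (@im_cvg t).
  by apply: cvg_trans; apply: near_eq_cvg; apply: nearW => n; have [_ ->] := chfE t n.
by exists mu; split.
Qed.

End centered_sums.

Theorem theorem3p1 (d : measure_display) (Omega : measurableType d)
  (R : realType) (P : probability Omega R)
  (W : Omega -> nat) (mW : measurable_fun setT W)
  (nu beta c1 : R) (h1 h2 L : R -> R) (Xs : nat -> {RV P >-> R})
  (nu_gt0 : 0 < nu) (beta_gt0 : 0 < beta) (c1_ge0 : 0 <= c1)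
  (h1_pos : forall x, 0 < x -> 0 < h1 x)
  (h2_pos : forall x, 0 < x -> 0 < h2 x)
  (h21 : (fun x => h2 x / h1 x) @ +oo --> c1)
  (h1_reg : forall e : R, 0 < e -> exists M delta : R, 0 < delta /\
      forall x a : R, M < x -> `|a - 1| < delta -> `|h1 (a * x) / h1 x - 1| < e)
  (W_even : forall x : R, 0 < x ->
     P [set w | x <= (W w)%:R / 2 /\ ~~ odd (W w)] =
     (h1 (Num.ceil x)%:~R * expR (- nu * (Num.ceil x)%:~R))%:E)
  (W_odd : forall x : R, 0 < x ->
     P [set w | x <= ((W w)%:R - 1) / 2 /\ odd (W w)] =
     (h2 (Num.ceil x)%:~R * expR (- nu * (Num.ceil x)%:~R))%:E)
  (L_sv : slowly_varying L)
  (L_mono : exists N : nat, forall n m : nat, (N <= n)%N -> (n <= m)%N ->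
      L (expR n%:R) <= L (expR m%:R))
  (alpha_lt2 : nu / (2 * beta) < 2) :
  let X : Omega -> R := fun w =>
    L (expR (W w)%:R) * expR (beta * (W w)%:R) * (-1) ^+ W w in
  mutually_independent Xs ->
  (forall j, same_law P (Xs j) X) ->
  let F : R -> R := fun y => fine (P [set w | X w <= y]) in
  let Q : R -> R := fun s => inf [set y | s <= F y] in
  let k : nat -> nat := fun n =>
    absz (Num.ceil (expR ((n%:R - 1) * nu) / h1 (n%:R - 1))) in
  let A : nat -> R := fun n =>
    L (expR (2 * n%:R - 2)) * expR (2 * beta * (n%:R - 1)) in
  let B : nat -> R := fun n =>
    (k n)%:R * Rintegral lebesgue_measure `[(k n)%:R^-1, 1 - (k n)%:R^-1] Q in
  let ML : R -> R := fun y =>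
    c1 * expR (- nu * ((Num.floor (2^-1 + (2 * beta)^-1 * ln (- y)))%:~R
                        - (2 * beta)^-1 * ln (- y))) in
  let MR : R -> R := fun x =>
    expR (- nu * ((Num.floor ((2 * beta)^-1 * ln x) + 1)%:~R
                   - (2 * beta)^-1 * ln x)) in
  exists mu : probability R R,
    semistable_law (nu / (2 * beta)) ML MR mu /\
    cvg_in_distribution P
      (fun n w => (A n)^-1 * (\sum_(1 <= j < (k n).+1) Xs j w - B n)) mu.
Proof.
move=> X indep law F Q k A B ML MR.
pose m : probability R R := distribution P (Xs 0).
have lawX C : measurable C -> m C = P (X @^-1` C) by exact: law.
have lawj j C : measurable C -> m C = P (Xs j @^-1` C) by move=> mC; rewrite lawX// law.
have FW z : cdf m z = pW P W [set i | signed_amp beta L i <= z].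
  by rewrite /cdf lawX.
have FcW z : 1 - cdf m z = pW P W [set i | z < signed_amp beta L i].
  rewrite FW -pW_setC//; congr (pW _ _ _).
  by apply/seteqP; split=> i /=; rewrite ltNge => /negP.
have FE : F = cdf m by apply/funext => z; rewrite FW.
have QE : Q = quantile (cdf m) by rewrite -FE.
pose kN := num_terms nu h1; pose AN (N : nat) := amp beta L (2 * N%:R).
have nN (N : nat) : N.+1%:R - 1 = N%:R :> R by rewrite -natr1 addrK.
have kE N : k N.+1 = kN N by rewrite /k nN.
have AE N : A N.+1 = AN N.
  rewrite /A /AN /amp nN (_ : 2 * N.+1%:R - 2 = 2 * N%:R); last by rewrite -natr1; ring.
  by congr (_ * expR _); ring.
have koo := num_terms_cvgy mW nu_gt0 h1_pos h2_pos h21 h1_reg W_even W_odd.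
have AN0 : \forall N \near \oo, 0 < AN N.
  by apply: cvgry_gt; exact: (A_cvgy beta_gt0 L_sv L_mono).
have [M0 growth] := amp_growth beta L_sv L_mono.
have signed_tail b i : odd i = b -> (M0.+1.*2 + b <= i)%N ->
    0 < (-1) ^+ b * signed_amp beta L i.
  move=> ib Mi; have Mi' : (M0 <= i)%N.
    by rewrite (leq_trans _ Mi)// -addnn -addnA (leq_trans (leqnSn _))// leq_addr.
  have [g0 _] := growth i i Mi' (leqnn i).
  by rewrite /signed_amp mulrCA -(signr_odd R i) ib -expr2 sqrr_sign mulr1.
have tail0 b := parity_tail_gt0 mW h1_pos h2_pos W_even W_odd b (ltn0Sn M0).
(* [W] charges arbitrarily large integers of both parities, where [L] is positive, so [X] takes
   values of both signs; the identity for the centering needs 0 strictly between the extreme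
   quantiles. *)
have F0 : 0 < cdf m 0.
  rewrite FW (lt_le_trans (tail0 true))//; apply: le_pW => // i /= [ib Mi].
  by have := signed_tail _ _ ib Mi; rewrite expr1 mulN1r oppr_gt0 => /ltW.
have F1 : cdf m 0 < 1.
  rewrite -subr_gt0 FcW (lt_le_trans (tail0 false))//; apply: le_pW => // i /= [ib Mi].
  by have := signed_tail _ _ ib Mi; rewrite expr0 mul1r.
have cvg1 : {ae lebesgue_measure, forall u : R, `]0%R, +oo[%classic u ->
    (fun N => lower_array m (kN N)%:R (AN N) u) @ \oo --> geo_quantile nu beta c1 2^-1 u}.
  apply: lower_array_cvg => // x x0 xl.
  rewrite (_ : (fun N => _) = fun N => (kN N)%:R *
      pW P W [set i | signed_amp beta L i <= - (x * AN N)]); last first.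
    by apply/funext => N; rewrite FW.
  exact: (lower_tail_limit mW nu_gt0 h1_pos h2_pos h21 h1_reg W_even W_odd beta_gt0 L_sv L_mono).
have cvg2 : {ae lebesgue_measure, forall u : R, `]0%R, +oo[%classic u ->
    (fun N => upper_array m (kN N)%:R (AN N) u) @ \oo --> geo_quantile nu beta 1 1 u}.
  apply: upper_array_cvg => // x x0 xl.
  rewrite (_ : (fun N => _) = fun N => (kN N)%:R *
      pW P W [set i | x * AN N < signed_amp beta L i]); last first.
    by apply/funext => N; rewrite FcW.
  exact: (upper_tail_limit mW nu_gt0 h1_pos h2_pos h21 h1_reg W_even W_odd beta_gt0 L_sv L_mono).
have [V V1 small] := tail_small mW nu_gt0 h1_pos h2_pos h21 h1_reg W_even W_odd beta_gt0 L_sv L_mono.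
(* Above the index, as [tail_bound_powR] requires, and below 2, so that [a^-1 > 1 / 2]. *)
pose a := (nu / (2 * beta) + 2) / 2.
have na : nu / (2 * beta) < a by rewrite /a; lra.
have al0 : 0 < nu / (2 * beta) by rewrite divr_gt0// mulr_gt0.
have a0 : 0 < a by exact: lt_trans na.
have a2 : 1 / 2 < a^-1 by rewrite div1r ltf_pV2 ?posrE// /a; lra.
have [C C0 bound] := tail_bound_powR mW nu_gt0 c1_ge0 h1_pos h2_pos h21 h1_reg
  W_even W_odd beta_gt0 L_sv L_mono na V1.
pose S N y := (kN N)%:R * pW P W [set i | y * AN N < `|amp beta L i%:R|].
have norm_amp i : `|signed_amp beta L i| = `|amp beta L i%:R|.
  by rewrite [LHS]normrM normrX normrN1 expr1n mulr1.
have [K K0 [dom1 dom2]] : exists2 K : R, 0 <= K &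
  (\forall n \near \oo, forall u, 1 <= u -> lower_array m (kN n)%:R (AN n) u <= K * u `^ (- a^-1)) /\
  (\forall n \near \oo, forall u, 1 <= u -> upper_array m (kN n)%:R (AN n) u <= K * u `^ (- a^-1)).
  apply: (@array_domination R m kN AN AN0 S a V C a0 C0) => //.
  - apply: filterS AN0 => N An y y0; rewrite FW ler_wpM2l//; apply: le_pW => // i /=.
    move=> H; rewrite -norm_amp.
    have : signed_amp beta L i < 0 by rewrite (le_lt_trans H)// oppr_lt0 mulr_gt0.
    move=> /ltr0_norm ->; move: H; rewrite lerNr; apply: lt_le_trans.
    by rewrite ltr_pM2r// ltr_pdivrMr// mulr_natr mulr2n ltrDl.
  - apply: nearW => N y y0; rewrite FcW ler_wpM2l//; apply: le_pW => // i /= H.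
    by rewrite -norm_amp (lt_le_trans H)// ler_norm.
  - apply: filterS2 AN0 small => N An H y Vy; apply: le_lt_trans H.
    rewrite ler_wpM2l//; apply: le_pW => // i /=; apply: le_lt_trans.
    by rewrite ler_wpM2r// ltW.
pose b N := \int[lebesgue_measure]_(s in `[(kN N)%:R^-1, 1 - (kN N)%:R^-1])
  quantile (cdf m) s / AN N.
have limit t := array_limit koo AN0 F0 F1
  (measurable_funTS (measurable_geo_quantile nu beta c1 2^-1))
  (measurable_funTS (measurable_geo_quantile nu beta 1 1))
  cvg1 cvg2 a2 K0 dom1 dom2 t.
(* The limiting quantiles are bounded directly, with their own exponent [2 * beta / nu]. *)
have [K' K'0 qK] := geo_quantiles_le nu_gt0 beta_gt0 2^-1 1 c1_ge0 (@ler01 R).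
have chf0 := levy_chf_cvg1 (measurable_geo_quantile nu beta c1 2^-1)
  (measurable_geo_quantile nu beta 1 1) (geo_quantile_ge0 nu beta c1 2^-1)
  (geo_quantile_ge0 nu beta 1 1) (quantile_rho nu_gt0 beta_gt0 alpha_lt2) K'0
  (fun u u1 => (qK u u1).1) (fun u u1 => (qK u u1).2)
  (Theta (geo_quantile nu beta 1 1) - Theta (geo_quantile nu beta c1 2^-1)).
have [mu [mu_cdf mu_cos mu_sin]] := centered_sum_limit indep lawj koo
  (fun t => proj1 (limit t)) (fun t => proj2 (limit t)) chf0.
exists mu; split.
  by apply: semistable_law_of_chf => // t.
have sumE N w : (A N.+1)^-1 * (\sum_(1 <= j < (k N.+1).+1) Xs j w - B N.+1) =
    \sum_(1 <= j < (kN N).+1) (Xs j w / AN N - b N).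
  rewrite /B AE kE QE sumrB -mulr_suml sumr_const_nat subn1/= -[X in _ = _ - X]mulr_natl /b.
  by rewrite [LHS]mulrC mulrBl mulrA.
move=> y cy; rewrite -cvg_shiftS; have := mu_cdf y cy.
apply: cvg_trans; apply: near_eq_cvg; apply: nearW => N.
by congr (fine (P _)); apply/seteqP; split=> w /=; rewrite sumE.
Qed.
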